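(* For all integers $n, m\geq 1$ and $1\leq r\leq 2m+1$, the maximum forcing number of the quadriculated torus $T(2n,2m+1,r)$ is $$F(T(2n,2m+1,r))=(m+1)n.$$
   Context: Quadriculated torus: for integers $p\ge 2$, $q\ge 3$ and $1\le s\le q$, the quadriculated torus $T(p,q,s)$ is the graph obtained from a $p\times q$ chessboard ($p$ rows, each consisting of $q$ squares) by sticking the left and right sides together and then identifying the top and bottom sides with a torsion of $s$ squares. Explicitly, $T(p,q,s)$ is the simple graph with vertex set $\{v_{i,j} : i\in\{0,\dots,p-1\},\ j\in \mathbb{Z}/q\mathbb{Z}\}$, whose edges are: $v_{i,j}v_{i,j+1}$ for all $i,j$ (second index modulo $q$); $v_{i,j}v_{i+1,j}$ for $0\le i\le p-2$ and all $j$; and $v_{0,j}v_{p-1,j-s}$ for all $j$ (second index modulo $q$). Forcing numbers: let $G$ be a finite graph with a perfect matching $M$. A subset $S\subseteq M$ is a forcing set of $M$ if $S$ is contained in no perfect matching of $G$ other than $M$. The forcing number $f(G,M)$ is the smallest cardinality of a forcing set of $M$. The maximum forcing number $F(G)$ is the maximum of $f(G,M)$ over all perfect matchings $M$ of $G$. *)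

(* Defs.v *)
From mathcomp Require Import all_boot.

Set Implicit Arguments.
Unset Strict Implicit.
Unset Printing Implicit Defensive.

(* A finite simple graph is given by a symmetric irreflexive relation on a
   finType; its edges are the two-element sets of adjacent vertices. *)
Section Forcing.
Variables (V : finType) (adj : rel V).
Implicit Types M S : {set {set V}}.

Definition edges : {set {set V}} := [set [set u; v] | u in V, v in V & adj u v].

Definition perfect_matching M : bool :=
  [&& M \subset edges, trivIset M & cover M == [set: V]].

Definition forcing_set M S : bool :=
  (S \subset M) &&
  [forall M', perfect_matching M' && (S \subset M') ==> (M' == M)].

(* The default M of [arg min] is harmless, by forcing_set_id below. *)
Definition forcing_number M : nat :=
  #|[arg min_(S < M | forcing_set M S) #|S| ]|.

(* An empty maximum is 0, so a positive value entails that the graph has a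
   perfect matching. *)
Definition max_forcing_number : nat :=
  \max_(M | perfect_matching M) forcing_number M.

Lemma perfect_matching_sub_eq M M' :
  perfect_matching M -> perfect_matching M' -> M \subset M' -> M' = M.
Proof.
move=> /and3P[_ _ /eqP covM] /and3P[edM' trM' _] sMM'.
apply/eqP; rewrite eqEsubset sMM' andbT; apply/subsetP => A AM'.
have /imset2P[u v _ _ defA] := subsetP edM' A AM'.
have uA : u \in A by rewrite defA !inE eqxx.
have : u \in cover M by rewrite covM inE.
case/bigcupP => B BM uB.
have BM' := subsetP sMM' B BM.
by rewrite -(def_pblock trM' AM' uA) (def_pblock trM' BM' uB).
Qed.

Lemma forcing_set_id M : perfect_matching M -> forcing_set M M.
Proof.
move=> pM; rewrite /forcing_set subxx /=; apply/forallP => M'.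
by apply/implyP => /andP[pM' sMM']; apply/eqP/perfect_matching_sub_eq.
Qed.

Lemma forcing_number_attained M : perfect_matching M ->
  exists2 S, forcing_set M S & #|S| = forcing_number M.
Proof.
move=> pM; rewrite /forcing_number.
by case: arg_minnP => [|S fS _]; [exact: forcing_set_id | exists S].
Qed.

Lemma forcing_number_min M S : perfect_matching M ->
  forcing_set M S -> forcing_number M <= #|S|.
Proof.
move=> pM fS; rewrite /forcing_number.
by case: arg_minnP => [|S' _ minS]; [exact: forcing_set_id | exact: minS].
Qed.

End Forcing.

(* The vertex v_{i,j} is the pair (i, j); column indices are representatives
   modulo q. The three disjuncts are v_{i,j} v_{i,j+1}, v_{i,j} v_{i+1,j} and
   v_{0,j} v_{p-1,j-s}, the last one written as j = j' + s modulo q to avoid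
   truncated subtraction. *)
Definition torus_arc (p q s : nat) (u v : 'I_p * 'I_q) : bool :=
  [|| (u.1 == v.1) && (v.2 == u.2 + 1 %[mod q]),
      (val v.1 == u.1 + 1) && (u.2 == v.2)
    | [&& val u.1 == 0, val v.1 == p - 1 & u.2 == v.2 + s %[mod q]]].

Definition torus (p q s : nat) : rel ('I_p * 'I_q) :=
  [rel u v | torus_arc s u v || torus_arc s v u].
Arguments torus : clear implicits.

Lemma torus_sym p q s : symmetric (torus p q s).
Proof. by move=> u v; rewrite /torus /= orbC. Qed.

Lemma torus_irrefl p q s : 1 < p -> 1 < q -> irreflexive (torus p q s).
Proof.
move=> p_gt1 q_gt1 [i j]; rewrite /torus /torus_arc /= orbb !eqxx andbT /=.
have -> : (j == j + 1 %[mod q]) = false.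
  by rewrite -{1}[val j]addn0 eqn_modDl mod0n modn_small.
rewrite addn1 ltn_eqF //=; case: eqP => //= ->.
by rewrite subn1 -(subnKC p_gt1).
Qed.

(* Main.v *)
(** Lower bound: match rows 2a and 2a+1 by vertical rungs; a forcing set must
    contain a vertex cover of each of the n odd cycles of rungs.

    Upper bound: given a perfect matching M, it suffices to find an independent
    set X of nm vertices such that no M-alternating cycle alternates between X
    and the M-partners of X, for then the M-edges missing X form a forcing set.

    If n > 1, or if r = 2m+1, X takes m vertices of every other row, alternate
    and shifted by one column from each such row to the next.

    If n = 1 and r < 2m+1, unroll the torus to the helical tube where (b, z) is
    adjacent to (b, z +- 1) and (1-b, z +- t), 2t = +-r modulo 2m+1. Start with
    X = {0, 2, ..., 2m-2} in one row. Alternating cycles are the cycles of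
    x |-> 2 mu(x) - x, where mu(x) is the partner of x. A cycle that makes two
    opposite steps has a cap, and a local exchange next to that cap destroys it
    without creating new cycles; a Jordan parity argument controls the exchange.
    If some cycle never makes opposite steps, it forces the partners along a
    path that winds around the torus, and X is chosen in the complementary
    annulus as the set of left or lower ends of one colour of the M-edges:
    counting with signs shows that one of the two colours has enough of them,
    and a potential built from the height function excludes cycles. *)

Require Import Defs.
From mathcomp Require Import all_boot all_order all_algebra zify ring.
Import Order.TTheory GRing.Theory Num.Theory Num.Def.

Set Implicit Arguments.
Unset Strict Implicit.
Unset Printing Implicit Defensive.

(** * Forcing sets *)

Section Partner.
Variables (V : finType) (adj : rel V).
Hypotheses (adjC : symmetric adj) (adj_irr : irreflexive adj).

(** A perfect matching has n(2m+1) edges, so the bound (m+1)n asks for exactly nm vertices in X,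
    slightly under a quarter of all. In so sparse a set arcs are rigid: two vertices whose
    coordinates agree modulo 2 can only be joined by a straight double step, so an alternating cycle
    becomes an orbit of a function. The obstacle is that the rows have odd length: neither column
    parity nor a proper 2-colouring exists on the torus. X is therefore placed in a region where
    both make sense, and arcs wrapping around are excluded by the extent of that region. With more
    than two rows, or for the prism, one fixed X serves all matchings. For two rows with a proper
    torsion a vertex has two distinct vertical neighbours in the one other row, and X depends on M.
    The two situations there complement each other: below a cap the matching is constrained enough
    that parity guarantees room for an exchange, while a cycle without opposite steps has a rigid
    shape, and deleting it leaves a region with a proper 2-colouring. The better colour may still be
    one vertex short of m; a corner of the deleted path then supplies the missing vertex. *)

Definition matching_of (mu : V -> V) : {set {set V}} := [set [set v; mu v] | v in V].

Lemma matching_of_perfect mu : involutive mu -> (forall v, adj v (mu v)) ->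
  perfect_matching adj (matching_of mu).
Proof.
move=> muK adj_mu; apply/and3P; split.
- by apply/subsetP => _ /imsetP[v _ ->]; apply/imset2P; exists v (mu v); rewrite ?inE ?adj_mu.
- apply/trivIsetP => _ _ /imsetP[v _ ->] /imsetP[w _ ->]; rewrite -setI_eq0; apply: contraNT.
  case/set0Pn => z; rewrite !inE => /andP[/orP[]/eqP -> /orP[]/eqP e].
  + by rewrite e.
  + by rewrite e muK setUC.
  + by rewrite -e muK setUC.
  by rewrite (can_inj muK e).
by apply/eqP/setP => v; rewrite in_setT; apply/bigcupP; exists [set v; mu v]; [exact: imset_f | rewrite !inE eqxx].
Qed.

Lemma partner_exists M : perfect_matching adj M ->
  exists mu : V -> V, [/\ involutive mu, forall v, adj v (mu v) & M = matching_of mu].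
Proof.
move=> /and3P[/subsetP eM tM /eqP cM].
have pair v A : A \in M -> v \in A -> exists2 u, A = [set v; u] & adj v u.
  move=> /eM/imset2P[a b _]; rewrite inE => /andP[_ ab] ->; rewrite !inE => /orP[]/eqP ->.
    by exists b.
  by exists a; [rewrite setUC | rewrite adjC].
have block v : pblock M v \in M /\ v \in pblock M v.
  have vc : v \in cover M by rewrite cM in_setT.
  by split; [rewrite pblock_mem | rewrite mem_pblock].
have ex v : exists u, pblock M v == [set v; u].
  by have [bM vb] := block v; have [u -> _] := pair _ _ bM vb; exists u.
pose mu v := xchoose (ex v).
have muP v : pblock M v = [set v; mu v] by apply/eqP; exact: (xchooseP (ex v)).
have adj_mu v : adj v (mu v).
  have [bM vb] := block v; have [u e vu] := pair _ _ bM vb.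
  have : u \in [set v; mu v] by rewrite -muP e !inE eqxx orbT.
  rewrite !inE => /orP[]/eqP eu; last by rewrite -eu.
  by rewrite eu adj_irr in vu.
have muneq v : (mu v == v) = false by apply/eqP => e; have := adj_mu v; rewrite e adj_irr.
have muK : involutive mu.
  move=> v; have [bM vb] := block v.
  have eb : pblock M (mu v) = pblock M v by apply: def_pblock => //; rewrite muP !inE eqxx orbT.
  have : v \in [set mu v; mu (mu v)] by rewrite -muP eb.
  by rewrite !inE eq_sym muneq => /eqP.
exists mu; split=> //; apply/setP => A; apply/idP/imsetP => [AM|[v _ ->]]; last first.
  by rewrite -muP; have [] := block v.
have [v _] : exists2 v, v \in V & v \in A.
  by have /imset2P[a b _ _ ->] := eM A AM; exists a; rewrite // !inE eqxx.
by move=> vA; exists v; rewrite // -muP (def_pblock tM AM vA).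
Qed.

Lemma card_matching mu : involutive mu -> (forall v, adj v (mu v)) -> #|V| = #|matching_of mu| * 2.
Proof.
move=> muK adj_mu; have /and3P[_ tM cM] := matching_of_perfect muK adj_mu.
have muneq v : (v == mu v) = false by apply/eqP => e; have := adj_mu v; rewrite -e adj_irr.
rewrite -cardsT; apply: card_uniform_partition.
  by move=> _ /imsetP[v _ ->]; rewrite cards2 muneq.
rewrite /partition cM tM; apply/negP => /imsetP[v _ /setP/(_ v)].
by rewrite !inE eqxx.
Qed.

(* For an independent X, an M-alternating cycle inside the M-edges meeting X
   visits every such edge from its X-end to its other end, so it is a cyclic
   permutation s of a subset of X with s x adjacent to the partner of x. *)
Definition alternation_free (mu : V -> V) (X : {set V}) : Prop :=
  {in X &, forall x y, ~~ adj x y} /\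
  forall (C : {set V}) s, C \subset X -> {in C &, injective s} ->
    {in C, forall x, [/\ s x \in C, s x != x & adj (mu x) (s x)]} -> C = set0.

(** A perfect matching containing all M-edges that miss X can differ from M only on edges meeting X.
    Independence of X gives each of these one end in X, so composing the two partner maps permutes
    the vertices of X where they disagree, which [alternation_free] forbids unless there are
    none. *)
Lemma forcing_number_acyclic mu (X : {set V}) : involutive mu -> (forall v, adj v (mu v)) ->
  alternation_free mu X ->
  forcing_number adj (matching_of mu) + #|X| <= #|matching_of mu|.
Proof.
move=> muK adj_mu [indep acy]; set M := matching_of mu.
have pM : perfect_matching adj M by apply: matching_of_perfect.
pose T := [set [set x; mu x] | x in X].
have TM : T \subset M by apply/subsetP => _ /imsetP[x _ ->]; apply: imset_f.
have cT : #|T| = #|X|.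
  rewrite card_in_imset // => x y xX yX /setP/(_ x); rewrite !inE eqxx /= => /esym/orP[/eqP//|/eqP e].
  by have := indep _ _ xX yX; rewrite e adjC adj_mu.
suff fS : forcing_set adj M (M :\: T).
  have := forcing_number_min pM fS; rewrite cardsD (setIidPr TM) cT => le.
  have leX : #|X| <= #|M| by rewrite -cT subset_leq_card.
  by rewrite addnC -leq_subRL.
rewrite /forcing_set subsetDl; apply/forallP => M'; apply/implyP => /andP[pM' sM'].
have [mu' [muK' adj_mu' eM']] := partner_exists pM'.
have keep v : [set v; mu v] \notin T -> mu' v = mu v.
  move=> vT; have : [set v; mu v] \in M' by apply: (subsetP sM'); rewrite in_setD vT; apply: imset_f.
  rewrite eM' => /imsetP[w _ e]; have : v \in [set w; mu' w] by rewrite -e !inE eqxx.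
  have mv : mu v \in [set w; mu' w] by rewrite -e !inE eqxx orbT.
  have nv : mu v <> v by move=> e2; have := adj_mu v; rewrite e2 adj_irr.
  have mk := muK' w.
  by move: mv; rewrite !inE => /orP[]/eqP e1 /orP[]/eqP e2; congruence.
pose C := [set x in X | mu' x != mu x].
have CX : C \subset X by apply/subsetP => x /setIdP[].
pose s' x := mu (mu' x).
have s'C x : x \in C -> s' x \in C.
  case/setIdP => xX nx; have : [set mu' x; mu (mu' x)] \in T.
    apply: contraR nx => /keep; rewrite muK' => e; by rewrite {2}e muK.
  case/imsetP => z zX e; have : mu' x \in [set z; mu z] by rewrite -e !inE eqxx.
  rewrite !inE /s' => /orP[]/eqP ez; first by have := indep _ _ xX zX; rewrite -ez adj_mu'.
  rewrite ez muK zX /=; apply: contra nx => /eqP e2.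
  have -> : x = z by apply: (can_inj muK'); rewrite e2.
  exact/eqP.
have s'inj : injective s' by apply: inj_comp (can_inj muK) (can_inj muK').
have s'im : s' @: C = C.
  apply/eqP; rewrite eqEcard card_imset // leqnn andbT.
  by apply/subsetP => _ /imsetP[x xC ->]; exact: s'C.
have C0 : C = set0.
  (* [s'] runs through the cycles backwards, which makes its stability on C easy to see; the map
     wanted here is its inverse. *)
  apply: (acy C (fun x => mu' (mu x))) => //.
    by move=> x y _ _ e; apply/(can_inj muK)/(can_inj muK').
  move=> x xC; split; last exact: adj_mu'.
    by move: xC; rewrite -{1}s'im => /imsetP[z zC ->]; rewrite /s' muK muK'.
  case/setIdP: xC => _; apply: contra => /eqP e; by rewrite -{1}e muK'.
have same x : mu' x = mu x.
  have [/imsetP[z zX e]|/keep//] := boolP ([set x; mu x] \in T).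
  have ez : mu' z = mu z.
    by apply/eqP; have := in_set0 z; rewrite -C0 /C inE zX /= => /negbFE.
  have : x \in [set z; mu z] by rewrite -e !inE eqxx.
  by rewrite !inE => /orP[]/eqP ->; rewrite ?ez // muK -ez muK'.
by apply/eqP; rewrite eM'; apply: eq_imset => x; rewrite same.
Qed.
End Partner.

(** * Lower bound *)

(** The successor map sends the complement of K into K, so K contains at least half of an odd number
    of vertices. *)
Lemma odd_cycle_cover m (K : {set 'I_(2 * m + 1)}) :
  (forall j, (j \in K) || (ordS j \in K)) -> m < #|K|.
Proof.
move=> cov; have le : #|~: K| <= #|K|.
  rewrite -(card_imset _ (@ordS_inj (2 * m + 1))).
  apply/subset_leq_card/subsetP => _ /imsetP[j + ->]; rewrite inE => /negbTE jK.
  by have := cov j; rewrite jK.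
have := cardsC K; rewrite card_ord; move: le.
by move: #|K| #|~: K| => a b; lia.
Qed.

Section Rungs.
Variables (n m r : nat).
Local Notation q := (2 * m + 1).
Notation V := ('I_(2 * n) * 'I_q)%type.
Local Notation adj := (torus (2 * n) q r).

Fact rung_subproof (i : 'I_(2 * n)) : (if odd i then i.-1 else i.+1) < 2 * n.
Proof. by have := ltn_ord i; case: ifP; lia. Qed.
Definition rung (v : V) : V := (Ordinal (rung_subproof v.1), v.2).

Lemma rungK : involutive rung.
Proof.
move=> [i j]; congr (_, _); apply: val_inj; rewrite /=.
by case: (boolP (odd i)) => oi; [rewrite ifN | rewrite ifT]; lia.
Qed.

Lemma rung_half v : (rung v).1./2 = v.1./2.
Proof. by rewrite /=; case: ifP; lia. Qed.

Lemma adj_rung v : adj v (rung v).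
Proof.
have vi : val (rung v).1 = if odd v.1 then v.1.-1 else v.1.+1 by [].
apply/orP; case: (boolP (odd v.1)) => ov; [right|left]; apply/or3P; apply: Or32; rewrite eqxx andbT; apply/eqP.
  by rewrite vi ov /=; move: ov; case: (nat_of_ord v.1) => // k _; apply/esym/addn1.
by rewrite vi (negbTE ov); apply/esym/addn1.
Qed.

Lemma adj_ordS i j : adj (i, j) (i, ordS j).
Proof.
apply/orP; left; apply/or3P; apply: Or31; rewrite eqxx /= modn_mod.
by apply/eqP; congr (_ %% _); apply/esym/addn1.
Qed.

Hypothesis m_gt0 : 0 < m.

Lemma ordS_neq (j : 'I_q) : (ordS j == j) = false.
Proof.
apply/eqP => /(congr1 val) /=; have := ltn_ord j.
rewrite leq_eqVlt => /orP[/eqP e|lt]; last by rewrite modn_small //; lia.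
by rewrite e modnn => e0; move: e; rewrite -e0; lia.
Qed.

Definition flip (a : nat) (j : 'I_q) (v : V) : V :=
  if (v.1./2 == a) && ((v.2 == j) || (v.2 == ordS j))
  then (v.1, if v.2 == j then ordS j else j) else rung v.

Lemma flipK a j : involutive (flip a j).
Proof.
move=> [i k]; rewrite {2}/flip; case: ifP => [/andP[/= ia /orP[]/eqP ->]|nin].
- by rewrite eqxx /flip /= ia eqxx orbT ordS_neq.
- by rewrite ordS_neq /flip /= ia eqxx.
by rewrite /flip rung_half nin rungK.
Qed.

Lemma adj_flip a j v : adj v (flip a j v).
Proof.
rewrite /flip; case: ifP => [|_]; last exact: adj_rung.
case: v => i k /andP[_ /orP[]/eqP /= ->]; first by rewrite eqxx adj_ordS.
by rewrite ordS_neq torus_sym adj_ordS.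
Qed.

(* Two cyclically consecutive rungs outside S span a 4-cycle that can be
   flipped, so in each of the n ladders S is a vertex cover of an odd cycle. *)
Lemma forcing_rungs S : forcing_set adj (matching_of rung) S -> n * m.+1 <= #|S|.
Proof.
case/andP=> /subsetP SM /forallP uniqM.
pose post (u : 'I_n * 'I_q) : V := (Ordinal (etrans (ltn_pmul2l (isT : 0 < 2) : _ = _) (ltn_ord u.1)), u.2).
pose edge u := [set post u; rung (post u)].
have edge_inj : injective edge.
  move=> [a j] [b k] /setP/(_ (post (a, j))); rewrite !inE eqxx /= => /esym/orP[] /eqP [e ->].
    by congr (_, _); apply: val_inj; move: e; rewrite /=; lia.
  by move: e; rewrite oddM /=; lia.
have half_lt (i : 'I_(2 * n)) : i./2 < n by have := ltn_ord i; lia.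
have edgeE v : [set v; rung v] = edge (Ordinal (half_lt v.1), v.2).
  have [e|e] : v = post (Ordinal (half_lt v.1), v.2) \/ v = rung (post (Ordinal (half_lt v.1), v.2)).
  - case: v => i j; case: (boolP (odd i)) => oi; [right|left]; congr (_, _); apply: val_inj => /=.
      by rewrite oddM /=; lia.
    by lia.
  - by rewrite /edge -e.
  by rewrite {1 2}e rungK setUC.
pose K := [set u | edge u \in S].
have cov a j : ((a, j) \in K) || ((a, ordS j) \in K).
  apply: contraT; rewrite negb_or !inE => /andP[n1 n2].
  have muK := flipK a j; have adj_mu := adj_flip a j.
  have /implyP := uniqM (matching_of (flip a j)).
  rewrite matching_of_perfect //= => /(_ _)/eqP e.
  have : [set post (a, j); (post (a, ordS j))] \in matching_of rung.
    rewrite -e; last first.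
      apply/subsetP => A AS; have /imsetP[v _ eA] := SM A AS.
      apply/imsetP; exists v => //; rewrite /flip; case: ifP => // /andP[/eqP va vj].
      have ea : a = Ordinal (half_lt v.1) by apply: val_inj.
      move: AS n1 n2; rewrite eA edgeE -ea.
      by case/orP: vj => /eqP -> ->.
    have half_a : (post (a, j)).1./2 == a by rewrite /=; lia.
    by apply/imsetP; exists (post (a, j)); rewrite // /flip half_a !eqxx.
  case/imsetP => w _ ew; have : post (a, j) \in [set w; rung w] by rewrite -ew !inE eqxx.
  have : post (a, ordS j) \in [set w; rung w] by rewrite -ew !inE eqxx orbT.
  have snd_w x : x \in [set w; rung w] -> x.2 = w.2 by rewrite !inE => /orP[]/eqP ->.
  by move=> /snd_w /= e1 /snd_w /= e2; have := ordS_neq j; rewrite e1 e2 eqxx.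
have : #|[set edge u | u in K]| <= #|S|.
  by apply/subset_leq_card/subsetP => _ /imsetP[u + ->]; rewrite inE.
rewrite card_imset //; apply: leq_trans.
have -> : #|K| = \sum_(a < n) #|[set j | (a, j) \in K]|.
  rewrite -sum1_card (eq_bigl (fun u => predT u.1 && (u.2 \in [set j | (u.1, j) \in K]))); last first.
    by move=> [a j] /=; rewrite !inE.
  rewrite -(pair_big_dep predT (fun a j => j \in [set j | (a, j) \in K]) (fun _ _ => 1)) /=.
  by apply: eq_bigr => a _; rewrite sum1_card.
rewrite -[X in X * _]card_ord -sum_nat_const; apply: leq_sum => a _.
by apply: odd_cycle_cover => j; rewrite !inE; have := cov a j; rewrite !inE.
Qed.
End Rungs.

Local Open Scope ring_scope.

(** * Local exchange at a cap *)

Section Curve.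
Variables (G : comPzRingType) (mu : G -> G) (D : pred G).
(* The only vertex other than x with the parities of x adjacent to mu x. *)
Definition straight x := mu x *+ 2 - x.
Definition on_curve x := D x || D (mu x).
(** The coefficient modulo 2 of the edge ab in the closed curve running through x, [mu x],
    [straight x] and so on. Exclusive or makes it a sum over the vertices of the cycle. *)
Definition curve_edge a b : bool :=
  ((D a && (mu a == b)) (+) (D b && (mu b == a)))
  (+) ((D (mu a) && (straight (mu a) == b)) (+) (D (mu b) && (straight (mu b) == a))).
(** [psi w] is the side of the unit face with corners w, w + h, w + v and w + h + v: it changes
    exactly across the edges of the curve. *)
Definition face_parity h v (psi : G -> bool) := forall w,
  psi w (+) psi (w - h) = curve_edge w (w + v) /\
  psi w (+) psi (w - v) = curve_edge w (w + h).

Lemma curve_edgeC a b : curve_edge a b = curve_edge b a.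
Proof. by rewrite /curve_edge [X in X (+) _]addbC [X in _ (+) X]addbC. Qed.

Lemma face_parityN h v psi :
  face_parity h v psi -> face_parity (- h) v (fun w => psi (w - h)).
Proof.
move=> fp w; split.
  by have [<- _] := fp w; rewrite opprK addrK addbC.
have [_] := fp (w - h); rewrite subrK curve_edgeC => <-.
by congr (_ (+) psi _); ring.
Qed.

Lemma face_parityC h v psi : face_parity h v psi -> face_parity v h psi.
Proof. by move=> fp w; have [] := fp w. Qed.
End Curve.

(* D is a minimal cycle of the map [straight mu] on the window; the exchange
   replaces the vertices R of the window by the equally many vertices P lying
   diagonally between them. S collects the vertices of D above P: the
   predecessors of P lie in S or off D, and the curve through D separates P
   from the remaining predecessors of S. *)
Record exchange (G : comPzRingType) (mu : G -> G) (px py : G -> bool) (adj : rel G)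
    (D Win : pred G) (P R : seq G) (S : pred G) (side : G -> bool) (sg : bool) (dl : G)
    : Prop := Exchange {
  exchange_uniq : uniq P;
  exchange_size : size R = size P;
  exchange_Win : forall r, r \in R -> Win r;
  exchange_D : exists2 r, r \in R & D r;
  exchange_P : forall p, p \in P ->
    [/\ px p && py p, mu p = p + dl, D (mu (p - dl)) & side p = sg];
  exchange_corner : forall p b e, p \in P -> adj p b -> adj b e ->
    ~~ px e && ~~ py e -> Win e;
  exchange_pred : forall p b, p \in P -> adj p b -> b != mu p ->
    [\/ S (mu b), mu b \in R
      | px (mu b) && py (mu b) /\
        let u := mu (mu b *+ 2 - b) in
        [|| px u || py u, D (straight mu u) && ~~ D u | D u && (b != mu b + dl)]];
  exchange_S : forall x, S x -> D x /\
    forall x', D x' -> straight mu x' = x -> S x' || (x' \in R);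
  exchange_side : forall x b, S x -> adj x b -> ~~ on_curve mu D b ->
    (mu b \in R) || (side b != sg);
  exchange_adj : forall b c, adj b c -> ~~ on_curve mu D b -> ~~ on_curve mu D c ->
    side b = side c }.

Section Exchange.
Variables (G : comPzRingType) (mu : G -> G) (h v : G) (px py : G -> bool).
Hypothesis muK : involutive mu.
Hypothesis mu_nb : forall x, mu x - x \in [:: h; - h; v; - v].
Hypotheses (pxD : {morph px : x y / x + y >-> x (+) y})
           (pyD : {morph py : x y / x + y >-> x (+) y}).
Hypotheses (pxh : px h) (pxv : px v = false) (pyh : py h = false) (pyv : py v).
Hypotheses (h_inf : forall n, h *+ n = 0 -> n = 0%N) (v_inf : forall n, v *+ n = 0 -> n = 0%N).
Variables (D : pred G).
Local Notation f := (straight mu).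
Local Notation VD := (on_curve mu D).
Local Notation edge := (curve_edge mu D).
Hypothesis D_f : forall x, D x -> D (f x).
Hypothesis D_inj : forall x y, D x -> D y -> f x = f y -> x = y.
Hypothesis D_even : forall x, D x -> ~~ px x && ~~ py x.

Lemma px0 : px 0 = false. Proof. by have := pxD 0 0; rewrite addr0; case: (px 0). Qed.
Lemma py0 : py 0 = false. Proof. by have := pyD 0 0; rewrite addr0; case: (py 0). Qed.
Lemma pxN x : px (- x) = px x.
Proof. by have := pxD x (- x); rewrite subrr px0; case: (px x); case: (px _). Qed.
Lemma pyN x : py (- x) = py x.
Proof. by have := pyD x (- x); rewrite subrr py0; case: (py x); case: (py _). Qed.
Lemma pxM x n : px (x *+ n) = odd n && px x.
Proof. by elim: n => [|n IH]; rewrite ?px0 // mulrS pxD IH /=; case: (px x); case: (odd n). Qed.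
Lemma pyM x n : py (x *+ n) = odd n && py x.
Proof. by elim: n => [|n IH]; rewrite ?py0 // mulrS pyD IH /=; case: (py x); case: (odd n). Qed.
Let pE := (pxD, pyD, pxN, pyN, pxM, pyM, pxh, pxv, pyh, pyv).

Lemma mu_black x : px (mu x) (+) py (mu x) = ~~ (px x (+) py x).
Proof.
have -> : mu x = (mu x - x) + x by rewrite subrK.
have := mu_nb x; rewrite !inE => /or4P[] /eqP ->; rewrite !pE;
  by case: (px x); case: (py x).
Qed.

Lemma D_mu x : D x -> D (mu x) = false.
Proof.
move=> Dx; apply/negP => /D_even/andP[/negPf a /negPf b].
by have := mu_black x; have /andP[/negPf c /negPf d] := D_even Dx; rewrite a b c d.
Qed.

Lemma f_neq x : f x != x.
Proof.
apply/eqP => /(congr1 (fun y => y - x)); rewrite subrr /straight => e.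
have {e} : (mu x - x) *+ 2 = 0 by rewrite -e; ring.
have := mu_nb x; rewrite !inE => /or4P[] /eqP -> /eqP; rewrite ?mulNrn ?oppr_eq0 => /eqP.
- by move/h_inf.
- by move/h_inf.
- by move/v_inf.
- by move/v_inf.
Qed.

Lemma edge_mu x : D x -> edge x (mu x).
Proof.
move=> Dx; rewrite /curve_edge Dx eqxx D_mu //= muK Dx /=.
by rewrite (negPf (f_neq x)).
Qed.

Lemma edge_straight x : D x -> edge (mu x) (f x).
Proof.
move=> Dx; have Dfx := D_f Dx.
rewrite /curve_edge D_mu // muK Dx eqxx (D_mu Dfx) Dfx /=.
by case: eqP => // /(can_inj muK) e; have := f_neq x; rewrite e eqxx.
Qed.

Lemma edge_off a b : ~~ VD a -> edge a b = false.
Proof.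
rewrite /on_curve negb_or => /andP[/negPf a1 /negPf a2].
rewrite /curve_edge a1 a2 /=; apply/negbTE.
case Db: (D b); last first.
  case Db': (D (mu b)) => //=; case: eqP => // e.
  by have := D_f Db'; rewrite e a1.
rewrite (D_mu Db) /= addbF; case: eqP => //= e.
by move: a2; rewrite -e muK Db.
Qed.

Variables (Win : pred G) (side : G -> bool).
Hypothesis D_Win : forall x, D x -> Win x.
Hypothesis Win_conv : forall x n i, (i <= n)%N ->
  Win x -> Win (x + h *+ n.*2) -> Win (x + h *+ i.*2).
Hypothesis sideP : face_parity mu D h v side.

Variables (x0 : G) (a : nat).
Hypotheses (a_gt0 : (0 < a)%N) (Dx0 : D x0) (mu_x0 : mu x0 = x0 + v).
(* The cap goes from x0 up by v, along h for 2a steps and back down; cell j is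
   the j-th vertex just below its horizontal part. *)
Definition cell j := locked (x0 + v + h *+ j).
Lemma cellE j : cell j = x0 + v + h *+ j. Proof. by rewrite /cell -lock. Qed.
Hypothesis mu_top : forall i, (i < a)%N -> mu (cell i.*2 + v) = cell i.*2.+1 + v.
Hypothesis mu_last : mu (cell a.*2 + v) = cell a.*2.

Lemma cellS j : cell j.+1 = cell j + h. Proof. by rewrite !cellE; ring. Qed.

Lemma D_top i : (i <= a)%N -> D (cell i.*2 + v).
Proof.
elim: i => [_|i IH ltia].
  have -> : cell 0 + v = f x0 by rewrite /straight mu_x0 !cellE; ring.
  exact: D_f.
have -> : cell i.+1.*2 + v = f (cell i.*2 + v).
  by rewrite /straight mu_top // doubleS !cellS; ring.
by apply: D_f; apply: IH; lia.
Qed.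

Lemma f_top i : (i < a)%N -> f (cell i.*2 + v) = cell i.+1.*2 + v.
Proof. by move=> ?; rewrite /straight mu_top // doubleS !cellS; ring. Qed.

Lemma px_z j : px (cell j) = odd j.
Proof.
by have /andP[/negPf e _] := D_even Dx0; rewrite cellE !pE e andbT.
Qed.
Lemma py_z j : py (cell j).
Proof.
by have /andP[_ /negPf e] := D_even Dx0; rewrite cellE !pE e andbF.
Qed.
Lemma Dz j : D (cell j) = false.
Proof. by apply/negP => /D_even/andP[_]; rewrite py_z. Qed.

Lemma hv : h != v. Proof. by apply/eqP => e; have := pxh; rewrite e pxv. Qed.
Lemma hNv : h != - v. Proof. by apply/eqP => e; have := pxh; rewrite e pxN pxv. Qed.
Lemma hNh : h != - h.
Proof. by rewrite -subr_eq0 opprK -mulr2n; apply/eqP => /h_inf. Qed.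
Lemma vNv : v != - v.
Proof. by rewrite -subr_eq0 opprK -mulr2n; apply/eqP => /v_inf. Qed.

Definition cell_down j := mu (cell j) == cell j - v.
Definition cell_right j := mu (cell j) == cell j + h.
Definition cell_left j := mu (cell j) == cell j - h.

Lemma down0 : cell_down 0.
Proof. by rewrite /cell_down cellE mulr0n addr0 -mu_x0 muK mu_x0 addrK. Qed.
Lemma up_last : mu (cell a.*2) = cell a.*2 + v. Proof. exact: esym (canRL muK mu_last). Qed.
Lemma down_last : cell_down a.*2 = false.
Proof.
by rewrite /cell_down up_last (inj_eq (addrI _)) (negbTE vNv).
Qed.
Lemma mu_odd i : (i < a)%N -> mu (cell i.*2.+1 + v) = cell i.*2 + v.
Proof. by move=> ?; rewrite -mu_top // muK. Qed.
Local Ltac slia := clear mu_last mu_x0 mu_top muK mu_nb; lia.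
Lemma not_up j : (j < a.*2)%N -> (mu (cell j) == cell j + v) = false.
Proof.
move=> ltj; apply/eqP => /(congr1 mu); rewrite muK.
have [i [e lti]] : exists i, (j = i.*2 \/ j = i.*2.+1) /\ (i < a)%N.
  by exists j./2; slia.
case: e => ->.
  rewrite (mu_top lti) (cellS i.*2) => e.
  have /eqP : h + v = 0 by apply: (addrI (cell i.*2)); rewrite addr0 addrA -e.
  by rewrite addr_eq0 (negbTE hNv).
rewrite (mu_odd lti) (cellS i.*2) => /addrI/eqP.
by rewrite (negbTE hv).
Qed.
Lemma dirP j : (j < a.*2)%N -> [|| cell_down j, cell_right j | cell_left j].
Proof.
move=> ltj; have := mu_nb (cell j); rewrite !inE !subr_eq ![_ + cell j]addrC (not_up ltj) /=.
by case/or3P => e; rewrite /cell_down /cell_right /cell_left e ?orbT.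
Qed.

Lemma not_left_S j : ~~ cell_right j -> cell_left j.+1 = false.
Proof.
move=> nr; apply/negbTE/negP => /eqP; rewrite cellS addrK => /(congr1 mu); rewrite muK => e.
by move: nr; rewrite /cell_right -e eqxx.
Qed.
Lemma cell_right_left j : cell_right j -> cell_left j.+1.
Proof. by move/eqP => e; rewrite /cell_left cellS addrK -e muK. Qed.
Lemma down_right j : cell_down j -> cell_right j = false.
Proof.
by move/eqP => e; rewrite /cell_right e (inj_eq (addrI _)) eq_sym (negbTE hNv).
Qed.
Lemma down_left j : cell_down j -> cell_left j = false.
Proof.
by move/eqP => e; rewrite /cell_left e (inj_eq (addrI _)) eqr_opp eq_sym (negbTE hv).
Qed.
Lemma left_right j : cell_left j -> cell_right j = false.
Proof.
by move/eqP => e; rewrite /cell_right e (inj_eq (addrI _)) eq_sym (negbTE hNh).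
Qed.

(** The cells strictly between k and l are matched among themselves in horizontal pairs, formed from
    left to right, so their number is even. *)
Lemma down_gap k l : (k < l <= a.*2)%N -> cell_down k -> cell_down l || (l == a.*2) ->
  (forall j, (k < j < l)%N -> ~~ cell_down j) -> odd (l - k).
Proof.
move=> /andP[ltkl lela] dk dl nd.
have alt i : (k + i.+1 < l)%N -> if odd i then cell_left (k + i.+1) else cell_right (k + i.+1).
  elim: i => [|i IH] lti /=.
    have nl : cell_left k.+1 = false by rewrite not_left_S // down_right.
    have lt1 : (k.+1 < a.*2)%N by slia.
    have nd1 : ~~ cell_down k.+1 by apply: nd; slia.
    by rewrite addn1; move: (dirP lt1); rewrite (negbTE nd1) nl orbF.
  have lt1 : (k + i.+1 < l)%N by slia.
  have := IH lt1; rewrite [(k + i.+2)%N]addnS; case: (odd i) => /=; last exact: cell_right_left.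
  move/left_right/negbT/not_left_S => nl.
  have lt2 : ((k + i.+1).+1 < a.*2)%N by slia.
  have nd2 : ~~ cell_down (k + i.+1).+1 by apply: nd; slia.
  by move: (dirP lt2); rewrite (negbTE nd2) nl orbF.
apply/negPn/negP => ev; have := alt (l - k).-2.
have -> : (k + (l - k).-2.+1 = l.-1)%N by slia.
have -> : odd (l - k).-2 = false by slia.
move/(_ ltac:(slia))/cell_right_left; rewrite prednK; last by slia.
case/orP: dl => [/down_left->//|/eqP->].
by rewrite /cell_left up_last (inj_eq (addrI _)) -eqr_oppLR eq_sym (negbTE hNv).
Qed.

(** By [down_gap] the last cell matched downwards before 2a has odd index, so some run ends at an
    odd index. The first such run cannot start at a positive even index, since by [down_gap] again
    the run before it would end at an odd index too. These parities make P and R equally large in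
    [exchange_exists]. *)
Lemma run_exists : exists s k, [/\ (s <= k < a.*2)%N, odd k, (s == 0%N) || odd s
  & [/\ forall j, (s <= j <= k)%N -> cell_down j, cell_down k.+1 = false
     & (0 < s)%N -> cell_down s.-1 = false]].
Proof.
have exk : exists k, [&& odd k, cell_down k, ~~ cell_down k.+1 & (k < a.*2)%N].
  have ex0 : exists j, cell_down j && (j < a.*2)%N by exists 0%N; rewrite down0 double_gt0.
  have ub j : cell_down j && (j < a.*2)%N -> (j <= a.*2)%N by case/andP => _ /ltnW.
  have [k /andP[dk ltk] maxk] := ex_maxnP ex0 ub.
  have nd j : (k < j < a.*2)%N -> ~~ cell_down j.
    by move=> ltj; apply/negP => dj; have := maxk j; rewrite dj /=; slia.
  have := down_gap (k := k) (l := a.*2); rewrite dk eqxx orbT /= => gap.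
  exists k; rewrite dk ltk /= andbT; apply/andP; split; first by have := gap ltac:(slia) isT isT nd; slia.
  have [e|ne] := eqVneq k.+1 a.*2; first by rewrite e down_last.
  by apply: nd; slia.
have {exk} [k /and4P[ok dk /negbTE dk1 ltk] mink] := ex_minnP exk.
have exs : exists s, (s <= k)%N && all cell_down (iota s (k.+1 - s)).
  by exists k; rewrite leqnn subSnn /= dk.
have {exs} [s /andP[lesk /allP alls] mins] := ex_minnP exs.
have ds j : (s <= j <= k)%N -> cell_down j by move=> ?; apply: alls; rewrite mem_iota; slia.
have ds1 : (0 < s)%N -> cell_down s.-1 = false.
  move=> s_gt0; apply/negP => d1.
  have all1 : all cell_down (iota s.-1 (k.+1 - s.-1)).
    apply/allP => j; rewrite mem_iota => hj.
    by have [->//|ne] := eqVneq j s.-1; apply: ds; slia.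
  by have := mins s.-1; rewrite all1 andbT; slia.
exists s, k; split => //; first by rewrite lesk.
have [//|s_gt0 /=] := posnP s; apply/negPn/negP => es.
have ex0 : exists j, cell_down j && (j < s)%N by exists 0%N; rewrite down0.
have ub j : cell_down j && (j < s)%N -> (j <= s)%N by case/andP => _ /ltnW.
have [l /andP[dl ltl] maxl] := ex_maxnP ex0 ub.
have nd j : (l < j < s)%N -> ~~ cell_down j.
  by move=> ltj; apply/negP => dj; have := maxl j; rewrite dj /=; clear -ltj; lia.
have lts1 : (l < s.-1)%N.
  have : l != s.-1 by apply/eqP => e; move: (ds1 s_gt0); rewrite -e dl.
  by clear -ltl s_gt0; lia.
have lsa : (l < s <= a.*2)%N by clear -lts1 lesk ltk; lia.
have dsl : cell_down s || (s == a.*2) by rewrite ds // leqnn.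
have ol : odd l by move: (down_gap lsa dl dsl nd); clear -es ltl; lia.
have ndl : ~~ cell_down l.+1 by apply: nd; clear -lts1; lia.
by have := mink l; rewrite ol dl ndl; clear -lts1 lesk ltk; lia.
Qed.

Variable adj : rel G.
Hypothesis adjE : forall x y, adj x y = (y - x \in [:: h; - h; v; - v]).

Lemma adjP x b : adj x b -> [\/ b = x + h, b = x - h, b = x + v | b = x - v].
Proof.
rewrite adjE !inE !subr_eq ![_ + x]addrC.
by case/or4P => /eqP ->; [apply: Or41|apply: Or42|apply: Or43|apply: Or44].
Qed.

Lemma D_topj j : ~~ odd j -> (j <= a.*2)%N -> D (cell j + v).
Proof.
move=> ej lej; have -> : j = j./2.*2 by clear -ej; lia.
by apply: D_top; clear -lej; lia.
Qed.

Lemma f_topj j : ~~ odd j -> (j < a.*2)%N -> f (cell j + v) = cell j.+2 + v.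
Proof.
move=> ej lej; have -> : j = j./2.*2 by clear -ej; lia.
by rewrite f_top //; clear -lej; lia.
Qed.

Lemma mu_topj j : (j < a.*2)%N -> mu (cell j + v) = cell (if odd j then j.-1 else j.+1) + v.
Proof.
move=> lej; case: ifP => oj.
  have -> : j = j./2.*2.+1 by clear -oj; lia.
  by rewrite mu_odd //; clear -lej oj; lia.
have -> : j = j./2.*2 by clear -oj; lia.
by rewrite mu_top //; clear -lej oj; lia.
Qed.

Lemma cell0v : cell 0 - v = x0. Proof. by rewrite cellE mulr0n addr0 addrK. Qed.

Lemma bottom_Win j : ~~ odd j -> (j <= a.*2)%N -> Win (cell j - v).
Proof.
move=> ej lej; have -> : cell j - v = x0 + h *+ j by rewrite cellE; ring.
have -> : j = j./2.*2 by clear -ej; lia.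
apply: (@Win_conv _ a); [by clear -lej; lia | exact: D_Win |].
have -> : x0 + h *+ a.*2 = f (cell a.*2 + v) by rewrite /straight mu_last cellE; move: a.*2 => n; ring.
by apply/D_Win/D_f/D_top.
Qed.

(** If the vertex below an even cell j > 0 were in D, its image under [f] would be the vertex above
    that cell, which is already the image of the vertex above cell j - 2. *)
Lemma u_notD j : ~~ odd j -> (0 < j <= a.*2)%N -> cell_down j -> D (cell j - v) = false.
Proof.
move=> ej /andP[j_gt0 lej] /eqP dj; apply/negP => Du.
have [i e] : exists i, j = i.+2 by exists j.-2; clear -ej j_gt0; lia.
have ei : ~~ odd i by clear -ej e; lia.
have lti : (i < a.*2)%N by clear -lej e; lia.
have eu : cell j - v = cell i + v.
  apply: D_inj => //; first by apply: D_topj => //; apply: ltnW.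
  have m : mu (cell j - v) = cell j by rewrite -dj muK.
  by rewrite f_topj // -e /straight m; ring.
have := muK (cell j); rewrite dj eu mu_topj // (negbTE ei) e (cellS i.+1) => /addrI/eqP.
by rewrite eq_sym (negbTE hv).
Qed.

Lemma odd_notVD j : odd j -> cell_down j -> ~~ VD (cell j).
Proof.
move=> oj /eqP dj; rewrite /on_curve Dz dj /=; apply/negP => /D_even/andP[].
by rewrite !pE px_z oj.
Qed.

Lemma even_notVD j : ~~ odd j -> (0 < j <= a.*2)%N -> cell_down j -> ~~ VD (cell j).
Proof. by move=> ej lej dj; rewrite /on_curve Dz (eqP dj) u_notD. Qed.

(** [side] belongs to faces, but no edge at a vertex off the curve lies on the curve, so the four
    faces around such a vertex agree and the side can be read at the vertex. *)
Lemma side_VD b c : ~~ VD b -> ~~ VD c -> adj b c -> side b = side c.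
Proof.
move=> nb nc /adjP; have hb := sideP b; have hc := sideP c.
have sv x y : side x (+) side y = false -> side x = side y by case: (side x); case: (side y).
case=> e.
- by have [] := hc; rewrite (edge_off _ nc) e addrK => /sv ->.
- by have [] := hb; rewrite (edge_off _ nb) -e => /sv ->.
- by have [_] := hc; rewrite (edge_off _ nc) e addrK => /sv ->.
by have [_] := hb; rewrite (edge_off _ nb) -e => /sv ->.
Qed.

Lemma side_neq x y : side x (+) side y -> side x != side y.
Proof. by case: (side x); case: (side y). Qed.
Lemma side_eq x y : side x (+) side y = false -> side x = side y.
Proof. by case: (side x); case: (side y). Qed.

Lemma exchange_exists : exists P R S sg dl, exchange mu px py adj D Win P R S side sg dl.
Proof.
have [s [k [/andP[lesk ltk] ok sP [ds dk1 ds1]]]] := run_exists.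
(* P consists of the odd cells of the run and R of the vertices below its even cells. If the run
   starts at 0, the first of these is [x0], which is in D. If it starts at an odd s, there is one
   odd cell more than even ones, and R is completed by the vertex of D above cell s - 1. S consists
   of the vertices of D on the cap above the run. *)
pose P := [seq cell i.*2.+1 | i <- iota s./2 (k./2.+1 - s./2)].
pose r0 := if odd s then cell s.-1 + v else cell 0 - v.
pose R := r0 :: [seq cell i.*2 - v | i <- iota s./2.+1 (k./2 - s./2)].
pose S := [pred x | (x \in [seq cell i.*2 + v | i <- iota (uphalf s) (k./2.+1 - uphalf s)])
                    || ((k.+1 == a.*2) && (x == cell a.*2 + v))].
have inP p : p \in P -> exists j, [/\ odd j, (s <= j <= k)%N & p = cell j].
  case/mapP => i; rewrite mem_iota => hi ->; exists i.*2.+1; split=> //=; first by rewrite odd_double.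
  by clear -hi ok lesk; lia.
have inR r : r \in R ->
    (exists j, [/\ ~~ odd j, (s <= j <= k)%N & r = cell j - v]) \/ odd s /\ r = cell s.-1 + v.
  rewrite inE => /orP[/eqP ->|/mapP[i]].
    rewrite /r0; case: ifP => os; [by right | left; exists 0%N; split=> //].
    by move: sP; rewrite os orbF => /eqP ->.
  rewrite mem_iota => hi ->; left; exists i.*2; split; first by rewrite odd_double.
    by clear -hi ok lesk; lia.
  by [].
have memR j : ~~ odd j -> (s <= j <= k)%N -> cell j - v \in R.
  move=> ej hj; have [j0|j_gt0] := posnP j.
    by rewrite inE /r0 j0 (_ : odd s = false) ?eqxx //; clear -hj j0; lia.
  rewrite inE (_ : j = j./2.*2); last by clear -ej; lia.
  apply/orP; right; apply/map_f; rewrite mem_iota; clear -ej hj sP j_gt0; lia.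
have memR1 : odd s -> cell s.-1 + v \in R by move=> os; rewrite inE /r0 os eqxx.
have memS j : ~~ odd j -> (s <= j <= k)%N -> S (cell j + v).
  move=> ej hj; rewrite /S /=; apply/orP; left.
  rewrite (_ : j = j./2.*2); last by clear -ej; lia.
  by apply/map_f; rewrite mem_iota; clear -ej hj; lia.
have memSl : k.+1 = a.*2 -> S (cell a.*2 + v) by move=> e; rewrite /S /= e !eqxx orbT.
have inS x : S x ->
    (exists j, [/\ ~~ odd j, (s <= j <= k)%N & x = cell j + v]) \/ k.+1 = a.*2 /\ x = cell a.*2 + v.
  case/orP => [/mapP[i]|/andP[/eqP e /eqP ->]]; last by right.
  rewrite mem_iota => hi ->; left; exists i.*2; split; first by rewrite odd_double.
    by clear -hi ok lesk; lia.
  by [].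
have run_notVD j : (0 < j)%N -> (s <= j <= k)%N -> ~~ VD (cell j).
  move=> j_gt0 hj; have [oj|ej] := boolP (odd j); first by apply: odd_notVD; rewrite ?ds.
  by apply: even_notVD; rewrite ?ds //; clear -j_gt0 hj ltk; lia.
have side_le j l : (0 < j)%N -> (s <= j)%N -> (j <= l <= k)%N -> side (cell j) = side (cell l).
  move=> j_gt0 lesj; elim: l => [|l IH]; first by clear -j_gt0; lia.
  have [->//|nejl /andP[lejl lelk]] := eqVneq j l.+1.
  have lejl' : (j <= l)%N by clear -lejl nejl; lia.
  rewrite IH ?lejl' ?(ltnW lelk) //.
  apply: side_VD; [| |by rewrite adjE cellS addrAC subrr add0r !inE eqxx];
    by apply: run_notVD; clear -lejl' lesj j_gt0 lelk; lia.
have k_gt0 : (0 < k)%N by clear -ok; lia.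
have run_side j : (0 < j)%N -> (s <= j <= k)%N -> side (cell j) = side (cell k).
  by move=> j_gt0 /andP[lesj lejk]; apply: side_le; rewrite ?lejk ?leqnn.
have mu_last1 : k.+1 = a.*2 -> mu (cell k.+1) = cell a.*2 + v by move=> ->; exact: up_last.
exists P, R, S, (side (cell k)), (- v); split.
- rewrite map_inj_uniq ?iota_uniq // => i i' /eqP.
  rewrite !cellE (inj_eq (addrI _)) => /eqP e; apply/eqP.
  wlog lei : i i' e / (i <= i')%N => [wl|].
    by have [/wl->//|/ltnW/wl] := leqP i i'; rewrite eq_sym => ->.
  have : h *+ (i'.*2.+1 - i.*2.+1) = 0 by rewrite mulrnBr ?e ?subrr //; clear -lei; lia.
  by move/h_inf; clear -lei; lia.
- by rewrite /= !size_map !size_iota; clear -lesk sP ok; lia.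
- move=> r /inR[[j [ej hj ->]]|[os ->]].
    by apply: bottom_Win => //; clear -hj ltk; lia.
  by apply/D_Win/D_topj; clear -os lesk ltk; lia.
- exists r0; first by rewrite inE eqxx.
  rewrite /r0; case: ifP => [os|_]; last by rewrite cell0v.
  by apply: D_topj; clear -os lesk ltk; lia.
- move=> p /inP[j [oj hj ->]]; have /eqP dj := ds _ hj.
  have j_gt0 : (0 < j)%N by clear -oj; lia.
  have ltj : (j < a.*2)%N by clear -hj ltk; lia.
  split; rewrite ?px_z ?py_z ?oj //; last exact: run_side.
  by rewrite opprK mu_topj // oj; apply: D_topj; clear -oj ltj; lia.
- move=> p b e /inP[j [oj hj ->]] /adjP pb /adjP be.
  have [i ei] : exists i, j = i.+1 by exists j.-1; clear -oj; lia.
  have W1 i' : (i' == i) || (i' == i.+2) -> Win (cell i' + v).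
    by move=> hi; apply/D_Win/D_topj; clear -hi ei oj hj ltk; lia.
  have W2 i' : (i' == i) || (i' == i.+2) -> Win (cell i' - v).
    by move=> hi; apply: bottom_Win; clear -hi ei oj hj ltk; lia.
  have zi : cell j - h = cell i by rewrite ei cellS addrK.
  have zi2 : cell j + h = cell i.+2 by rewrite ei -cellS.
  move: pb be => [] -> [] -> par; try by move: par; rewrite !pE px_z py_z oj.
  - by rewrite zi2; apply: W1; rewrite eqxx orbT.
  - by rewrite zi2; apply: W2; rewrite eqxx orbT.
  - by rewrite zi; apply: W1; rewrite eqxx.
  - by rewrite zi; apply: W2; rewrite eqxx.
  - by rewrite addrAC zi2; apply: W1; rewrite eqxx orbT.
  - by rewrite addrAC zi; apply: W1; rewrite eqxx.
  - by rewrite addrAC zi2; apply: W2; rewrite eqxx orbT.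
  - by rewrite addrAC zi; apply: W2; rewrite eqxx.
(* Only the neighbours of p other than the one below matter. The one above is matched along the cap
   with a vertex of S or R. The lateral ones are matched down into R while inside the run. Just
   outside it they are matched with an odd cell further away from the run, or, at the end of the
   cap, up into S. For such an odd cell the third alternative follows from the direction of the next
   even cell. *)
- move=> p b /inP[j [oj hj ->]] /adjP zb; have /eqP dj := ds _ hj.
  rewrite dj => neb.
  have [i ei] : exists i, j = i.+1 by exists j.-1; clear -oj; lia.
  have zi : cell j - h = cell i by rewrite ei cellS addrK.
  have zi2 : cell j + h = cell i.+2 by rewrite ei -cellS.
  case: zb neb => -> neb; last by rewrite eqxx in neb.
  + rewrite zi2; have [ltjk|/negP] := boolP (j < k)%N.
      have /eqP -> : cell_down i.+2 by apply: ds; clear -ei ltjk hj; lia.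
      by apply: Or32; apply: memR; clear -ei ltjk hj oj; lia.
    move=> nlt; have ejk : i.+1 = k by clear -ei nlt hj; lia.
    have [e|ne] := eqVneq k.+1 a.*2; first by apply: Or31; rewrite ejk mu_last1 //; apply: memSl.
    have ltk1 : (k.+1 < a.*2)%N by clear -ltk ne; lia.
    have ltk2 : (k.+2 < a.*2)%N by clear -ltk1 ok; lia.
    have nl : cell_left k.+1 = false by rewrite not_left_S // down_right // ds // lesk leqnn.
    have := dirP ltk1; rewrite dk1 nl orbF /= => /eqP; rewrite ejk -cellS => e1.
    apply: Or33; rewrite e1 px_z py_z /= ok; split=> //=.
    have -> : cell k.+2 *+ 2 - cell k.+1 = cell k.+3 by rewrite !cellS; ring.
    have [e3|ne3] := eqVneq k.+3 a.*2.
      have nb : cell k.+1 != cell k.+2 - v.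
        rewrite (cellS k.+1) -subr_eq0; have -> : cell k.+1 - (cell k.+1 + h - v) = v - h by ring.
        by rewrite subr_eq0 eq_sym hv.
      by rewrite e3 up_last D_top // nb !orbT.
    have ltk3 : (k.+3 < a.*2)%N by clear -ltk2 ne3 ok; lia.
    have ek3 : ~~ odd k.+3 by rewrite /= ok.
    case/or3P: (dirP ltk3) => d3.
    * have uD : D (cell k.+3 - v) = false by apply: u_notD => //; clear -ltk3; lia.
      have -> : f (mu (cell k.+3)) = cell k.+3 + v by rewrite /straight muK (eqP d3); ring.
      by rewrite (eqP d3) uD D_topj ?orbT // ltnW.
    * by rewrite (eqP d3) !pE px_z /= ok.
    * by rewrite (eqP d3) !pE px_z /= ok.
  + rewrite zi; have [lesi|/negP] := boolP (s <= i)%N.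
      have /eqP -> : cell_down i by apply: ds; clear -ei lesi hj; lia.
      by apply: Or32; apply: memR; clear -ei lesi hj oj; lia.
    move=> nlt; have ejs : i.+1 = s by clear -ei nlt hj; lia.
    have s_gt0 : (0 < s)%N by rewrite -ejs.
    have ndi : cell_down i = false by have := ds1 s_gt0; rewrite -ejs.
    have lti : (i < a.*2)%N by clear -ltk lesk ejs; lia.
    have nr : cell_right i = false.
      by apply/negP => /cell_right_left; rewrite ejs down_left // ds // leqnn.
    have i_neq0 : i != 0%N by apply/eqP => e; move: ndi; rewrite e down0.
    have := dirP lti; rewrite ndi nr /= => /eqP.
    have [i' ei'] : exists i', i = i'.+2 by exists i.-2; clear -i_neq0 ei oj; lia.
    have oi' : ~~ odd i' by clear -oj ei ei'; lia.
    rewrite ei' cellS addrK -cellS => e1; apply: Or33; rewrite e1 px_z py_z /= oi'; split=> //=.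
    have -> : cell i'.+1 *+ 2 - cell i'.+2 = cell i' by rewrite !cellS; ring.
    have lti' : (i' < a.*2)%N by clear -lti ei'; lia.
    have [i0|i_gt0] := posnP i'.
      have nb : cell i'.+2 != cell i'.+1 - v.
        rewrite (cellS i'.+1) -subr_eq0; have -> : cell i'.+1 + h - (cell i'.+1 - v) = h + v by ring.
        by rewrite addr_eq0 hNv.
      by rewrite {1 2 3 4 5}i0 (eqP down0) cell0v Dx0 nb !orbT.
    case/or3P: (dirP lti') => d3.
    * have uD : D (cell i' - v) = false by apply: u_notD => //; clear -lti' i_gt0; lia.
      have -> : f (mu (cell i')) = cell i' + v by rewrite /straight muK (eqP d3); ring.
      by rewrite (eqP d3) uD D_topj ?orbT // ltnW.
    * by rewrite (eqP d3) !pE px_z /= (negbTE oi').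
    * by rewrite (eqP d3) !pE px_z /= (negbTE oi').
  + have ltj : (j < a.*2)%N by clear -hj ltk; lia.
    rewrite mu_topj // oj ei /=; have [lesi|/negP nle] := boolP (s <= i)%N.
      by apply: Or31; apply: memS; clear -ei lesi hj oj; lia.
    have es : s = i.+1 by clear -ei nle hj; lia.
    by apply: Or32; move: memR1; rewrite es /=; apply; clear -oj ei; lia.
- have pred i x' : ~~ odd i -> (i < a.*2)%N -> D x' -> f x' = cell i.+2 + v -> x' = cell i + v.
    move=> ei lti Dx' e; apply: D_inj => //; last by rewrite f_topj.
    by apply: D_topj => //; apply: ltnW.
  move=> x /inS[[j [ej hj ->]]|[ek ->]]; last first.
    split; first exact: D_top.
    move=> x' Dx'; have [i ei] : exists i, k = i.+1 by exists k.-1; clear -ok; lia.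
    rewrite -ek ei => /(pred i) ->//; [|by clear -ok ei; lia|by clear -ei ltk; lia].
    have [lesi|/negP nle] := boolP (s <= i)%N; apply/orP.
      by left; apply: memS; clear -ei ok lesi; lia.
    have es : s = i.+1 by clear -ei nle lesk; lia.
    by right; move: memR1; rewrite es /=; apply; clear -ok ei; lia.
  split; first by apply: D_topj; clear -ej hj ltk; lia.
  move=> x' Dx'; have [j0|j_gt0] := posnP j.
    move=> e; have -> : x' = cell 0 - v.
      rewrite cell0v; apply: D_inj => //; rewrite e j0 /straight mu_x0 cellE; ring.
    by apply/orP; right; apply: memR; rewrite -j0.
  have [i ei] : exists i, j = i.+2 by exists j.-2; clear -ej j_gt0; lia.
  rewrite ei => /(pred i) ->//; [|by clear -ej ei; lia|by clear -ei hj ltk; lia].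
  have [lesi|/negP nle] := boolP (s <= i)%N; apply/orP.
    by left; apply: memS; clear -ei ej hj lesi; lia.
  have es : s = i.+1 by clear -ei nle ej hj sP; lia.
  by right; move: memR1; rewrite es /=; apply; clear -ej ei; lia.
(* A neighbour below is on the curve or matched into R; any other neighbour off the curve is
   separated from the run by exactly one edge of the cap. *)
- have edgeT x : D x -> edge x (mu x) /\ edge (mu x) (f x).
    by move=> Dx; rewrite edge_mu ?edge_straight.
  have eh b : ~~ VD b -> side b = side (b - v).
    by move=> nb; apply: side_eq; have [_ ->] := sideP b; apply: edge_off.
  have ev b : ~~ VD b -> side b = side (b - h).
    by move=> nb; apply: side_eq; have [-> _] := sideP b; apply: edge_off.
  move=> x b /inS[[j [ej hj ->]]|[ek ->]] /adjP xb nb.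
    have ltj : (j < a.*2)%N by clear -ej hj ok ltk; lia.
    have Dj : D (cell j + v) by apply: D_topj; rewrite // ltnW.
    have mj : mu (cell j + v) = cell j + v + h.
      by rewrite mu_topj // (negbTE ej) cellS; ring.
    have up : side (cell j + v) != side (cell j).
      apply: side_neq; have [_] := sideP (cell j + v).
      by rewrite addrK -mj => ->; have [] := edgeT _ Dj.
    have sz : side (cell j) = side (cell k).
      have [j0|j_gt0] := posnP j; last exact: run_side.
      have s0 : s = 0%N by clear -j0 hj; lia.
      have n1 : ~~ VD (cell 1) by apply: run_notVD => //; rewrite s0.
      rewrite -(run_side 1%N) //; last by rewrite s0.
      by rewrite (ev _ n1) cellS addrK j0.
    case: xb nb => -> nb.
    + by move: nb; rewrite /on_curve -mj muK Dj orbT.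
    + have [j0|j_gt0] := posnP j; last first.
        have [i ei] : exists i, j = i.+2 by exists j.-2; clear -ej j_gt0; lia.
        move: nb; rewrite /on_curve ei cellS addrAC addrK.
        have oi : odd i.+1 by clear -ej ei; lia.
        rewrite mu_topj; last by clear -ei ltj; lia.
        by rewrite oi D_topj ?orbT //; clear -ej ei ltj; lia.
      apply/orP; right; rewrite -sz (eh _ nb) j0 [cell 0 + v - h]addrAC addrK.
      rewrite eq_sym; apply: side_neq; have [-> _] := sideP (cell 0).
      have [_] := edgeT _ Dx0; rewrite mu_x0 (_ : x0 + v = cell 0) ?cellE ?mulr0n ?addr0 //.
      by rewrite (_ : f x0 = x0 + v + v) // /straight mu_x0; ring.
    + apply/orP; right; rewrite -sz (eh _ nb) addrK; exact: up.
    rewrite addrK; have [j0|j_gt0] := posnP j.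
      move: nb; rewrite addrK /on_curve j0 (eqP down0) cell0v Dx0 orbT //.
    by rewrite (eqP (ds _ hj)) memR.
  have [i ei] : exists i, a = i.+1 by exists a.-1; clear -a_gt0; lia.
  have ek' : k = i.*2.+1 by clear -ek ei; lia.
  have Di : D (cell i.*2 + v) by apply: D_top; rewrite ei leqnSn.
  have Da : D (cell a.*2 + v) by apply: D_top.
  have zk : cell k = cell a.*2 - h by rewrite -ek cellS addrK.
  case: xb nb => -> nb; apply/orP; right.
  + rewrite (eh _ nb) (_ : cell a.*2 + v + h - v = cell a.*2 + h); last by ring.
    have ns : edge (cell a.*2 + h) (cell a.*2 + h + v) = false.
      by rewrite curve_edgeC (_ : cell a.*2 + h + v = cell a.*2 + v + h) ?edge_off //; ring.
    have [+ _] := sideP (cell a.*2 + h); rewrite ns addrK => /side_eq ->.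
    rewrite zk; apply: side_neq; have [-> _] := sideP (cell a.*2).
    by rewrite curve_edgeC -{2}mu_last; have [] := edgeT _ Da.
  + move: nb; rewrite /on_curve addrAC -zk mu_topj; last by clear -ltk; lia.
    by rewrite ok D_topj ?orbT //; clear -ok ltk; lia.
  + rewrite (ev _ nb) (_ : cell a.*2 + v + v - h = cell k + v + v); last by rewrite zk; ring.
    have ns : edge (cell k + v + v) (cell k + v + v + h) = false.
      rewrite curve_edgeC (_ : cell k + v + v + h = cell a.*2 + v + v) ?edge_off //.
      by rewrite zk; ring.
    have [_ +] := sideP (cell k + v + v); rewrite ns addrK => /side_eq ->.
    apply: side_neq; have [_ ] := sideP (cell k + v); rewrite addrK => ->.
    have [_] := edgeT _ Di; rewrite mu_top ?ei // -ek' f_top ?ei // -ei.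
    by rewrite (_ : cell k + v + h = cell a.*2 + v) // zk; ring.
  by move: nb; rewrite addrK /on_curve up_last Da orbT.
- by move=> b c bc nb nc; apply: side_VD.
Qed.
End Exchange.

(** * Repairing a window *)

Lemma uniq_flatten_map (T1 T2 : eqType) (g : T1 -> seq T2) (s : seq T1) :
  uniq s -> (forall x, x \in s -> uniq (g x)) ->
  (forall x y p, x \in s -> y \in s -> p \in g x -> p \in g y -> x = y) ->
  uniq (flatten (map g s)).
Proof.
elim: s => //= x s IH /andP[xs us] ug dis; rewrite cat_uniq ug ?mem_head //= IH //; last 2 first.
- by move=> y ys; apply: ug; rewrite inE ys orbT.
- by move=> y z p ys zs; apply: dis; rewrite inE ?ys ?zs orbT.
rewrite andbT; apply/hasPn => p /flatten_mapP[y ys py]; apply/negP => px.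
by move: xs; rewrite (dis x y p) ?ys ?inE ?eqxx ?ys ?orbT.
Qed.

Lemma in_map_perm (T : eqType) (C : seq T) (s : T -> T) :
  uniq C -> {in C &, injective s} -> (forall x, x \in C -> s x \in C) ->
  forall y, y \in C -> exists2 x, x \in C & s x = y.
Proof.
move=> uC injs sC y yC; have uM : uniq (map s C) by rewrite map_inj_in_uniq.
have sub : {subset map s C <= C} by move=> z /mapP[x xC ->]; exact: sC.
have [|_ e] := uniq_min_size uM sub; first by rewrite size_map.
by move: yC; rewrite -e => /mapP[x xC ->]; exists x.
Qed.

Section Repair.
Variables (G : comPzRingType) (mu : G -> G) (h v : G) (px py : G -> bool) (adj : rel G).
(** The cycle condition of [alternation_free], on lists because G may be infinite. *)
Definition acyclic (L : seq G) := forall (C : seq G) (s : G -> G), uniq C ->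
  {subset C <= L} -> {in C &, injective s} ->
  (forall x, x \in C -> [/\ s x \in C, s x != x & adj (mu x) (s x)]) -> C = [::].
Hypothesis muK : involutive mu.
Hypothesis adjE : forall x y, adj x y = (y - x \in [:: h; - h; v; - v]).
Hypothesis adj_mu : forall x, adj x (mu x).
Hypotheses (pxD : {morph px : x y / x + y >-> x (+) y})
           (pyD : {morph py : x y / x + y >-> x (+) y}).
Hypotheses (pxh : px h) (pxv : px v = false) (pyh : py h = false) (pyv : py v).
Local Notation f := (straight mu).
Variables (I : finType) (pt : I -> G).
Hypothesis pt_inj : injective pt.
Hypothesis pt_even : forall u, ~~ px (pt u) && ~~ py (pt u).
Definition win x := x \in codom pt.
Definition pts (D : {set I}) x := x \in [seq pt u | u in D].
Definition closed_under (D : {set I}) :=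
  [forall u in D, [exists w in D, pt w == f (pt u)]].
(** This describes a single cycle of [f]: the image of a closed set is closed, so by minimality [f]
    permutes D, and no proper nonempty part of D is invariant. *)
Definition min_cycle D := minset (fun B : {set I} => (B != set0) && closed_under B) D.
Hypothesis all_exchange : forall D, min_cycle D ->
  exists P R S side sg dl, exchange mu px py adj (pts D) win P R S side sg dl.

Lemma adjC x y : adj x y = adj y x.
Proof.
rewrite !adjE -(opprB x y) !inE !eqr_opp ?eqr_oppLR ?opprK.
by rewrite orbCA; congr (_ || (_ || _)); rewrite orbC.
Qed.

Let px0 : px 0 = false. Proof. by have := pxD 0 0; rewrite addr0; case: (px 0). Qed.
Let py0 : py 0 = false. Proof. by have := pyD 0 0; rewrite addr0; case: (py 0). Qed.
Let pxN x : px (- x) = px x.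
Proof. by have := pxD x (- x); rewrite subrr px0; case: (px x); case: (px _). Qed.
Let pyN x : py (- x) = py x.
Proof. by have := pyD x (- x); rewrite subrr py0; case: (py x); case: (py _). Qed.

Lemma adj_black x y : adj x y -> px y (+) py y = ~~ (px x (+) py x).
Proof.
rewrite adjE => xy; have -> : y = (y - x) + x by rewrite subrK.
move: xy; rewrite !inE => /or4P[] /eqP ->; rewrite !pxD !pyD ?pxN ?pyN ?pxh ?pyh ?pxv ?pyv;
  by case: (px x); case: (py x).
Qed.

(** Two perpendicular steps change both parities, and two opposite ones lead back to x. *)
Lemma step_straight x y : ~~ px x && ~~ py x -> ~~ px y && ~~ py y ->
  adj (mu x) y -> y != x -> y = f x.
Proof.
move=> /andP[/negbTE a /negbTE b] /andP[/negbTE c /negbTE d] xy neq.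
have := adj_mu x; move: xy; rewrite !adjE.
move E1: (y - mu x) => e1 h1; move E2: (mu x - x) => e2 h2.
have ey : y = x + e2 + e1 by rewrite -E1 -E2; ring.
have fx : f x = x + e2 + e2 by rewrite /straight -E2; ring.
have nz : e1 + e2 != 0.
  by apply: contraNneq neq => z; rewrite ey -addrA [e2 + _]addrC z addr0.
move: c d nz; rewrite ey fx !pxD !pyD a b; move: h1 h2; rewrite !inE.
case/or4P => /eqP -> /or4P[] /eqP ->; rewrite ?pxN ?pyN ?pxh ?pyh ?pxv ?pyv ?addNr ?addrN ?eqxx //.
Qed.

Lemma ptsP (D : {set I}) u : u \in D -> pts D (pt u).
Proof. by move=> uD; apply/imageP; exists u. Qed.
Lemma pts_win (D : {set I}) x : pts D x -> win x.
Proof. by case/imageP => u _ ->; apply: codom_f. Qed.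
Lemma win_even x : win x -> ~~ px x && ~~ py x.
Proof. by case/codomP => u ->. Qed.

Lemma pts_straight (D : {set I}) x : min_cycle D -> pts D x -> pts D (f x).
Proof.
move=> /minsetp/andP[_ /forall_inP cl] /imageP[u uD ->].
by have /exists_inP[w wD /eqP <-] := cl u uD; apply: ptsP.
Qed.

Lemma min_cycle_sub (D B : {set I}) : min_cycle D -> B \subset D -> B != set0 -> closed_under B -> B = D.
Proof. by move=> /minsetP[_ mD] sB B0 cB; apply: mD; rewrite ?B0. Qed.

Lemma min_cycle_meet (D E : {set I}) x : min_cycle D -> min_cycle E -> pts D x -> pts E x -> D = E.
Proof.
move=> mD mE /imageP[u uD ->] /imageP[w wE /pt_inj euw].
have cl : closed_under (D :&: E).
  apply/forall_inP => i /setIP[iD iE].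
  have /minsetp/andP[_ /forall_inP/(_ i iD)/exists_inP[j jD /eqP ej]] := mD.
  have /minsetp/andP[_ /forall_inP/(_ i iE)/exists_inP[k kE /eqP ek]] := mE.
  apply/exists_inP; exists j; last exact/eqP.
  by rewrite inE jD (pt_inj (etrans ej (esym ek))).
have n0 : D :&: E != set0 by apply/set0Pn; exists u; rewrite inE uD euw.
by rewrite -(min_cycle_sub mD (subsetIl _ _) n0 cl) {1}(min_cycle_sub mE (subsetIr _ _) n0 cl).
Qed.

Lemma min_cycle_perm (D : {set I}) : min_cycle D ->
  exists g : I -> I, [/\ g @: D = D, {in D &, injective g}
                        & {in D, forall u, pt (g u) = f (pt u)}].
Proof.
move=> mD; have /minsetp/andP[D0 /forall_inP cl] := mD.
pose g u := odflt u [pick w in D | pt w == f (pt u)].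
have gP u : u \in D -> g u \in D /\ pt (g u) = f (pt u).
  move=> uD; rewrite /g; case: pickP => [w /andP[? /eqP]//|no].
  by have /exists_inP[w wD e] := cl u uD; have := no w; rewrite wD e.
have gD : g @: D = D.
  apply: min_cycle_sub => //.
  - by apply/subsetP => _ /imsetP[u uD ->]; have [] := gP u uD.
  - by have /set0Pn[u uD] := D0; apply/set0Pn; exists (g u); apply: imset_f.
  apply/forall_inP => _ /imsetP[u uD ->]; have [guD _] := gP u uD.
  apply/exists_inP; exists (g (g u)); first exact: imset_f.
  by have [_ ->] := gP _ guD.
exists g; split=> //; last by move=> u /gP[].
by apply/imset_injP; rewrite gD.
Qed.

Lemma pts_inj (D : {set I}) : min_cycle D ->
  forall x y, pts D x -> pts D y -> f x = f y -> x = y.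
Proof.
move=> /min_cycle_perm[g [_ gi gP]] _ _ /imageP[u uD ->] /imageP[w wD ->].
by rewrite -(gP u uD) -(gP w wD) => /pt_inj /gi ->.
Qed.

Lemma closed_contains_cycle (B : {set I}) : B != set0 -> closed_under B ->
  exists2 D, min_cycle D & D \subset B.
Proof.
move=> B0 cB.
pose Q (A : {set I}) := (A != set0) && closed_under A.
have [D mD sD] := @minset_exists _ Q B (introT andP (conj B0 cB)).
by exists D.
Qed.

(** All cycles are exchanged simultaneously. A new cycle through some P would have to enter it from
    S. The part S of D is reached only from S itself, from a removed vertex, or from the far side of
    the curve; and a cycle that is on the far side stays there. *)
Lemma repair : exists2 L : seq G, uniq L /\ (#|I| <= size L)%N &
  acyclic L /\ forall x, x \in L -> win x \/
    [/\ px x, py x & forall b e, adj x b -> adj b e -> ~~ px e && ~~ py e -> win e].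
Proof.
have [F FP] : exists F : {set I} -> seq G * seq G, forall D, min_cycle D ->
    exists S side sg dl, exchange mu px py adj (pts D) win (F D).1 (F D).2 S side sg dl.
  apply: (@fin_all_exists _ (fun=> seq G * seq G)%type (fun D PR => min_cycle D ->
    exists S side sg dl, exchange mu px py adj (pts D) win PR.1 PR.2 S side sg dl)) => D.
  have [mD|nD] := boolP (min_cycle D); last by exists ([::], [::]).
  by have [P [R [S [side [sg [dl E]]]]]] := all_exchange mD; exists (P, R) => _; exists S, side, sg, dl.
pose cs := [seq D <- enum {set I} | min_cycle D].
have csP D : (D \in cs) = min_cycle D by rewrite mem_filter mem_enum andbT.
pose Pa := flatten [seq (F D).1 | D <- cs]; pose Ra := flatten [seq (F D).2 | D <- cs].
have inPa p : reflect (exists2 D, min_cycle D & p \in (F D).1) (p \in Pa).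
  apply: (iffP flatten_mapP) => [[D]|[D]]; first by rewrite csP; exists D.
  by rewrite -csP; exists D.
have inRa p : reflect (exists2 D, min_cycle D & p \in (F D).2) (p \in Ra).
  apply: (iffP flatten_mapP) => [[D]|[D]]; first by rewrite csP; exists D.
  by rewrite -csP; exists D.
pose E := [seq x <- [seq pt u | u <- enum I] | x \notin Ra].
have inE' x : (x \in E) = win x && (x \notin Ra).
  by rewrite mem_filter andbC; congr (_ && _); rewrite /win /codom /image_mem; congr (_ \in map _ _).
pose L := E ++ Pa.
have Podd D p : min_cycle D -> p \in (F D).1 -> px p && py p.
  by move=> /FP[S [side [sg [dl X]]]] /(exchange_P X)[].
have Podd' p : p \in Pa -> px p && py p by case/inPa => D; apply: Podd.
(* [mu p = p + dl] recovers [dl] from p, hence also the vertex [mu (p - dl)] of the cycle, and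
   distinct minimal cycles are disjoint. *)
have Puniq D D' p : min_cycle D -> min_cycle D' -> p \in (F D).1 -> p \in (F D').1 -> D = D'.
  move=> mD mD' pD pD'; have [S [side [sg [dl X]]]] := FP _ mD.
  have [S' [side' [sg' [dl' X']]]] := FP _ mD'.
  have [_ e d _] := exchange_P X pD; have [_ e' d' _] := exchange_P X' pD'.
  have edl : dl = dl' by apply: (addrI p); rewrite -e -e'.
  by apply: (min_cycle_meet mD mD' d); rewrite edl.
have uP : uniq Pa.
  apply: uniq_flatten_map; first by rewrite filter_uniq // enum_uniq.
    by move=> D; rewrite csP => /FP[S [side [sg [dl X]]]]; apply: exchange_uniq X.
  by move=> D D' p; rewrite !csP; apply: Puniq.
have uE : uniq E by rewrite filter_uniq // map_inj_uniq // enum_uniq.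
have nEP p : p \in E -> p \in Pa -> False.
  by rewrite inE' => /andP[/win_even/andP[/negbTE a _] _] /Podd'; rewrite a.
have szR : size Ra = size Pa.
  rewrite !size_flatten /shape -!map_comp; congr sumn; apply/eq_in_map => D.
  by rewrite csP => /FP[S [side [sg [dl X]]]]; apply: exchange_size X.
exists L; split.
- rewrite cat_uniq uE uP andbT; apply/hasPn => p pP; apply/negP => pE; exact: nEP pE pP.
(* The lists R of different cycles need not be disjoint: repetitions only leave more of the window,
   so an inequality is enough. *)
- rewrite size_cat -szR cardE -(size_map pt) -/(enum I).
  rewrite -(count_predC [pred x | x \notin Ra]) -size_filter leq_add2l -size_filter.
  apply: uniq_leq_size; first by rewrite filter_uniq // map_inj_uniq // enum_uniq.
  by move=> x; rewrite mem_filter /= negbK => /andP[].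
- move=> C s uC subC injs sC.
  have pred y : y \in C -> exists2 x, x \in C & s x = y.
    by apply: in_map_perm => // x /sC[].
  have LP x : x \in C -> (win x /\ x \notin Ra) \/ x \in Pa.
    by move/subC; rewrite mem_cat inE' => /orP[/andP[]|]; [left | right].
  have nR D x : min_cycle D -> x \in C -> x \in (F D).2 -> False.
    move=> mD /LP[[_ /inRa nx] xR|/Podd'/andP[ox _]]; first by apply: nx; exists D.
    have [S [side [sg [dl X]]]] := FP _ mD.
    by move/(exchange_Win X)/win_even/andP; rewrite ox => [] [].
  have Ceven x : x \in C -> px x (+) py x = false.
    by case/LP => [[/win_even/andP[/negbTE-> /negbTE->]]|/Podd'/andP[-> ->]].
  have black (D : {set I}) x : px x (+) py x = false -> pts D (mu x) = false.
    move=> ev; apply/negP => /pts_win/win_even/andP[/negbTE a /negbTE b].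
    by have := adj_black (adj_mu x); rewrite a b ev.
  have onC (D : {set I}) x : x \in C -> on_curve mu (pts D) x = pts D x.
    by move=> /Ceven/black e; rewrite /on_curve e orbF.
  have onM (D : {set I}) x : x \in C -> on_curve mu (pts D) (mu x) = pts D x.
    by move=> /Ceven/black e; rewrite /on_curve e muK.
  (* In the third alternative of [exchange_pred], x is a new vertex for some cycle D', and
     [exchange_P] puts the vertex u of that alternative in D'. So u is even; if D contains [f u] or
     u then D = D', which contains u and makes [x + dl] the partner of x. Each clause is thus
     contradicted. *)
  have SP D x : min_cycle D -> x \in C -> s x \in (F D).1 ->
      forall S side sg dl, exchange mu px py adj (pts D) win (F D).1 (F D).2 S side sg dl -> S x.
    move=> mD xC sxP S side sg dl X; have [_ nsx axs] := sC _ xC.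
    have nb : mu x != mu (s x) by rewrite (can_eq muK) eq_sym.
    have := exchange_pred X sxP _ nb; rewrite adjC muK => /(_ axs).
    case=> [//|/(nR _ _ mD xC)//|[/andP[ox _]]].
    case: (LP _ xC) => [[/win_even/andP[]]|]; first by rewrite ox.
    case/inPa => D' mD' xP'; have [S' [side' [sg' [dl' X']]]] := FP _ mD'.
    have [_ ex' d' _] := exchange_P X' xP'.
    rewrite /= (_ : x *+ 2 - mu x = x - dl'); last by rewrite ex'; ring.
    have /andP[/negbTE -> /negbTE -> /=] := win_even (pts_win d').
    case/orP => [/andP[fD nD]|/andP[uD ne]].
      have e := min_cycle_meet mD mD' fD (pts_straight mD' d').
      by move: nD; rewrite e d'.
    have e := min_cycle_meet mD mD' uD d'; rewrite -e in xP'.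
    by have [_ ex _ _] := exchange_P X xP'; rewrite ex eqxx in ne.
  have PW x : x \in C -> x \in Pa -> win (s x) /\ s x \notin Ra.
    move=> xC xP; have [sxC nsx axs] := sC _ xC.
    case: (LP _ sxC) => // /inPa[D mD sxP]; have [S [side [sg [dl X]]]] := FP _ mD.
    have Sx := SP _ _ mD xC sxP _ _ _ _ X; have [Dx _] := exchange_S X Sx.
    have /andP[ox _] := Podd' _ xP; by have /win_even/andP := pts_win Dx; rewrite ox => [][].
  (* An arc of C leaves D only towards a new vertex, whose predecessor must lie in the S of its own
     cycle; so that cycle is D, and the new vertex is on side [sg]. *)
  have leftP D S side sg dl : min_cycle D ->
      exchange mu px py adj (pts D) win (F D).1 (F D).2 S side sg dl ->
      forall x, x \in C -> ~~ pts D (s x) -> side (s x) != sg ->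
        ~~ pts D x /\ side x = side (s x).
    move=> mD X x xC nD sneq; have [sxC nsx axs] := sC _ xC.
    have nDx : ~~ pts D x.
      apply/negP => Dx; case: (LP _ sxC) => [[wsx _]|/inPa[D' mD' sxP]].
        have e := step_straight (win_even (pts_win Dx)) (win_even wsx) axs nsx.
        by move: nD; rewrite e pts_straight.
      have [S' [side' [sg' [dl' X']]]] := FP _ mD'.
      have [D'x _] := exchange_S X' (SP _ _ mD' xC sxP _ _ _ _ X').
      have e := min_cycle_meet mD' mD D'x Dx; rewrite e in sxP.
      by have [_ _ _ e'] := exchange_P X sxP; rewrite e' eqxx in sneq.
    split=> //; transitivity (side (mu x)).
      by apply: (exchange_adj X); rewrite ?onM ?onC.
    by apply: (exchange_adj X); rewrite ?onM ?onC.
  (* By [leftP] the far side is closed under predecessors; [s] permutes the finite set C, so it is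
     closed under successors as well. *)
  have left_stable D S side sg dl : min_cycle D ->
      exchange mu px py adj (pts D) win (F D).1 (F D).2 S side sg dl ->
      forall x, x \in C -> ~~ pts D x -> side x != sg ->
        ~~ pts D (s x) /\ side (s x) != sg.
    move=> mD X; pose B := [seq x <- C | ~~ pts D x && (side x != sg)].
    have uB : uniq B by rewrite filter_uniq.
    have inB x : (x \in B) = [&& ~~ pts D x, side x != sg & x \in C].
      by rewrite mem_filter andbA.
    have sub : {subset B <= map s B}.
      move=> y; rewrite inB => /and3P[nD ny /pred[x xC e]]; rewrite -e in nD ny *.
      have [nDx ex] := leftP _ _ _ _ _ mD X _ xC nD ny.
      by apply: map_f; rewrite inB nDx ex ny xC.
    have [|_ eB] := uniq_min_size uB sub; first by rewrite size_map.
    move=> x xC nD nx; have : s x \in B by rewrite eB map_f // inB nD nx.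
    by rewrite inB => /and3P[].
  (* Going back from a vertex of S in C, a predecessor off D would be trapped on the far side, and
     one in D is not in R, hence again in S. All of D would then lie in C, including the removed
     vertex of [exchange_D]. *)
  have nS D S side sg dl : min_cycle D ->
      exchange mu px py adj (pts D) win (F D).1 (F D).2 S side sg dl ->
      forall x, x \in C -> S x -> False.
    move=> mD X x0 x0C Sx0.
    have back x x' : x \in C -> S x -> pts D x' -> f x' = x -> x' \in C /\ S x'.
      move=> xC Sx Dx' e; have [Dx SRx] := exchange_S X Sx.
      have [w wC ew] := pred _ xC; have [_ nsw asw] := sC _ wC.
      rewrite ew in nsw asw.
      case Dw : (pts D w).
        have efw := step_straight (win_even (pts_win Dw)) (win_even (pts_win Dx)) asw nsw.
        have ew' : x' = w by apply: (pts_inj mD) => //; rewrite e.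
        rewrite ew'; split=> //; have /orP[//|wR] := SRx _ Dw (esym efw).
        by case: (nR _ _ mD wC wR).
      have nVb : ~~ on_curve mu (pts D) (mu w) by rewrite onM // Dw.
      have nVw : ~~ on_curve mu (pts D) w by rewrite onC // Dw.
      have axw : adj x (mu w) by rewrite adjC.
      have /orP[|sb] := exchange_side X Sx axw nVb; first by rewrite muK => /(nR _ _ mD wC).
      have sw : side w != sg by rewrite (exchange_adj X (adj_mu w)).
      have [] := left_stable _ _ _ _ _ mD X _ wC (negbT Dw) sw.
      by rewrite ew Dx.
    pose B := [set u in D | (pt u \in C) && S (pt u)].
    have cl : closed_under (D :\: B).
      apply/forall_inP => u /setDP[uD uB].
      have /minsetp/andP[_ /forall_inP/(_ u uD)/exists_inP[w wD /eqP ew]] := mD.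
      apply/exists_inP; exists w; last exact/eqP.
      rewrite inE wD andbT; apply: contra uB; rewrite !inE wD uD /= => /andP[wC Sw].
      by have [-> ->] := back _ _ wC Sw (ptsP uD) (esym ew).
    have [r rR Dr] := exchange_D X.
    have [e|n0] := eqVneq (D :\: B) set0.
      have /imageP[u uD er] := Dr; have : u \in B by move/setP/(_ u): e; rewrite !inE uD andbT => /negbFE.
      by rewrite inE -er => /and3P[_ rC _]; apply: nR mD rC rR.
    have eD := min_cycle_sub mD (subsetDl _ _) n0 cl.
    have [Dx0 _] := exchange_S X Sx0; have /imageP[u uD eu] := Dx0.
    by have := uD; rewrite -eD !inE uD -eu x0C Sx0.
  have nP x : x \in C -> x \notin Pa.
    move=> xC; apply/negP => /inPa[D mD xP]; have [S [side [sg [dl X]]]] := FP _ mD.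
    have [w wC ew] := pred _ xC; rewrite -ew in xP.
    exact: (nS _ _ _ _ _ mD X _ wC (SP _ _ mD wC xP _ _ _ _ X)).
  have Cwin x : x \in C -> win x /\ x \notin Ra.
    by move=> xC; have [//|xP] := LP _ xC; move: (nP _ xC); rewrite xP.
  have sf x : x \in C -> s x = f x.
    move=> xC; have [sxC nsx asx] := sC _ xC.
    have [wx _] := Cwin _ xC; have [wsx _] := Cwin _ sxC.
    exact: step_straight (win_even wx) (win_even wsx) asx nsx.
  (* C now avoids all new vertices, so it is closed under [f] in the window and contains a minimal
     cycle, from which a vertex was removed. *)
  apply/eqP; rewrite -[_ == _]negbK; apply/negP => C0.
  pose B := [set u | pt u \in C].
  have inC x : x \in C -> exists2 u, u \in B & x = pt u.
    by move=> xC; have [/codomP[u e] _] := Cwin _ xC; exists u; rewrite ?inE -?e.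
  have cl : closed_under B.
    apply/forall_inP => u; rewrite inE => puC; have [sC' _ _] := sC _ puC.
    have [w wB e] := inC _ sC'; apply/exists_inP; exists w => //.
    by rewrite -e sf.
  have B0 : B != set0.
    by case: (C) C0 inC => // x C' _ /(_ x (mem_head _ _))[u uB _]; apply/set0Pn; exists u.
  have [D mD sD] := closed_contains_cycle B0 cl; have [S [side [sg [dl X]]]] := FP _ mD.
  have [r rR /imageP[u uD er]] := exchange_D X.
  have := subsetP sD _ uD; rewrite inE -er => rC; exact: nR mD rC rR.
- move=> x; rewrite mem_cat inE' => /orP[/andP[]|]; first by left.
  move=> xP; right; have /andP[-> ->] := Podd' _ xP; split=> // b e.
  have [D mD xD] := inPa _ xP; have [S [side [sg [dl X]]]] := FP _ mD.
  exact: (exchange_corner X xD).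
Qed.
End Repair.

(** * Jordan parity *)

Section Jordan.
Variables (G : comPzRingType) (mu : G -> G) (h v : G).
Hypothesis muK : involutive mu.
Hypothesis mu_nb : forall x, mu x - x \in [:: h; - h; v; - v].
Hypotheses (hNh : h != - h) (vNv : v != - v) (hv : h != v) (hNv : h != - v).
Variable above : G -> bool.
Hypothesis aboveD : forall g, above (g + v) = above g (+) (g == 0).
Variables (I : finType) (pt : I -> G).
Hypothesis pt_inj : injective pt.
Local Notation f := (straight mu).

Definition unit_step a b := b - a \in [:: h; - h; v; - v].
(* Whether the step from a to b crosses the ray from w in direction v. *)
Definition crossing (a b w : G) :=
  if b == a + h then above (a - w) else if b == a - h then above (b - w) else false.
Definition is_edge (e a b w : G) := ((a == w) && (b == w + e)) (+) ((b == w) && (a == w + e)).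

Lemma is_edge_other d e a w : d != e -> d != - e -> is_edge e a (a + d) w = false.
Proof.
move=> nde ndNe; rewrite /is_edge.
have -> : (a == w) && (a + d == w + e) = false.
  by case: eqP => //= ->; rewrite (inj_eq (addrI w)) (negbTE nde).
case: eqP => //= <-; rewrite -{1}[a]addr0 -addrA (inj_eq (addrI a)) eq_sym addr_eq0.
exact: negbTE.
Qed.

Lemma is_edgeD e a w : e != - e -> is_edge e a (a + e) w = (a == w).
Proof.
move=> ne; rewrite /is_edge; have -> : (a + e == w) && (a == w + e) = false.
  case: eqP => //= <-; rewrite -{1}[a]addr0 -addrA (inj_eq (addrI a)) eq_sym addr_eq0.
  exact: negbTE.
by rewrite addbF (inj_eq (addIr e)) andbb.
Qed.

Lemma is_edgeB e a w : e != - e -> is_edge e a (a - e) w = (a - e == w).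
Proof. by move=> ne; rewrite /is_edge addbC -/(is_edge e (a - e) a w) -{2}[a](subrK e) is_edgeD. Qed.

Lemma crossing_h a b w : unit_step a b ->
  crossing a b w (+) crossing a b (w - h)
  = (above (a - w) (+) above (b - w)) (+) is_edge v a b w.
Proof.
have vh : v != h by rewrite eq_sym.
have Nhv : - h != v by rewrite eqr_oppLR.
have vNh : v != - h by rewrite eq_sym.
have NhNv : - h != - v by rewrite eqr_opp.
rewrite /unit_step !inE !subr_eq ![_ + a]addrC => /or4P[] /eqP ->;
  rewrite /crossing !(inj_eq (addrI a)) ?eqxx.
- rewrite is_edge_other // addbF; congr (_ (+) above _); ring.
- rewrite eq_sym (negbTE hNh) is_edge_other // addbF addbC; congr (above _ (+) _); ring.
- rewrite (negbTE vh) (negbTE vNh) is_edgeD //.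
  rewrite (_ : a + v - w = a - w + v) ?aboveD ?subr_eq0; last by ring.
  by case: (above _); case: (a == w).
rewrite (negbTE (_ : - v != h)) ?eqr_opp ?[v == h]eq_sym ?(negbTE hv) 1?eq_sym 1?eqr_oppLR //.
rewrite is_edgeB // -{1}[a](subrK v).
rewrite (_ : a - v + v - w = a - v - w + v) ?aboveD ?subr_eq0; last by ring.
by case: (above _); case: (a - v == w).
Qed.

Lemma crossing_v a b w : unit_step a b ->
  crossing a b w (+) crossing a b (w - v) = is_edge h a b w.
Proof.
have vh : v != h by rewrite eq_sym.
have Nvh : - v != h by rewrite eq_sym.
have vNh : v != - h by rewrite -eqr_oppLR.
have NvNh : - v != - h by rewrite eqr_opp.
rewrite /unit_step !inE !subr_eq ![_ + a]addrC => /or4P[] /eqP ->;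
  rewrite /crossing !(inj_eq (addrI a)) ?eqxx.
- rewrite is_edgeD // (_ : a - (w - v) = a - w + v) ?aboveD ?subr_eq0; last by ring.
  by case: (above _); case: (a == w).
- rewrite eq_sym (negbTE hNh) is_edgeB //.
  rewrite (_ : a - h - (w - v) = a - h - w + v) ?aboveD ?subr_eq0; last by ring.
  by case: (above _); case: (a - h == w).
- by rewrite (negbTE vh) (negbTE vNh) is_edge_other.
by rewrite (negbTE Nvh) (negbTE NvNh) is_edge_other.
Qed.

Lemma sum_pick (D : {set I}) (q : G -> bool) w :
  \big[addb/false]_(u in D) ((pt u == w) && q (pt u)) = pts pt D w && q w.
Proof.
have [/imageP[u uD ->]|nD] := boolP (pts pt D w); last first.
  rewrite big1 // => u uD; case: eqP => // e; case/negP: nD; rewrite -e.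
  by apply/imageP; exists u.
rewrite (bigD1 u) //= eqxx big1 ?addbF // => i /andP[_ /negbTE ne].
by rewrite (inj_eq pt_inj) ne.
Qed.

(** [psi w] counts modulo 2 the crossings of the curve with the ray from w in direction v. Moving w
    by h adds the vertical edges at w and boundary terms [above], which cancel around the cycle
    because [f] permutes D. On the tube the ray spirals towards one end, so the parity makes sense
    even for a curve that winds around the tube. *)
Lemma jordan (D : {set I}) : min_cycle mu pt D -> exists psi, face_parity mu (pts pt D) h v psi.
Proof.
move=> mD; have [g [gD gi gP]] := min_cycle_perm mD.
have st1 x : unit_step x (mu x) by exact: mu_nb.
have st2 x : unit_step (mu x) (f x).
  by rewrite /unit_step (_ : f x - mu x = mu x - x) // /straight; ring.
pose psi w := \big[addb/false]_(u in D)
  (crossing (pt u) (mu (pt u)) w (+) crossing (mu (pt u)) (f (pt u)) w).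
have edges e w : \big[addb/false]_(u in D)
    (is_edge e (pt u) (mu (pt u)) w (+) is_edge e (mu (pt u)) (f (pt u)) w)
    = curve_edge mu (pts pt D) w (w + e).
  rewrite big_split /= /is_edge !big_split /curve_edge /=; congr (_ (+) _).
    congr (_ (+) _); first exact: (sum_pick D (fun y => mu y == w + e)).
    under eq_bigr do rewrite andbC.
    exact: (sum_pick D (fun y => mu y == w)).
  congr (_ (+) _).
    under eq_bigr do rewrite (can2_eq muK muK).
    exact: (sum_pick D (fun y => f y == w + e)).
  under eq_bigr do rewrite andbC (can2_eq muK muK).
  exact: (sum_pick D (fun y => f y == w)).
exists psi => w; split; rewrite /psi -big_split /= -edges.
  rewrite (eq_bigr (fun u => (above (pt u - w) (+) above (f (pt u) - w))
    (+) (is_edge v (pt u) (mu (pt u)) w (+) is_edge v (mu (pt u)) (f (pt u)) w))); last first.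
    move=> u _; rewrite addbACA (crossing_h _ (st1 _)) (crossing_h _ (st2 _)).
    by move: (above _) (above _) (above _) (is_edge _ _ _ _) (is_edge _ _ _ _) => [] [] [] [] [].
  rewrite big_split /= big_split /=.
  suff -> : \big[addb/false]_(u in D) above (f (pt u) - w)
          = \big[addb/false]_(u in D) above (pt u - w) by rewrite addbb addFb.
  rewrite -{2}gD (big_imset _ gi) /=; apply: eq_bigr => u uD.
  by rewrite gP.
apply: eq_bigr => u _.
by rewrite addbACA (crossing_v _ (st1 _)) (crossing_v _ (st2 _)).
Qed.
End Jordan.

(** * Caps on a cycle with opposite steps *)

Section Cap.
Variables (G : comPzRingType) (mu : G -> G) (e s : G).
Hypothesis muK : involutive mu.
Hypothesis mu_nb : forall x, mu x - x \in [:: e; - e; s; - s].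
Variables (I : finType) (pt : I -> G) (D : {set I}).
Hypothesis mD : min_cycle mu pt D.
Local Notation f := (straight mu).
Hypothesis f_neq : forall x, f x != x.
Hypothesis sNs : s != - s.

(** From x, go to the first step by -s and then back to the last step by s before it. All steps in
    between are by e or -e; since [mu] is injective, the cycle cannot reverse, so there is at least
    one such step and all have the same direction. *)
Lemma cap_exists x y : pts pt D x -> mu x = x + s -> pts pt D y -> mu y = y - s ->
  exists d a x0, [/\ (d == e) || (d == - e), (0 < a)%N, pts pt D x0, mu x0 = x0 + s
    & (forall i, (i < a)%N -> mu (x0 + s *+ 2 + d *+ i.*2) = x0 + s *+ 2 + d *+ i.*2 + d) /\
      mu (x0 + s *+ 2 + d *+ a.*2) = x0 + s *+ 2 + d *+ a.*2 - s].
Proof.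
move=> /imageP[u0 u0D ->] mux /imageP[w0 w0D ->] muy.
have [g [gD gi gP]] := min_cycle_perm mD.
have gin u : u \in D -> g u \in D by move=> uD; rewrite -gD imset_f.
have conn : fconnect g u0 w0.
  pose B := [set u in D | fconnect g u0 u].
  have sB : B \subset D by apply/subsetP => u /setIdP[].
  have B0 : B != set0 by apply/set0Pn; exists u0; rewrite inE u0D connect0.
  have cl : closed_under mu pt B.
    apply/forall_inP => u /setIdP[uD cu]; apply/exists_inP; exists (g u).
      by rewrite inE gin //= (connect_trans cu) // fconnect1.
    by rewrite gP.
  by have := min_cycle_sub mD sB B0 cl => /setP/(_ w0); rewrite inE w0D.
pose X n := pt (iter n g u0).
have iterD n : iter n g u0 \in D by elim: n => //= n; apply: gin.
have XD n : pts pt D (X n) by apply/imageP; exists (iter n g u0).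
have XS n : X n.+1 = f (X n) by rewrite /X iterS gP.
have exn : exists n, mu (X n) == X n - s.
  by exists (findex g u0 w0); rewrite /X iter_findex // muy.
have [n /eqP downn minn] := ex_minnP exn.
have Xdiff n' : mu (X n'.+1) != mu (X n').
  by rewrite XS; apply/eqP => /(can_inj muK); apply/eqP/f_neq.
have up0 : mu (X 0) = X 0 + s by [].
have n_gt0 : (0 < n)%N.
  case: (n) downn => // down0; move: sNs.
  by rewrite -(inj_eq (addrI (X 0))) -up0 down0 eqxx.
have ex1 : exists j, (mu (X j) == X j + s) && (j < n)%N by exists 0%N; rewrite up0 eqxx.
have ub j : (mu (X j) == X j + s) && (j < n)%N -> (j <= n)%N by case/andP => _ /ltnW.
have [k /andP[/eqP upk ltkn] maxk] := ex_maxnP ex1 ub.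
have fk : X k.+1 = X k + s *+ 2 by rewrite XS /straight upk; ring.
have lt1 : (k.+1 < n)%N.
  rewrite ltn_neqAle ltkn andbT; apply/eqP => en.
  have : mu (X k.+1) = mu (X k) by rewrite upk en downn -en fk; ring.
  by move/eqP; rewrite (negbTE (Xdiff k)).
have dirX j : (k < j < n)%N -> (mu (X j) == X j + e) || (mu (X j) == X j - e).
  move=> /andP[ltkj ltjn]; have := mu_nb (X j); rewrite !inE !subr_eq ![_ + X j]addrC.
  have -> : (mu (X j) == X j + s) = false.
    by apply/negP => hj; have := maxk j; rewrite hj ltjn leqNgt ltkj => /(_ isT).
  have -> : (mu (X j) == X j - s) = false.
    by apply/negP => /minn; rewrite leqNgt ltjn.
  by rewrite !orbF.
pose d := mu (X k.+1) - X k.+1.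
have dP : (d == e) || (d == - e).
  by rewrite /d !subr_eq ![_ + X k.+1]addrC; apply: dirX; rewrite leqnn.
have allN c : (c == e) || (c == - e) -> (c == d) || (c == - d).
  by case/orP: dP => /eqP ->; rewrite ?opprK // orbC.
have run i : (k.+1 + i < n)%N -> mu (X (k.+1 + i)%N) = X (k.+1 + i)%N + d.
  elim: i => [|i IH] lti; first by rewrite addn0 /d addrC subrK.
  have lti' : (k.+1 + i < n)%N by apply: ltn_trans lti; rewrite addnS.
  have XSi : X (k.+1 + i.+1)%N = X (k.+1 + i)%N + d *+ 2.
    by rewrite addnS XS /straight IH //; ring.
  have rng : (k < k.+1 + i.+1 < n)%N by rewrite lti addSn ltnS leq_addr.
  have /orP := dirX _ rng.
  rewrite -![mu _ == _]subr_eq0 => h1.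
  have : (mu (X (k.+1 + i.+1)%N) - X (k.+1 + i.+1)%N == d)
      || (mu (X (k.+1 + i.+1)%N) - X (k.+1 + i.+1)%N == - d).
    apply: allN; rewrite !subr_eq ![_ + X (k.+1 + i.+1)%N]addrC -![mu _ == _]subr_eq0.
    exact/orP.
  rewrite !subr_eq ![_ + X (k.+1 + i.+1)%N]addrC => /orP[/eqP//|/eqP e1].
  have := Xdiff (k.+1 + i)%N; rewrite -addnS e1 XSi IH //.
  by rewrite (_ : X (k.+1 + i)%N + d *+ 2 - d = X (k.+1 + i)%N + d) ?eqxx //; ring.
have Xi i : (k.+1 + i <= n)%N -> X (k.+1 + i)%N = X k + s *+ 2 + d *+ i.*2.
  elim: i => [|i IH] lti; first by rewrite addn0 mulr0n addr0.
  rewrite addnS XS /straight run -?addnS // IH; last by apply: leq_trans lti; rewrite addnS.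
  by rewrite doubleS; ring.
exists d, (n - k.+1)%N, (X k); split=> //; first by rewrite subn_gt0.
split=> [i lti|].
  have lti' : (k.+1 + i < n)%N by rewrite -ltn_subRL.
  by rewrite -Xi ?run // ltnW.
by rewrite -Xi subnKC.
Qed.
End Cap.

Lemma exchangeC (G : comPzRingType) (mu : G -> G) px py adj D Win P R S side sg dl :
  exchange mu px py adj D Win P R S side sg dl ->
  exchange mu py px adj D Win P R S side sg dl.
Proof.
case=> u sz w d p c pr ss si ad.
have p' q : q \in P -> [/\ py q && px q, mu q = q + dl, D (mu (q - dl)) & side q = sg].
  by move=> /p[a b c' e]; split; rewrite 1?andbC.
have c' q b e : q \in P -> adj q b -> adj b e -> ~~ py e && ~~ px e -> Win e.
  by move=> qP qb be; rewrite andbC; apply: c qP qb be.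
have pr' q b : q \in P -> adj q b -> b != mu q ->
    [\/ S (mu b), mu b \in R
      | py (mu b) && px (mu b) /\
        let u := mu (mu b *+ 2 - b) in
        [|| py u || px u, D (straight mu u) && ~~ D u | D u && (b != mu b + dl)]].
  move=> qP qb nb; case: (pr q b qP qb nb) => [Sb|bR|[o i]].
  - by constructor 1.
  - by constructor 2.
  by constructor 3; rewrite andbC; split=> //; move: i => /=; rewrite [px _ || _]orbC.
exact: (Exchange u sz w d p' c' pr' ss si ad).
Qed.

Section CapExchange.
Variables (G : comPzRingType) (mu : G -> G) (h v : G) (px py : G -> bool).
Hypothesis muK : involutive mu.
Hypothesis mu_nb : forall x, mu x - x \in [:: h; - h; v; - v].
Hypotheses (pxD : {morph px : x y / x + y >-> x (+) y})
           (pyD : {morph py : x y / x + y >-> x (+) y}).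
Hypotheses (pxh : px h) (pxv : px v = false) (pyh : py h = false) (pyv : py v).
Hypotheses (h_inf : forall n, h *+ n = 0 -> n = 0%N) (v_inf : forall n, v *+ n = 0 -> n = 0%N).
Variable adj : rel G.
Hypothesis adjE : forall x y, adj x y = (y - x \in [:: h; - h; v; - v]).
Variables (I : finType) (pt : I -> G).
Hypothesis pt_inj : injective pt.
Hypothesis pt_even : forall u, ~~ px (pt u) && ~~ py (pt u).
Hypothesis win_conv : forall d x n i, d \in [:: h; - h; v; - v] -> (i <= n)%N ->
  win pt x -> win pt (x + d *+ n.*2) -> win pt (x + d *+ i.*2).
Local Notation f := (straight mu).
Variables (D : {set I}) (psi : G -> bool).
Hypothesis mD : min_cycle mu pt D.
Hypothesis psiP : face_parity mu (pts pt D) h v psi.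

Let dirs := [:: h; - h; v; - v].
Let faces d s : ((d == h) || (d == - h)) && ((s == v) || (s == - v)) ->
  exists2 phi, face_parity mu (pts pt D) d s phi & face_parity mu (pts pt D) s d phi.
Proof.
move=> /andP[dh sv].
have [phi fp] : exists phi, face_parity mu (pts pt D) d v phi.
  case/orP: dh => /eqP ->; first by exists psi.
  by exists (fun w => psi (w - h)); apply: face_parityN.
have [phi' fp'] : exists phi, face_parity mu (pts pt D) s d phi.
  case/orP: sv => /eqP ->; first by exists phi; apply: face_parityC.
  by exists (fun w => phi (w - v)); apply/face_parityN/face_parityC.
by exists phi' => //; apply: face_parityC.
Qed.

Let frame d s : ((d == h) || (d == - h)) && ((s == v) || (s == - v)) ->
  (forall x, (x \in [:: d; - d; s; - s]) = (x \in dirs)) /\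
  (forall x, (x \in [:: s; - s; d; - d]) = (x \in dirs)).
Proof.
by move=> /andP[/orP[]/eqP -> /orP[]/eqP ->]; split=> x; rewrite !inE ?opprK;
  case: (x == h); case: (x == - h); case: (x == v); case: (x == - v).
Qed.

Let N_inf (e : G) : (forall n, e *+ n = 0 -> n = 0%N) -> forall n, (- e) *+ n = 0 -> n = 0%N.
Proof. by move=> e_inf n /eqP; rewrite mulNrn oppr_eq0 => /eqP/e_inf. Qed.
Let p0 (p : G -> bool) : {morph p : x y / x + y >-> x (+) y} -> forall x, p (- x) = p x.
Proof.
move=> pD x; have p0 : p 0 = false by have := pD 0 0; rewrite addr0; case: (p 0).
by have := pD x (- x); rewrite subrr p0; case: (p x); case: (p _).
Qed.

(** Reflections, and interchanging h with v when s is horizontal, bring the cap into the position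
    treated by [exchange_exists]. *)
Lemma cap_exchange x y s : s \in [:: h; - h; v; - v] ->
  pts pt D x -> mu x = x + s -> pts pt D y -> mu y = y - s ->
  exists P R S side sg dl, exchange mu px py adj (pts pt D) (win pt) P R S side sg dl.
Proof.
move=> sN Dx mx Dy my.
have Df z : pts pt D z -> pts pt D (f z) by apply: pts_straight.
have Dwin z : pts pt D z -> win pt z by apply: pts_win.
have Dev z : pts pt D z -> ~~ px z && ~~ py z by move=> /Dwin/codomP[u ->].
have Dev' z : pts pt D z -> ~~ py z && ~~ px z by rewrite andbC; apply: Dev.
have Dinj := pts_inj pt_inj mD.
have fneq z : f z != z by exact: (f_neq mu_nb h_inf v_inf).
have sNs (e : G) : (forall n, e *+ n = 0 -> n = 0%N) -> e != - e.
  by move=> e_inf; rewrite -subr_eq0 opprK -mulr2n; apply/eqP => /e_inf.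
have [sv|sh] : ((s == v) || (s == - v)) \/ ((s == h) || (s == - h)).
  by move: sN; rewrite !inE => /or4P[] ->; rewrite ?orbT; [right|right|left|left].
- have s_inf n : s *+ n = 0 -> n = 0%N.
    by case/orP: sv n => /eqP -> n; [apply: v_inf | apply: N_inf].
  have fr0 := frame (d := h) (s := s); rewrite eqxx sv in fr0.
  have mu_nb0 z : mu z - z \in [:: h; - h; s; - s] by have [-> _] := fr0 isT.
  have [d [a [x0 [dh a_gt0 Dx0 mx0 [top last]]]]] :=
    cap_exists muK mu_nb0 mD fneq (sNs _ s_inf) Dx mx Dy my.
  have ds : ((d == h) || (d == - h)) && ((s == v) || (s == - v)) by rewrite dh.
  have [phi fp _] := faces ds; have [fr _] := frame ds.
  have d_inf n : d *+ n = 0 -> n = 0%N.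
    by case/orP: dh n => /eqP -> n; [apply: h_inf | apply: N_inf].
  have dd : d \in dirs by rewrite /dirs !inE orbA dh.
  have [pd ps] : (px d && ~~ py d) /\ (~~ px s && py s).
    by case/orP: dh sv => /eqP -> /orP[] /eqP ->; rewrite ?p0 ?pxh ?pxv ?pyh ?pyv.
  case/andP: pd ps => pd1 /negbTE pd2 /andP[/negbTE ps1 ps2].
  have nb z : mu z - z \in [:: d; - d; s; - s] by rewrite fr.
  have aE z w : adj z w = (w - z \in [:: d; - d; s; - s]) by rewrite fr adjE.
  have wc z n i : (i <= n)%N -> win pt z -> win pt (z + d *+ n.*2) -> win pt (z + d *+ i.*2).
    exact: win_conv.
  have zt i : (i < a)%N -> mu (cell d s x0 i.*2 + s) = cell d s x0 i.*2.+1 + s.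
    move=> lti; have -> : cell d s x0 i.*2 + s = x0 + s *+ 2 + d *+ i.*2 by rewrite cellE; ring.
    by rewrite top // cellE; ring.
  have zl : mu (cell d s x0 a.*2 + s) = cell d s x0 a.*2.
    have -> : cell d s x0 a.*2 + s = x0 + s *+ 2 + d *+ a.*2 by rewrite cellE; move: a.*2 => n; ring.
    by rewrite last cellE; move: a.*2 => n; ring.
  have [P [R [S [sg [dl X]]]]] := exchange_exists muK nb pxD pyD pd1 ps1 pd2 ps2 d_inf s_inf
    Df Dinj Dev Dwin wc fp a_gt0 Dx0 mx0 zt zl aE.
  by exists P, R, S, phi, sg, dl.
have s_inf n : s *+ n = 0 -> n = 0%N.
  by case/orP: sh n => /eqP -> n; [apply: h_inf | apply: N_inf].
have fr0 := frame (d := s) (s := v); rewrite eqxx sh in fr0.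
have mu_nb0 z : mu z - z \in [:: v; - v; s; - s] by have [_ ->] := fr0 isT.
have [d [a [x0 [dv a_gt0 Dx0 mx0 [top last]]]]] :=
  cap_exists muK mu_nb0 mD fneq (sNs _ s_inf) Dx mx Dy my.
have ds : ((s == h) || (s == - h)) && ((d == v) || (d == - v)) by rewrite sh.
have [phi _ fp] := faces ds; have [_ fr] := frame ds.
have d_inf n : d *+ n = 0 -> n = 0%N.
  by case/orP: dv n => /eqP -> n; [apply: v_inf | apply: N_inf].
have dd : d \in dirs by rewrite /dirs !inE; case/orP: dv => ->; rewrite ?orbT.
have [ps pd] : (px s && ~~ py s) /\ (~~ px d && py d).
  by case/orP: sh dv => /eqP -> /orP[] /eqP ->; rewrite ?p0 ?pxh ?pxv ?pyh ?pyv.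
case/andP: ps pd => ps1 /negbTE ps2 /andP[/negbTE pd1 pd2].
have nb z : mu z - z \in [:: d; - d; s; - s] by rewrite fr.
have aE z w : adj z w = (w - z \in [:: d; - d; s; - s]) by rewrite fr adjE.
have wc z n i : (i <= n)%N -> win pt z -> win pt (z + d *+ n.*2) -> win pt (z + d *+ i.*2).
  exact: win_conv.
have zt i : (i < a)%N -> mu (cell d s x0 i.*2 + s) = cell d s x0 i.*2.+1 + s.
  move=> lti; have -> : cell d s x0 i.*2 + s = x0 + s *+ 2 + d *+ i.*2 by rewrite cellE; ring.
  by rewrite top // cellE; ring.
have zl : mu (cell d s x0 a.*2 + s) = cell d s x0 a.*2.
  have -> : cell d s x0 a.*2 + s = x0 + s *+ 2 + d *+ a.*2 by rewrite cellE; move: a.*2 => n; ring.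
  by rewrite last cellE; move: a.*2 => n; ring.
have [P [R [S [sg [dl X]]]]] := exchange_exists muK nb pyD pxD pd2 ps2 pd1 ps1 d_inf s_inf
  Df Dinj Dev' Dwin wc fp a_gt0 Dx0 mx0 zt zl aE.
by exists P, R, S, phi, sg, dl; apply: exchangeC.
Qed.
End CapExchange.

(** * The helical tube *)

Notation tube := (bool * int)%type.

Section Tube.
Variable t : nat.
(* (b, z) and (b', z') are adjacent when z' = z +- 1 in the same row or
   z' = z +- t in different rows; reducing z modulo 2m+1 gives T(2,2m+1,+-2t).
   [turn k] generates the deck transformations. *)
Definition hstep : tube := (false, 1).
Definition vstep : tube := (true, t%:Z).
Definition tadj (x y : tube) := y - x \in [:: hstep; - hstep; vstep; - vstep].

Definition col_parity (x : tube) := odd `|x.2| (+) (x.1 && odd t).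
Definition row_parity (x : tube) := x.1.

Lemma tubeD (x y : tube) : x + y = (x.1 (+) y.1, x.2 + y.2). Proof. by []. Qed.
Lemma tubeN (x : tube) : - x = (x.1, - x.2). Proof. by []. Qed.

Lemma col_parityD : {morph col_parity : x y / x + y >-> x (+) y}.
Proof.
move=> [b x] [c y]; rewrite /col_parity /=.
have -> : odd `|x + y| = odd `|x| (+) odd `|y| by lia.
by case: b c => [] []; case: (odd t); case: (odd _); case: (odd _).
Qed.
Lemma row_parityD : {morph row_parity : x y / x + y >-> x (+) y}.
Proof. by []. Qed.

Lemma tube_mulrn (x : tube) n : x *+ n = (odd n && x.1, n%:Z * x.2).
Proof.
elim: n => [|n IH]; first by rewrite mul0r.
rewrite mulrS IH tubeD /=; congr (_, _); last by lia.
by case: (x.1); case: (odd n).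
Qed.

Lemma hstep_inf n : hstep *+ n = 0 -> n = 0%N.
Proof. by rewrite tube_mulrn => -[_] /=; lia. Qed.
Hypothesis t_gt0 : (0 < t)%N.
Lemma vstep_inf n : vstep *+ n = 0 -> n = 0%N.
Proof. by rewrite tube_mulrn => -[_] /=; move: t_gt0; clear; nia. Qed.

(* Membership in the ray of positive multiples of vstep. *)
Definition above (g : tube) := (0 < g.2) && [exists i : 'I_(`|g.2|.+1), (g.2 == (i * t)%N) && (odd i == g.1)].

Lemma aboveP g : reflect (exists2 i, (0 < i)%N & g = vstep *+ i) (above g).
Proof.
apply: (iffP andP) => [[g_gt0 /existsP[i /andP[/eqP e /eqP o]]]|[i i_gt0 ->]].
  exists i; first by rewrite lt0n; apply: contraTneq g_gt0 => i0; rewrite e i0.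
  by rewrite tube_mulrn /= o andbT -PoszM -e; case: (g).
rewrite tube_mulrn /= andbT; split; first by rewrite -PoszM ltz_nat muln_gt0 i_gt0.
have lti : (i < `|(i%:Z * t%:Z)%R|.+1)%N by rewrite abszM ltnS leq_pmulr.
by apply/existsP; exists (Ordinal lti); rewrite /= -PoszM !eqxx.
Qed.

Lemma above_vstep g : above (g + vstep) = above g (+) (g == 0).
Proof.
apply/idP/idP => [/aboveP[[//|[|i]] _ e]|].
- have -> : g = 0 by apply: (addIr vstep); rewrite e add0r.
  by rewrite eqxx /above ltxx.
- have eg : g = vstep *+ i.+1 by apply: (addIr vstep); rewrite e mulrSr.
  have -> : above g by apply/aboveP; exists i.+1.
  by case: eqP => // g0; have := vstep_inf (etrans (esym eg) g0).
have [->|_] := eqVneq g 0; first by move=> _; apply/aboveP; exists 1%N; rewrite ?add0r.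
by rewrite addbF => /aboveP[i i_gt0 ->]; apply/aboveP; exists i.+1; rewrite // mulrSr.
Qed.

Variable m : nat.
Let q := m.*2.+1.
Definition turn (k : int) : tube := (false, k * q%:Z).
Section Good.
Variable mu : tube -> tube.
(** X lives on the torus, that is modulo turns, whereas cycles are controlled in the tube.
    [good_turn] keeps the representatives distinct on the torus, and [good_arc] makes every arc
    between them an arc of the tube, so that no cycle closes up only after a turn. *)
Record good (L : seq tube) : Prop := Good {
  good_size : (m <= size L)%N;
  good_uniq : uniq L;
  good_turn : forall x k, x \in L -> x + turn k \in L -> k = 0;
  good_indep : forall x y k, x \in L -> y \in L -> ~~ tadj x (y + turn k);
  good_arc : forall x y k, x \in L -> y \in L -> y != x -> tadj (mu x) (y + turn k) -> k = 0;
  good_acyclic : acyclic mu tadj L }.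
End Good.

Definition row0 (u : 'I_m) : tube := (false, u.*2%:Z).

Lemma row0_inj : injective row0.
Proof. by move=> u w [] e; apply: val_inj; move: e; rewrite /=; clear; lia. Qed.

Lemma row0_even u : ~~ col_parity (row0 u) && ~~ row_parity (row0 u).
Proof. by rewrite /col_parity /row_parity /= odd_double. Qed.

Lemma winP x : reflect [/\ x.1 = false, 0 <= x.2, x.2 <= m.*2%:Z - 2 & odd `|x.2| = false] (win row0 x).
Proof.
apply: (iffP idP) => [/codomP[u ->]|].
  by rewrite /row0 /= odd_double; split=> //; have := ltn_ord u; clear; lia.
case: x => -[] z [] //= _ z_ge0 z_le z_even.
have ltu : (`|z|./2 < m)%N by clear -z_ge0 z_le z_even; lia.
by apply/codomP; exists (Ordinal ltu); rewrite /row0 /=; congr (_, _); clear -z_ge0 z_even; lia.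
Qed.

Lemma win_conv (d x : bool * int) n i : d \in [:: hstep; - hstep; vstep; - vstep] -> (i <= n)%N ->
  win row0 x -> win row0 (x + d *+ n.*2) -> win row0 (x + d *+ i.*2).
Proof.
case: x => b z _ le_in /winP[/= -> {b} x_ge0 x_le x_even] /winP[].
rewrite !tube_mulrn !odd_double !tubeD /= => _ n_ge0 n_le _.
have : (0 <= i.*2%:Z * d.2 <= n.*2%:Z * d.2) || (n.*2%:Z * d.2 <= i.*2%:Z * d.2 <= 0).
  have [ge0|lt0] := leP 0 d.2.
    have -> : 0 <= i.*2%:Z * d.2 by rewrite mulr_ge0.
    by rewrite ler_wpM2r // lez_nat leq_double.
  have -> : i.*2%:Z * d.2 <= 0 by rewrite mulr_ge0_le0 // ltW.
  by rewrite andbT orbC ler_wnM2r ?lez_nat ?leq_double //; apply: ltW.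
have : odd `|(i.*2%:Z * d.2)%R| = false by rewrite abszM oddM /= odd_double.
move: (i.*2%:Z * d.2) (n.*2%:Z * d.2) n_ge0 n_le => ei en n_ge0 n_le ei_even le_e.
apply/winP; split=> //=.
- by clear -x_ge0 n_ge0 le_e; lia.
- by clear -x_le n_le le_e; lia.
by clear -x_even ei_even; lia.
Qed.

Section Window.
Hypothesis le_tm : (t <= m)%N.
Variable mu : tube -> tube.
Hypothesis muK : involutive mu.
Hypothesis adj_mu : forall x, tadj x (mu x).

Lemma tadj_cases x y : tadj x y ->
  (x.1 = y.1 /\ (y.2 = x.2 + 1 \/ y.2 = x.2 - 1)) \/
  (x.1 = ~~ y.1 /\ (y.2 = x.2 + t%:Z \/ y.2 = x.2 - t%:Z)).
Proof.
rewrite /tadj !inE !subr_eq => /or4P[]/eqP-> /=; rewrite ?negbK; [left|left|right|right];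
  split=> //; clear; lia.
Qed.

Lemma turn_cases k : (k = 0 /\ k * q%:Z = 0) \/ k * q%:Z = q%:Z \/ k * q%:Z = - q%:Z \/
  k * q%:Z <= - (2 * q%:Z) \/ 2 * q%:Z <= k * q%:Z.
Proof.
have [->|[->|[->|[k2|k2]]]] : k = 0 \/ k = 1 \/ k = -1 \/ k <= -2 \/ 2 <= k by clear; lia.
- by left; rewrite mul0r.
- by right; left; rewrite mul1r.
- by right; right; left; rewrite mulN1r.
- by right; right; right; left; rewrite -mulNr ler_wpM2r.
by right; right; right; right; rewrite ler_wpM2r.
Qed.

Lemma turnE (x : tube) k : x + turn k = (x.1, x.2 + k * q%:Z).
Proof. by rewrite tubeD addbF. Qed.

(** The corner condition confines a new vertex [(true, z)] to t + 1 <= z <= 2m - 3 - t. Together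
    with the column parities and the odd length 2m + 1 of a turn, these bounds exclude every
    adjacency and every arc that involves a nonzero turn. *)
Lemma window_good L : uniq L -> (m <= size L)%N -> acyclic mu tadj L ->
  (forall x, x \in L -> win row0 x \/
    [/\ col_parity x, row_parity x & forall b e, tadj x b -> tadj b e ->
       ~~ col_parity e && ~~ row_parity e -> win row0 e]) -> good mu L.
Proof.
move=> uL sL aL LP.
have {}LP x : x \in L ->
    [/\ x.1 = false, 0 <= x.2, x.2 <= m.*2%:Z - 2 & odd `|x.2| = false] \/
    [/\ x.1 = true, t%:Z + 1 <= x.2, x.2 <= m.*2%:Z - 3 - t%:Z & odd `|x.2| = ~~ odd t].
  case/LP => [/winP|[cx rx corner]]; [by left|right].
  have inw d e : d \in [:: hstep; - hstep; vstep; - vstep] -> e \in [:: hstep; - hstep; vstep; - vstep] ->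
      ~~ col_parity (x + d + e) && ~~ row_parity (x + d + e) -> win row0 (x + d + e).
    by move=> dI eI; apply: (corner (x + d)); rewrite /tadj addrAC subrr add0r.
  have par : odd `|x.2| = ~~ odd t.
    by clear -cx rx; case: x cx rx => -[] z //; rewrite /col_parity /=; case: (odd _); case: (odd t).
  have cor d e : d \in [:: hstep; - hstep] -> e \in [:: vstep; - vstep] ->
      win row0 (x + d + e).
    move=> dI eI; apply: inw.
    - by move: dI; rewrite !inE; do 4![case: (d == _)].
    - by move: eI; rewrite !inE; do 4![case: (e == _)].
    move: dI eI; rewrite !inE => /orP[]/eqP -> /orP[]/eqP ->; rewrite !col_parityD !row_parityD cx [row_parity x]rx;
      by rewrite /col_parity /row_parity /= ?abszN /=; case: (odd t).
  have /winP[_ lo _ _] : win row0 (x - hstep - vstep) by apply: cor; rewrite !inE eqxx ?orbT.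
  have /winP[_ _ hi _] : win row0 (x + hstep + vstep) by apply: cor; rewrite !inE eqxx ?orbT.
  clear -rx par lo hi; case: x rx par lo hi => b z; rewrite /row_parity /= => -> par lo hi; split=> //; clear -lo hi; lia.
have {}LP x : x \in L -> exists i : int,
    (x.1 = false /\ x.2 = 2 * i /\ 0 <= i /\ i <= m%:Z - 1) \/
    (x.1 = true /\ x.2 = t%:Z + 1 + 2 * i /\ 0 <= i /\ i + t%:Z + 2 <= m%:Z).
  case/LP; case: x => b z /= [-> z1 z2 z3].
    by exists (z %/ 2)%Z; left; move: (divz_eq z 2) (modz_ge0 z (isT : 2 != 0 :> int)) (ltz_pmod z (isT : 0 < 2 :> int)) z1 z2 z3;
      move: (z %/ 2)%Z (z %% 2)%Z => i o; clear; lia.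
  exists ((z - t%:Z - 1) %/ 2)%Z; right; move: (divz_eq (z - t%:Z - 1) 2) z1 z2 z3.
  move: (modz_ge0 (z - t%:Z - 1) (isT : 2 != 0 :> int)) (ltz_pmod (z - t%:Z - 1) (isT : 0 < 2 :> int)).
  by move: ((z - _ - _) %/ 2)%Z ((z - _ - _) %% 2)%Z => i o; clear; lia.
have qE : q%:Z = 2 * m%:Z + 1 by rewrite /q; clear; lia.
split=> //.
- move=> [b z] k /LP[i /= xL]; rewrite turnE => /LP[j /= yL].
  move: (turn_cases k); move: (k * _) yL => kq yL; rewrite qE; move: yL => yL k_cases.
  case: xL => -[eb [ez [i0 im]]]; case: yL => -[eb' [ez' [j0 jm]]]; try by rewrite eb in eb'.
    case: k_cases => [[]//|k_cases]; exfalso; clear -ez ez' i0 im j0 jm k_cases; lia.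
  by case: k_cases => [[]//|k_cases]; exfalso; clear -ez ez' i0 im j0 jm k_cases t_gt0; lia.
- move=> [b z] [c w] k /LP[i /= xL] /LP[j /= yL]; rewrite turnE; apply/negP => /tadj_cases /=.
  move: (turn_cases k); move: (k * _) => kq; rewrite qE => k_cases a.
  case: xL => -[eb [ez [i0 im]]]; case: yL => -[eb' [ez' [j0 jm]]]; case: a => -[e a];
    try (by rewrite eb eb' in e); clear -k_cases a ez ez' i0 im j0 jm le_tm t_gt0;
    case: k_cases => [[_ k_cases]|[k_cases|[k_cases|[k_cases|k_cases]]]]; case: a => a; lia.
move=> x y k xL yL _; rewrite turnE => axy; have [i] := LP _ xL; have [j] := LP _ yL; move: (adj_mu x) axy.
case: x {xL} => b z; case: y {yL} => c w; case: (mu _) => d u /tadj_cases /= + /tadj_cases /=.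
move: (turn_cases k); move: (k * _) => kq; rewrite qE => k_cases a1 a2 yL xL.
have : (b = c /\ (w + kq - z = 0 \/ w + kq - z = 2 \/ w + kq - z = - 2 \/
      w + kq - z = 2 * t%:Z \/ w + kq - z = - (2 * t%:Z))) \/
    (b = ~~ c /\ - (t%:Z + 1) <= w + kq - z <= t%:Z + 1).
  case: a1 => -[-> a1]; case: a2 => -[-> a2]; rewrite ?negbK; [left|right|right|left];
    by split=> //; clear -a1 a2 t_gt0; lia.
case: xL => -[eb [ez [z1 z2]]]; case: yL => -[eb' [ez' [w1 w2]]] [] [e D];
  try (by rewrite eb eb' in e); clear -k_cases ez ez' z1 z2 w1 w2 D le_tm t_gt0;
  case: k_cases => [[]//|k_cases]; exfalso; case: k_cases => [k_cases|[k_cases|[k_cases|k_cases]]]; lia.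
Qed.
End Window.
End Tube.

(** * Cycles in the window: opposite steps or a winding run *)

Section Case3.
Variables (m t : nat).
Hypotheses (t_gt0 : (0 < t)%N) (le_tm : (t <= m)%N).
Variable mu : tube -> tube.
Hypothesis muK : involutive mu.
Hypothesis adj_mu : forall x, tadj t x (mu x).
Local Notation h := hstep.
Local Notation v := (vstep t).
Local Notation f := (straight mu).
Local Notation pt := (@row0 m).

Definition opposed (D : {set 'I_m}) := [exists u, exists w, [&& u \in D, w \in D &
  has (fun s => (mu (pt u) == pt u + s) && (mu (pt w) == pt w - s)) [:: h; - h; v; - v]]].

Let hNh : h != - h. Proof. by []. Qed.
Let vNv : v != - v.
Proof. by apply/eqP; case; move: t_gt0; clear; lia. Qed.
Let hv : h != v. Proof. by []. Qed.
Let hNv : h != - v. Proof. by []. Qed.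

Lemma window_case : (forall D, min_cycle mu pt D -> opposed D) -> exists L, good t m mu L.
Proof.
move=> opp.
have pxh : col_parity t h by [].
have pxv : col_parity t v = false by rewrite /col_parity /= addbb.
have exc D : min_cycle mu pt D -> exists P R S side sg dl,
    exchange mu (col_parity t) row_parity (tadj t) (pts pt D) (win pt) P R S side sg dl.
  move=> mD; have /existsP[u /existsP[w /and3P[uD wD /hasP[s sI /andP[/eqP mx /eqP my]]]]] := opp D mD.
  have Dx : pts pt D (pt u) by apply/imageP; exists u.
  have Dy : pts pt D (pt w) by apply/imageP; exists w.
  have [psi psiP] := jordan muK adj_mu hNh vNv hv hNv (above_vstep t_gt0) (@row0_inj m) mD.
  exact: (cap_exchange muK adj_mu (@col_parityD t) row_parityD pxh pxv erefl isT
    hstep_inf (vstep_inf t_gt0) (fun _ _ => erefl) (@row0_inj m) (@row0_even t m)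
    (@win_conv t m) mD psiP sI Dx mx Dy my).
have [L [uL sL] [aL LP]] := repair muK (fun _ _ => erefl) adj_mu (@col_parityD t) row_parityD
  pxh pxv erefl isT (@row0_inj m) (@row0_even t m) exc.
exists L; apply: window_good => //; by rewrite card_ord in sL.
Qed.

(** Since [vstep t *+ 2] is [(false, 2t)], the straight step from the last vertex leads back to
    [x0]: the path closes up after winding around the tube. *)
Definition monotone_run (e : int) (x0 : tube) :=
  (forall j : nat, (j < t)%N -> mu (x0 + (false, e * j.*2%:Z)) = x0 + (false, e * j.*2.+1%:Z)) /\
  mu (x0 + (false, e * t.*2%:Z)) = x0 + (true, e * t%:Z).

(** Let n be the number of horizontal steps from [x0] before the first vertical one. The vertical
    step moves back by 2t columns, so extremality of [x0] gives n >= t. If n > t, it would land on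
    the vertex number n - t of the run, which already has another predecessor. *)
Lemma extreme_run (D : {set 'I_m}) (e : int) (x0 : tube) : min_cycle mu pt D -> e = 1 \/ e = -1 ->
  (forall x, pts pt D x -> mu x = x + (false, e) \/ mu x = x + (true, - (e * t%:Z))) ->
  pts pt D x0 -> (forall x, pts pt D x -> e * x0.2 <= e * x.2) -> monotone_run e x0.
Proof.
move=> mD e1 steps Dx0 ext.
pose X n := iter n f x0.
have DX n : pts pt D (X n) by elim: n => //= n; apply: pts_straight.
have XS n : mu (X n) = X n + (false, e) -> X n.+1 = X n + (false, e * 2).
  move=> e2; rewrite /X iterS -/(X n) /straight e2.
  have -> : (false, e * 2) = (false, e) *+ 2 :> tube by rewrite tube_mulrn mulrC.
  by ring.
have Xrun n : (forall i, (i < n)%N -> mu (X i) != X i + (true, - (e * t%:Z))) ->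
    forall i, (i <= n)%N -> X i = x0 + (false, e * i.*2%:Z).
  move=> no; elim=> [_|i IH lti]; first by rewrite mulr0 addr0.
  have [//|/eqP] := steps _ (DX i); last by rewrite (negbTE (no i lti)).
  move/XS ->; rewrite IH ?(ltnW lti) // -addrA; congr (_ + (_, _)).
  by rewrite /= doubleS; clear; nia.
have exn : exists n, mu (X n) == X n + (true, - (e * t%:Z)).
  have [/existsP[n Xn]|/existsPn no] := boolP [exists n : 'I_m.+1, mu (X n) == X n + (true, - (e * t%:Z))].
    by exists n.
  have Xm := Xrun m (fun i lti => no (Ordinal (ltnW lti : (i < m.+1)%N))) _ (leqnn m).
  have := pts_win (DX m); have := pts_win Dx0; rewrite Xm.
  case/winP => _ a1 a2 _ /winP[_ /= b1 b2 _]; move: a1 a2 b1 b2; case: (x0) => b z /=; clear -e1.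
  by case: e1 => ->; lia.
have [n /eqP down minn] := ex_minnP exn.
have no i : (i < n)%N -> mu (X i) != X i + (true, - (e * t%:Z)).
  by move=> lti; apply/negP => /minn; rewrite leqNgt lti.
have Xi := Xrun n no.
have right i : (i < n)%N -> mu (X i) = X i + (false, e).
  by move=> /no/eqP nd; case: (steps _ (DX i)).
have XnS : f (X n) = x0 + (false, e * (n.*2%:Z - t.*2%:Z)).
  rewrite /straight down Xi //; case: (x0) => b z.
  by rewrite mulr2n !tubeD tubeN /=; congr (_, _); [case: b | clear; nia].
have le_tn : (t <= n)%N.
  have := ext _ (DX n.+1); rewrite {1}/X iterS -/(X n) XnS.
  by case: (x0) e1 => b z /= [] ->; clear; nia.
have ent : n = t.
  apply/eqP; rewrite eqn_leq le_tn andbT leqNgt; apply/negP => lttn.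
  have lt1 : (n - t.+1 < n)%N by rewrite ltn_subrL (leq_trans _ lttn).
  have eX : X n = X (n - t.+1)%N.
    apply: (pts_inj (@row0_inj m) mD) => //.
    rewrite XnS -[RHS]/(X (n - t.+1).+1) (XS _ (right _ lt1)) Xi ?(ltnW lt1) // -addrA.
    have -> : (n - t.+1)%N.*2%:Z = n.*2%:Z - t.*2%:Z - 2 by clear -lttn; lia.
    by congr (_ + (_, _)); rewrite /=; ring.
  move: eX; rewrite !Xi ?(ltnW lt1) // => /addrI[] e2; clear -e1 e2 lttn.
  by case: e1 e2 => ->; lia.
split=> [j ltj|]; last first.
  rewrite -{1}ent -Xi // down ent Xi ?ent // -addrA tubeD /=; congr (_ + (_, _)).
  by rewrite /=; clear; nia.
by rewrite -Xi ?right ?ent ?(ltnW ltj) // Xi ?ent ?(ltnW ltj) // -addrA tubeD /=; congr (_ + (_, _)); rewrite /=; clear; nia.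
Qed.

(** Without opposite steps a cycle has one horizontal and one vertical direction, moving the column
    in opposite senses because the cycle returns. The steps out of and into the leftmost column tell
    which: right and [- vstep t], with the run starting at the leftmost vertex, or left and
    [vstep t], with the run starting at the rightmost one. *)
Lemma opposed_or_run (D : {set 'I_m}) : min_cycle mu pt D ->
  opposed D \/ exists (e : int) (x0 : tube), (e = 1 \/ e = -1) /\ monotone_run e x0.
Proof.
move=> mD; have /minsetp/andP[/set0Pn[u1 u1D] _] := mD.
pose dirs := [:: h; - h; v; - v].
have [|nop] := boolP (opposed D); [by left|].
right.
have {}nop x y s : pts pt D x -> pts pt D y -> s \in dirs -> mu x = x + s -> mu y <> y - s.
  move=> /imageP[u uD ->] /imageP[w wD ->] sI e1 e2; case/negP: nop.
  apply/existsP; exists u; apply/existsP; exists w; rewrite uD wD.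
  by apply/hasP; exists s; rewrite // e1 e2 !eqxx.
have step x : exists2 s, s \in dirs & mu x = x + s.
  by exists (mu x - x); [exact: adj_mu | rewrite addrC subrK].
have [u0 u0D min_u0] := @arg_minnP _ u1 (mem D) val u1D.
have [u2 u2D max_u2] := @arg_maxnP _ u1 (mem D) val u1D.
have [g [gD gi gP]] := min_cycle_perm mD.
have Dpt u : u \in D -> pts pt D (pt u) by move=> uD; apply/imageP; exists u.
have col_min x : pts pt D x -> (pt u0).2 <= x.2.
  by case/imageP => u /min_u0 + ->; rewrite /=; clear; lia.
have col_max x : pts pt D x -> x.2 <= (pt u2).2.
  by case/imageP => u /max_u2 + ->; rewrite /=; clear; lia.
have [s sI ms] := step (pt u0).
have : (pt u0).2 <= (f (pt u0)).2 by apply/col_min/pts_straight/Dpt.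
have [w wD ew] : exists2 w, w \in D & pt u0 = f (pt w).
  by move: u0D; rewrite -{1}gD => /imsetP[w wD ->]; exists w; rewrite // gP.
have [s' sI' ms'] := step (pt w).
have := col_min _ (Dpt _ wD); rewrite {1}ew /straight ms ms' !mulr2n !tubeD !tubeN /=.
move=> s'_le s_ge.
have np (a b : tube) : a \in dirs -> b \in dirs -> mu (pt u0) = pt u0 + a ->
    mu (pt w) = pt w + b -> forall x c, pts pt D x -> c \in dirs -> mu x = x + c -> c != - a /\ c != - b.
  move=> aI bI ea eb x c Dx cI ec; split; apply/eqP => E.
    by apply: (nop _ _ _ (Dpt _ u0D) Dx aI ea); rewrite -E.
  by apply: (nop _ _ _ (Dpt _ wD) Dx bI eb); rewrite -E.
have NP := np _ _ sI sI' ms ms'.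
have [sneq _] := NP _ _ (Dpt _ wD) sI' ms'.
have [[es es']|[es es']] : (s = h /\ s' = - v) \/ (s = v /\ s' = - h).
  move: sI sI' sneq s_ge s'_le; rewrite !inE.
  by case/or4P => /eqP -> /or4P[] /eqP ->; rewrite /= ?eqxx //; move: t_gt0; clear;
    move=> ? n1 ? ?; first [by left | by right | exfalso; clear n1; lia].
- exists 1, (pt u0); split; first by left.
  apply: (extreme_run mD) => [|x Dx||x /col_min]; rewrite ?mul1r //; [by left| |exact: Dpt].
  have [c cI ec] := step x; have [] := NP _ _ Dx cI ec.
  rewrite es es' opprK; move: cI ec; rewrite !inE.
  by case/or4P => /eqP -> ec; rewrite ?eqxx // => _ _; [left | right].
exists (- 1), (pt u2); split; first by right.
apply: (extreme_run mD) => [|x Dx||x /col_max]; rewrite ?mulN1r ?lerN2 //; [by right| |exact: Dpt].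
have [c cI ec] := step x; have [] := NP _ _ Dx cI ec.
rewrite es es' opprK; move: cI ec; rewrite !inE.
by case/or4P => /eqP -> ec; rewrite ?eqxx // => _ _; [left | right; rewrite ?mulN1r ?opprK].
Qed.

End Case3.

(** * The annulus left by a monotone cycle *)

Section Annulus.
Variables (m t : nat).
Hypotheses (t_gt0 : (0 < t)%N) (le_tm : (t <= m)%N).
Variable mu : tube -> tube.
Hypothesis muK : involutive mu.
Hypothesis adj_mu : forall x, tadj t x (mu x).
Hypothesis mu_turn : forall x k, mu (x + turn m k) = mu x + turn m k.
Hypothesis run_h : forall j : nat, (j < t)%N -> mu (false, j.*2%:Z) = (false, j.*2.+1%:Z).
Hypothesis run_v : mu (false, t.*2%:Z) = (true, t%:Z).

(* What remains of the torus after deleting the path (false,0), ...,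
   (false,2t), (true,t), which mu preserves modulo a turn. *)
Definition annulus (x : tube) : bool :=
  if x.1 then t%:Z + 1 <= x.2 <= t%:Z + m.*2%:Z else t.*2%:Z + 1 <= x.2 <= m.*2%:Z.

Lemma mu_hole c : 0 <= c <= t.*2%:Z -> ~~ annulus (mu (false, c)).
Proof.
move=> c_range; have [ct|ct] := eqVneq c t.*2%:Z; first by rewrite ct run_v /annulus /=; clear; lia.
pose j := `|c|./2; have ltj : (j < t)%N by rewrite /j; move: c_range ct; clear; lia.
have [ec|ec] : c = j.*2%:Z \/ c = j.*2.+1%:Z by rewrite /j; move: c_range; clear; lia.
  by rewrite ec run_h // /annulus /=; clear -ltj; lia.
by rewrite ec -(run_h ltj) muK /annulus /=; clear -ltj; lia.
Qed.

Lemma mu_hole_turn c : m.*2.+1%:Z <= c < m.*2.+1%:Z + t.*2%:Z -> ~~ annulus (mu (false, c)).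
Proof.
move=> c_range; pose j := `|c - m.*2.+1%:Z|./2.
have ltj : (j < t)%N by rewrite /j; move: c_range; clear; lia.
have e1 (d : int) : (false, d + m.*2.+1%:Z) = (false, d) + turn m 1 :> tube.
  by rewrite turnE /= mul1r.
have [ec|ec] : c = j.*2%:Z + m.*2.+1%:Z \/ c = j.*2.+1%:Z + m.*2.+1%:Z.
- by rewrite /j; move: c_range; clear; lia.
- by rewrite ec e1 mu_turn run_h // turnE /annulus /=; clear; lia.
by rewrite ec e1 mu_turn -(run_h ltj) muK turnE /annulus /=; clear; lia.
Qed.

Lemma mu_top_row k : ~~ annulus (mu (true, t%:Z + k * m.*2.+1%:Z)).
Proof.
have -> : (true, t%:Z + k * m.*2.+1%:Z) = (true, t%:Z) + turn m k :> tube by rewrite turnE.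
rewrite mu_turn -run_v muK turnE /annulus /=.
have := turn_cases m k; move: (k * _) => kq; clear -le_tm; lia.
Qed.

(** Every neighbour of the annulus outside it lies on the deleted path or on its translate by one
    turn, and [mu] keeps such vertices outside. So the partner is in the annulus itself, not merely
    up to a turn. *)
Lemma annulus_mu x : annulus x -> annulus (mu x).
Proof.
move=> Ax; have := adj_mu x; apply: contraTT => nA; move: Ax; rewrite -{1 2}(muK x).
move: (mu x) nA => [b z] nA Ax; apply/negP => /tadj_cases.
have := mu_hole (c := z); have := mu_hole_turn (c := z).
have := mu_top_row 0; have := mu_top_row 1; rewrite mul0r mul1r addr0.
move=> top1 top0 hole1 hole0.
have {}top0 : (b, z) != (true, t%:Z) by apply: contraL Ax => /eqP ->.
have {}top1 : (b, z) != (true, t%:Z + m.*2.+1%:Z) by apply: contraL Ax => /eqP ->.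
case: b Ax nA top0 top1 => Ax; rewrite /annulus /= ?xpair_eqE /= => nA n0 n1.
  move: Ax; case: (mu _) => -[] w; rewrite /annulus /=.
    by move: nA n0 n1; clear; lia.
  by move: nA n0 n1 t_gt0 le_tm; clear; lia.
have {}hole0 : ~~ (0 <= z <= t.*2%:Z) by apply/negP => /hole0; rewrite Ax.
have {}hole1 : ~~ (m.*2.+1%:Z <= z < m.*2.+1%:Z + t.*2%:Z) by apply/negP => /hole1; rewrite Ax.
move: Ax; case: (mu _) => -[] w; rewrite /annulus /=.
  by move: nA hole0 hole1 t_gt0 le_tm; clear; lia.
by move: nA hole0 hole1 t_gt0 le_tm; clear; lia.
Qed.

Definition right x := mu x == x + hstep.
Definition left x := mu x == x - hstep.
Definition up x := mu x == x + vstep t.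
Definition down x := mu x == x - vstep t.

Variant direction x : bool -> bool -> bool -> bool -> Prop :=
  | DirRight of mu x = x + hstep : direction x true false false false
  | DirLeft of mu x = x - hstep : direction x false true false false
  | DirUp of mu x = x + vstep t : direction x false false true false
  | DirDown of mu x = x - vstep t : direction x false false false true.

Lemma directionP x : direction x (right x) (left x) (up x) (down x).
Proof.
have vNv : (vstep t == - vstep t) = false.
  by apply/eqP; case; move: t_gt0; clear; lia.
have Nvv : (- vstep t == vstep t) = false by rewrite eq_sym.
rewrite /right /left /up /down; have := adj_mu x.
rewrite /tadj !inE !subr_eq ![_ + x]addrC.
by case/or4P => /eqP e; rewrite e !(inj_eq (addrI x)) ?eqxx ?vNv ?Nvv /=; constructor.
Qed.

Lemma right_left b z : left (b, z + 1) = right (b, z).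
Proof.
have -> : (b, z + 1) = (b, z) + hstep by rewrite tubeD addbF.
by rewrite /left /right addrK (can2_eq muK muK) eq_sym.
Qed.

Lemma up_down b z : up (~~ b, z - t%:Z) = down (b, z).
Proof.
have -> : (~~ b, z - t%:Z) = (b, z) - vstep t by rewrite tubeD tubeN /= addbT.
by rewrite /up /down subrK (can2_eq muK muK) eq_sym.
Qed.

(** A proper 2-colouring of the tube: the summand t + 1 for the second row makes vertical steps
    change colour. Turns by odd multiples reverse it, so it does not descend to the torus. *)
Definition white (x : tube) := ~~ odd (`|x.2| + x.1 * t.+1).
Definition sgn c x : int := if white x == c then 1 else -1.

Lemma whiteD x y : white (x + y) = (white x == white y).
Proof.
case: x y => [b z] [c w]; rewrite /white !oddD !oddM !oddb /=.
have -> : odd `|z + w| = odd `|z| (+) odd `|w| by clear; lia.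
by case: b c => [] []; case: (odd t); do 2 case: (odd _).
Qed.

Lemma white_mu x : white (mu x) = ~~ white x.
Proof.
have wh : white hstep = false by [].
have wNh : white (- hstep) = false by [].
have wv : white (vstep t) = false by rewrite /white /= mul1n addnS /= addnn odd_double.
have wNv : white (- vstep t) = false by rewrite /white /= abszN mul1n addnS /= addnn odd_double.
have -> : white (mu x) = (white (mu x - x) == white x) by rewrite -whiteD subrK.
by have := adj_mu x; rewrite /tadj !inE => /or4P[]/eqP ->; rewrite ?wh ?wNh ?wv ?wNv.
Qed.

Definition annulus_seq : seq tube :=
  [seq (false, (t.*2 + 1 + i)%N%:Z) | i <- iota 0 (m.*2 - t.*2)] ++
  [seq (true, (t + 1 + i)%N%:Z) | i <- iota 0 m.*2].

Lemma mem_annulus_seq x : (x \in annulus_seq) = annulus x.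
Proof.
rewrite mem_cat; apply/orP/idP => [[]/mapP[i]|].
- by rewrite mem_iota => lti ->; rewrite /annulus /=; move: lti; clear; lia.
- by rewrite mem_iota => lti ->; rewrite /annulus /=; move: lti; clear; lia.
case: x => -[] z; rewrite /annulus /= => Az; [right|left]; apply/mapP.
  exists (absz (z - t%:Z - 1)%R); first by rewrite mem_iota; move: Az; clear; lia.
  by congr (_, _); move: Az; clear; lia.
exists (absz (z - t.*2%:Z - 1)%R); first by rewrite mem_iota; move: Az; clear; lia.
by congr (_, _); move: Az; clear; lia.
Qed.

Lemma annulus_uniq : uniq annulus_seq.
Proof.
rewrite cat_uniq !map_inj_uniq ?iota_uniq ?andbT /=; last 2 first.
- by move=> i j [] /eqP; rewrite eqn_add2l => /eqP.
- by move=> i j [] /eqP; rewrite eqn_add2l => /eqP.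
by apply/hasPn => x /mapP[i _ ->]; apply/mapP => -[].
Qed.

Definition tailsum (g : tube -> int) b z :=
  \sum_(x <- annulus_seq | (x.1 == b) && (z <= x.2)) g x.

Lemma tailsumS g b z : tailsum g b z = (if annulus (b, z) then g (b, z) else 0) + tailsum g b (z + 1).
Proof.
rewrite /tailsum (bigID (pred1 (b, z))) /=; congr (_ + _).
  rewrite (eq_bigl (pred1 (b, z))) /=; last first.
    by move=> x /=; case: (x =P (b, z)) => [->|_]; rewrite ?andbF //= eqxx lexx.
  rewrite -mem_annulus_seq; case: ifP => [Ax|/negbT n].
    by rewrite -big_filter (filter_pred1_uniq annulus_uniq Ax) big_seq1.
  by rewrite big1_seq // => x /andP[/eqP->]; rewrite (negbTE n).
apply: eq_bigl => -[c w]; rewrite xpair_eqE /=; case: (c == b) => //=.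
by apply/idP/idP; clear; lia.
Qed.

Lemma tailsum0 g b z : (forall w, z <= w -> ~~ annulus (b, w)) -> tailsum g b z = 0.
Proof.
move=> out; rewrite /tailsum big1_seq // => x /andP[/andP[/eqP xb zx]].
by rewrite mem_annulus_seq; case: x xb zx => c w /= -> zw; rewrite (negbTE (out w zw)).
Qed.

Definition flow c x : int := if up x then sgn c x else 0.
Definition height c b z := tailsum (flow c) b z.

(* The flow is a signed count of vertical edges; balancing the two colours in
   a tail of a row relates the heights of the two rows. *)
Lemma annulus_right b z :
  annulus (b, z + 1) && left (b, z + 1) = annulus (b, z) && right (b, z).
Proof.
rewrite right_left andbC [RHS]andbC; case: (boolP (right _)) => //= /eqP e.
have <- : mu (b, z) = (b, z + 1) by rewrite e tubeD addbF.
by apply/idP/idP => [/annulus_mu|]; [rewrite muK | exact: annulus_mu].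
Qed.

Lemma annulus_down b z :
  annulus (~~ b, z - t%:Z) && up (~~ b, z - t%:Z) = annulus (b, z) && down (b, z).
Proof.
rewrite up_down andbC [RHS]andbC; case: (boolP (down _)) => //= /eqP e.
have <- : mu (b, z) = (~~ b, z - t%:Z) by rewrite e tubeD tubeN addbT.
by apply/idP/idP => [/annulus_mu|]; [rewrite muK | exact: annulus_mu].
Qed.

Lemma sgn_mu c x : sgn c (mu x) = - sgn c x.
Proof. by rewrite /sgn white_mu; case: (white x) c => [] []. Qed.

Lemma annulus_hi b z : t%:Z + m.*2%:Z < z -> ~~ annulus (b, z).
Proof. by rewrite /annulus /=; case: b; clear; lia. Qed.

Lemma int_descent (P : int -> Prop) N z : (forall z, N <= z -> P z) ->
  (forall z, P (z + 1) -> P z) -> P z.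
Proof.
move=> hi step; have [/hi//|ltz] := leP N z.
have -> : z = N - `|N - z|%:Z by lia.
elim: `|N - z|%N => [|n IH]; first by apply: hi; lia.
by apply: step; rewrite (_ : N - n.+1%:Z + 1 = N - n%:Z) //; lia.
Qed.

(** Among the vertices of row b from z on, horizontal pairs cancel except one cut at z. Those
    matched up are counted by [height c b z], and those matched down, with the opposite sign, by the
    height of the other row from z - t on. *)
Lemma balance c b z :
  tailsum (sgn c) b z - height c b z + height c (~~ b) (z - t%:Z)
  = if annulus (b, z) && left (b, z) then sgn c (b, z) else 0.
Proof.
pattern z; apply: (@int_descent _ (t.*2%:Z + m.*2%:Z + 1)) => {}z.
  move=> z_hi; rewrite /height !tailsum0 => [|w zw|w zw|w zw].
  - by rewrite (negbTE (annulus_hi _ _)) //; clear -z_hi; lia.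
  - by apply: annulus_hi; clear -z_hi zw; lia.
  - by apply: annulus_hi; clear -z_hi zw; lia.
  - by apply: annulus_hi; clear -z_hi zw; lia.
have ez : z + 1 - t%:Z = z - t%:Z + 1 by clear; lia.
rewrite ez annulus_right => IH; rewrite /height !(tailsumS _ _ z) (tailsumS _ _ (z - t%:Z)).
rewrite -!/(height _ _ _) /flow.
have -> : (if annulus (~~ b, z - t%:Z) then if up (~~ b, z - t%:Z) then sgn c (~~ b, z - t%:Z) else 0 else 0)
    = if annulus (b, z) && down (b, z) then - sgn c (b, z) else 0.
  rewrite -annulus_down; case: ifP => //= _; case: ifP => //.
  rewrite up_down => /eqP e; rewrite -sgn_mu e tubeD tubeN /= addbT; reflexivity.
move: IH; rewrite (_ : (if _ && right _ then sgn c (b, z + 1) else 0)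
  = if annulus (b, z) && right (b, z) then - sgn c (b, z) else 0); last first.
  case: ifP => // /andP[_ /eqP e].
  by rewrite -sgn_mu e tubeD addbF.
move: (tailsum _ _ _) (height _ _ _) (height _ _ _) (sgn _ _) => T0 H0 H1 s0.
case: (annulus _) => /=; last by clear; lia.
by case: directionP => _; clear; lia.
Qed.

Definition low (b : bool) : int := if b then t%:Z + 1 else t.*2%:Z + 1.
Definition top (b : bool) : int := if b then t%:Z + m.*2%:Z else m.*2%:Z.
(** The sum of [sgn c] over a tail of row b starting at colour c: it is 1 exactly when the last
    vertex of the row has colour c. In particular [tau c false + tau c true = 1]. *)
Definition tau (c b : bool) : int := (c (+) b)%:Z.

Lemma annulusE b z : annulus (b, z) = (low b <= z <= top b).
Proof. by rewrite /annulus /low /top; case: b. Qed.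

Lemma white_next b z : white (b, z + 1) = ~~ white (b, z).
Proof.
have -> : (b, z + 1) = (b, z) + hstep by rewrite tubeD addbF.
by rewrite whiteD /=; case: (white _).
Qed.

Lemma white_top b : white (b, top b + 1) = b.
Proof. by rewrite /white /top; case: b => /=; clear; lia. Qed.

Lemma sgn_sum c b z : low b <= z <= top b + 1 ->
  tailsum (sgn c) b z = tau c b - (white (b, z) != c)%:Z.
Proof.
pattern z; apply: (@int_descent _ (top b + 1)) => {}z => [z_hi z_range|IH z_range].
  have -> : z = top b + 1 by apply/eqP; rewrite eq_le z_hi; case/andP: z_range => _ ->.
  rewrite tailsum0 => [|w zw]; last by rewrite annulusE; clear -zw; lia.
  by rewrite white_top /tau; case: (c) (b) => [] [].
have [z_top|z_top] := leP z (top b); last first.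
  have -> : z = top b + 1 by clear -z_range z_top; lia.
  rewrite tailsum0 => [|w zw]; last by rewrite annulusE; clear -zw; lia.
  by rewrite white_top /tau; case: (c) (b) => [] [].
have Az : annulus (b, z) by rewrite annulusE z_top; case/andP: z_range => ->.
rewrite tailsumS Az IH; last by clear -z_range z_top; lia.
by rewrite white_next /sgn /tau; case: (white _); case: (c); case: (b).
Qed.

Lemma height_step c b z : annulus (b, z) -> ~~ left (b, z) ->
  height c b z = height c (~~ b) (z - t%:Z) + tau c b - (white (b, z) != c)%:Z.
Proof.
move=> Az nl; have := balance c b z; rewrite Az (negbTE nl) /= sgn_sum.
  by move: (height _ _ _) (height _ _ _) (tau _ _) (_ != _) => H0 H1 T w; clear; lia.
by move: Az; rewrite annulusE; clear; lia.
Qed.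

Lemma heightS c b z : height c b z = (if annulus (b, z) then flow c (b, z) else 0) + height c b (z + 1).
Proof. exact: tailsumS. Qed.

Lemma height_nup c b z : ~~ up (b, z) -> height c b z = height c b (z + 1).
Proof. by move=> nu; rewrite heightS /flow (negbTE nu) if_same add0r. Qed.

Definition tail c x := [&& annulus x, right x || up x & white x == c].
(** Two consecutive zigzags, right then down or up then left, change the column by 2t - 2 and the
    height by 1 in the same sense, because the two values of [tau c] add up to 1; this is the origin
    of the factor 2t - 2. The corrections in row [true] make each single zigzag neutral. *)
Definition potential c (x : tube) : int :=
  x.2 - (if x.1 then t%:Z - 1 else 0) - (t.*2%:Z - 2) * (height c x.1 x.2 - (if x.1 then tau c true else 0)).

(* The potential never decreases along an arc, and it is constant only along
   zigzags that change rows at every step; there the height is monotone. *)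
Lemma potential_arc c x y : tail c x -> tail c y -> y != x -> tadj t (mu x) y ->
  potential c x < potential c y \/ potential c x = potential c y /\ y.1 = ~~ x.1 /\
   ((right x /\ right y /\ height c y.1 y.2 = height c x.1 x.2 - tau c x.1) \/
    (up x /\ up y /\ height c y.1 y.2 = height c x.1 x.2 + tau c (~~ x.1))).
Proof.
case: x y => [b z] [d u] /and3P[Ax tx /eqP wx] /and3P[Ay ty /eqP wy] neq.
have nlx : ~~ left (b, z) by move: tx; case: (directionP (b, z)).
have nly : ~~ left (d, u) by move: ty; case: (directionP (d, u)).
have hx := height_step c Ax nlx; have hy := height_step c Ay nly.
rewrite wx eqxx /= subr0 in hx; rewrite wy eqxx /= subr0 in hy.
have pot_eq (k : int) : height c d u = height c b z + k ->
  potential c (d, u) - potential c (b, z) = u - z - (t%:Z - 1) * (d%:Z - b%:Z)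
   - (t.*2%:Z - 2) * (k - (d%:Z - b%:Z) * tau c true).
  rewrite /potential /= => ->; move: (height _ _ _) (tau _ _) => H T.
  by case: (b) (d) => [] []; rewrite /=; clear; ring.
have pos (k : int) : height c d u = height c b z + k ->
    0 < u - z - (t%:Z - 1) * (d%:Z - b%:Z) - (t.*2%:Z - 2) * (k - (d%:Z - b%:Z) * tau c true) ->
    potential c (b, z) < potential c (d, u).
  by move=> hk k_pos; rewrite -subr_gt0 (pot_eq _ hk).
have null (k : int) : height c d u = height c b z + k ->
    u - z - (t%:Z - 1) * (d%:Z - b%:Z) - (t.*2%:Z - 2) * (k - (d%:Z - b%:Z) * tau c true) = 0 ->
    potential c (b, z) = potential c (d, u).
  by move=> hk k0; apply/eqP; rewrite eq_sym -subr_eq0 (pot_eq _ hk) k0.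
have [rx|ux] := orP tx.
  have [nux ndx] : ~~ up (b, z) /\ ~~ down (b, z) by move: rx; case: (directionP (b, z)).
  have lx : left (b, z + 1) by rewrite right_left.
  have [nux1 ndx1] : ~~ up (b, z + 1) /\ ~~ down (b, z + 1).
    by move: lx; case: (directionP (b, z + 1)).
  have hb : height c b z = height c b (z + 1) by apply: height_nup.
  have -> : mu (b, z) = (b, z + 1) by rewrite (eqP rx) tubeD addbF.
  move=> /tadj_cases /= [[bd [eu|eu]]|[bd [eu|eu]]].
  - left; apply: (pos 0); first by rewrite addr0 hb (@height_nup c b _ nux1) -bd eu.
    by rewrite -bd eu /tau; case: (b); case: (c); clear; lia.
  - by case/eqP: neq; rewrite -bd eu addrK.
  - left; apply: (pos (tau c d)); first by rewrite hy -bd eu addrK hb.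
    by rewrite eu bd /tau; case: (d); case: (c); move: t_gt0; clear; lia.
  have edb : d = ~~ b by rewrite bd negbK.
  have hk : height c d u = height c b z - tau c b.
    have ez : z - t%:Z + 1 = u by rewrite eu; clear; lia.
    by rewrite hx (@height_nup c (~~ b) (z - t%:Z)) ?up_down // ez -edb addrK.
  right; split; [apply: (null _ hk) | split=> //; left; split=> //; split=> //].
    by rewrite eu edb /tau; case: (b); case: (c); clear; lia.
  by move: ty; rewrite edb eu up_down (negbTE ndx1) orbF.
have dx : down (~~ b, z + t%:Z) by rewrite -up_down negbK addrK.
have [nlx1 nux1] : ~~ left (~~ b, z + t%:Z) /\ ~~ up (~~ b, z + t%:Z).
  by move: dx; case: (directionP (~~ b, z + t%:Z)).
have ex : mu (b, z) = (~~ b, z + t%:Z) by rewrite (eqP ux) tubeD addbT.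
have hb : height c (~~ b) (z + t%:Z) = height c b z + tau c (~~ b) - 1.
  rewrite height_step //; last by rewrite -ex annulus_mu.
  by rewrite negbK addrK -ex white_mu wx; case: (c).
rewrite ex => /tadj_cases /= [[bd [eu|eu]]|[bd [eu|eu]]].
- left; apply: (pos (tau c (~~ b) - 1)).
    by rewrite addrA -hb -bd eu -height_nup.
  by rewrite -bd eu /tau; case: (b); case: (c); move: t_gt0; clear; lia.
- have uy : up (d, u).
    by move: ty; rewrite -right_left eu subrK -bd (negbTE nlx1).
  have hk : height c d u = height c b z + tau c (~~ b).
    by rewrite heightS Ay /flow uy /sgn wy eqxx eu subrK -bd hb addrC subrK.
  right; split; [apply: (null _ hk) | by split=> //; right].
  by rewrite eu -bd /tau; case: (b); case: (c); clear; lia.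
- have edb : d = b by rewrite -[d]negbK -bd negbK.
  left; apply: (pos 0).
    rewrite hy edb eu addrK hb addr0 /tau; move: (height _ _ _) => H.
    by case: (b); case: (c); clear; lia.
  by rewrite edb eu /tau; case: (b); case: (c); move: t_gt0; clear; lia.
by case/eqP: neq; rewrite eu addrK -[d]negbK -bd negbK.
Qed.

Lemma perm_sum_const (C : seq tube) (s : tube -> tube) (F : tube -> int) :
  uniq C -> {in C &, injective s} -> {in C, forall x, s x \in C} ->
  {in C, forall x, F x <= F (s x)} -> {in C, forall x, F (s x) = F x}.
Proof.
move=> uC injs sC leF x xC; apply/eqP; rewrite -subr_eq0.
have perm : perm_eq (map s C) C.
  apply: uniq_perm => //; first by rewrite map_inj_in_uniq.
  move=> y; apply/mapP/idP => [[z zC ->]|yC]; first exact: sC.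
  by have [z zC <-] := in_map_perm uC injs sC yC; exists z.
have : \sum_(x <- C) (F (s x) - F x) == 0.
  by rewrite sumrB -[X in _ - X](perm_big _ perm) big_map subrr.
rewrite big_seq_cond psumr_eq0 => [/allP/(_ x xC)|z /andP[zC _]]; last by rewrite subr_ge0 leF.
by rewrite xC.
Qed.

(** On a cycle the potential is constant, so all arcs are zigzags. The height is then monotone,
    hence constant; but rows alternate, and [tau c], by which the height changes, is 1 in one of the
    two rows. *)
Lemma tail_acyclic c L : {in L, forall x, tail c x} -> acyclic mu (tadj t) L.
Proof.
move=> Lt C s uC sCL injs sP.
have sC : {in C, forall x, s x \in C} by move=> x /sP[].
have arc x : x \in C -> _ :=
  fun xC => potential_arc (Lt _ (sCL _ xC)) (Lt _ (sCL _ (sC _ xC))) (let: And3 _ a _ := sP x xC in a)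
    (let: And3 _ _ a := sP x xC in a).
have pot : {in C, forall x, potential c (s x) = potential c x}.
  by apply: perm_sum_const => // x /arc[/ltW|[->]].
have {}arc x : x \in C -> (s x).1 = ~~ x.1 /\
   ((right x /\ right (s x) /\ height c (s x).1 (s x).2 = height c x.1 x.2 - tau c x.1) \/
    (up x /\ up (s x) /\ height c (s x).1 (s x).2 = height c x.1 x.2 + tau c (~~ x.1))).
  by move=> xC; case: (arc x xC) => [|[_]//]; rewrite pot ?ltxx.
(* Zigzags right then down lower the height and zigzags up then left raise it; with this sign
   neither kind lowers F. *)
pose F x := if right x then - height c x.1 x.2 else height c x.1 x.2.
have tau_ge0 b : 0 <= tau c b by rewrite /tau; case: (c (+) b).
have up_nr x : up x -> right x = false by case: (directionP x).
have rise : {in C, forall x, F (s x) = F x}.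
  apply: perm_sum_const => // x /arc[_ [[r [r' e]]|[u [u' e]]]]; rewrite /F.
    by rewrite r r' e lerN2 gerBl.
  by rewrite !up_nr // e lerDl.
have tau0 x : x \in C -> tau c (if right x then x.1 else ~~ x.1) = 0.
  move=> xC; have := rise x xC; have [_ [[r [r' e]]|[u [u' e]]]] := arc x xC; rewrite /F.
    by rewrite r r' e; move: (height _ _ _) (tau _ _) => H T; clear; lia.
  by rewrite !up_nr // e; move: (height _ _ _) (tau _ _) => H T; clear; lia.
case: C uC sCL injs sP sC arc tau0 {pot rise} => // x C _ _ _ _ sC arc tau0.
have := tau0 _ (sC x (mem_head _ _)); have := tau0 x (mem_head _ _).
have [-> [[r [r' _]]|[u [u' _]]]] := arc x (mem_head _ _); rewrite ?r ?r' ?up_nr // /tau;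
  by case: (c); case: (x.1).
Qed.

Definition tails c := [seq x <- annulus_seq | tail c x].

Lemma pair_sum (g : tube -> int) : \sum_(x <- annulus_seq) g x =
  \sum_(x <- annulus_seq | right x || up x) (g x + g (mu x)).
Proof.
rewrite (bigID (fun x => right x || up x)) /= big_split /=; congr (_ + _).
have perm : perm_eq (map mu annulus_seq) annulus_seq.
  apply: uniq_perm; rewrite ?annulus_uniq ?map_inj_uniq ?annulus_uniq //; first exact: can_inj muK.
  move=> x; apply/mapP/idP => [[y yA ->]|xA].
    by rewrite mem_annulus_seq annulus_mu // -mem_annulus_seq.
  by exists (mu x); rewrite ?muK // mem_annulus_seq annulus_mu // -mem_annulus_seq.
rewrite -(perm_big _ perm) big_map; apply: eq_bigl => x.
have -> : right (mu x) = left x.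
  by rewrite /right /left muK -subr_eq eq_sym.
have -> : up (mu x) = down x.
  by rewrite /up /down muK -subr_eq eq_sym.
by case: directionP.
Qed.

Lemma tails_sum (g : tube -> int) k1 k2 :
  (forall x, white x -> g x = k1) -> (forall x, ~~ white x -> g x = k2) ->
  \sum_(x <- annulus_seq | right x || up x) g x
  = k1 * (size (tails true))%:Z + k2 * (size (tails false))%:Z.
Proof.
move=> g1 g2; rewrite (bigID white) /=; congr (_ + _).
  rewrite (eq_bigr (fun=> k1)) => [|x /andP[_ /g1]//].
  rewrite big_const_seq iter_addr_0 -mulr_natr natz; congr (_ * (_ : nat)%:Z).
  rewrite size_filter; apply: eq_in_count => x; rewrite mem_annulus_seq /tail => -> /=.
  by case: (white x).
rewrite (eq_bigr (fun=> k2)) => [|x /andP[_ /g2]//].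
rewrite big_const_seq iter_addr_0 -mulr_natr natz; congr (_ * (_ : nat)%:Z).
rewrite size_filter; apply: eq_in_count => x; rewrite mem_annulus_seq /tail => -> /=.
by case: (white x).
Qed.

Lemma size_tails : (size (tails true))%:Z + (size (tails false))%:Z = m.*2%:Z - t%:Z.
Proof.
have := pair_sum (fun=> 1); rewrite (tails_sum (k1 := 2) (k2 := 2)) //.
rewrite big_const_seq iter_addr_0 natz count_predT size_cat !size_map !size_iota.
by move: le_tm; clear; lia.
Qed.

Definition rowsum (g : tube -> int) b := \sum_(x <- annulus_seq | x.1 == b) g x.

Lemma rowsumE (g : tube -> int) b z : z <= low b -> tailsum g b z = rowsum g b.
Proof.
move=> zb; rewrite /tailsum /rowsum big_seq_cond [RHS]big_seq_cond; apply: eq_bigl => -[c w].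
rewrite mem_annulus_seq annulusE /=; case: (c =P b) => [->|]; rewrite ?andbF //.
by move: zb; clear; lia.
Qed.

Lemma annulus_sum (g : tube -> int) : \sum_(x <- annulus_seq) g x = rowsum g false + rowsum g true.
Proof.
rewrite (bigID (fun x : tube => x.1 == false)) /=; congr (_ + _).
by apply: eq_bigl => x; case: (x.1).
Qed.

Lemma moment b z : low b <= z <= top b + 1 ->
  4 * tailsum (fun x => sgn true x * x.2) b z
  = sgn true (b, z) * (2 * z - 1) - sgn true (b, top b + 1) * (2 * top b + 1).
Proof.
pattern z; apply: (@int_descent _ (top b + 1)) => {}z => [z_hi z_range|IH z_range].
  have -> : z = top b + 1 by apply/eqP; rewrite eq_le z_hi; case/andP: z_range => _ ->.
  rewrite tailsum0 => [|w zw]; last by rewrite annulusE; clear -zw; lia.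
  by move: (sgn _ _) => S; move: (top b) => T; clear; lia.
have [z_top|z_top] := leP z (top b); last first.
  have -> : z = top b + 1 by clear -z_range z_top; lia.
  rewrite tailsum0 => [|w zw]; last by rewrite annulusE; clear -zw; lia.
  by move: (sgn _ _) => S; move: (top b) => T; clear; lia.
have Az : annulus (b, z) by rewrite annulusE z_top; case/andP: z_range => ->.
rewrite tailsumS Az mulrDr IH; last by clear -z_range z_top; lia.
rewrite {2}/sgn white_next; move: (sgn true (b, top b + 1)) => S; rewrite /sgn.
by case: (white _) => /=; clear; lia.
Qed.

(** Row [true] of the annulus as a whole has equally many vertices of both colours and cuts no
    horizontal edge, so [balance] leaves only the two fluxes. *)
Lemma even_flux : rowsum (flow true) true = rowsum (flow true) false.
Proof.
have := balance true true (low true).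
have -> : annulus (true, low true) && left (true, low true) = false.
  by apply/negP => /andP[/annulus_mu + /eqP e]; rewrite e tubeD tubeN /annulus /low /= addrK gerDl ler10.
rewrite sgn_sum; last by rewrite /low /top; clear; lia.
rewrite /height !rowsumE //; last by rewrite /low /=; move: t_gt0; clear; lia.
have -> : white (true, low true) by rewrite /white /low /=; clear; lia.
by rewrite /tau /=; move: (rowsum _ _) (rowsum _ _) => F G; clear; lia.
Qed.

(** The sum of the signed columns over the annulus is computed in two ways. Row by row it is -t, by
    [moment]. Edge by edge, a horizontal edge with tail x contributes [- sgn true x] and a vertical
    one t times as much. *)
Lemma tails_balance : (size (tails true))%:Z - (size (tails false))%:Z
   + 2 * (t%:Z - 1) * rowsum (flow true) true = t%:Z.
Proof.
have := pair_sum (fun x => sgn true x * x.2).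
have -> : \sum_(x <- annulus_seq | right x || up x) (sgn true x * x.2 + sgn true (mu x) * (mu x).2)
  = \sum_(x <- annulus_seq | right x || up x) (- sgn true x) + (1 - t%:Z) *
    \sum_(x <- annulus_seq | right x || up x) flow true x.
  rewrite big_distrr -big_split; apply: eq_bigr => x; rewrite sgn_mu /flow /=.
  case: directionP => // -> _; case: (x) => b z; rewrite tubeD /=; move: (sgn _ _) => S; clear; lia.
rewrite (@tails_sum (fun x => - sgn true x) (-1) 1); last 2 first.
- by move=> x xw; rewrite /sgn xw.
- by move=> x /negbTE xw; rewrite /sgn xw.
have -> : \sum_(x <- annulus_seq | right x || up x) flow true x = rowsum (flow true) false + rowsum (flow true) true.
  rewrite -annulus_sum [RHS](bigID (fun x => right x || up x)) /= [X in _ = _ + X]big1 ?addr0 // => x.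
  by rewrite /flow; case: directionP.
rewrite annulus_sum -even_flux.
have lo b : low b <= low b <= top b + 1.
  by rewrite lexx /low /top; case: (b); move: le_tm; clear; lia.
have := moment (lo false); have := moment (lo true).
rewrite !rowsumE //.
have -> : sgn true (true, low true) = 1 by rewrite /sgn /white /low /= (_ : odd _ = false) //; clear; lia.
have -> : sgn true (false, low false) = -1 by rewrite /sgn /white /low /= (_ : odd _ = true) //; clear; lia.
have -> : sgn true (true, top true + 1) = 1 by rewrite /sgn white_top.
have -> : sgn true (false, top false + 1) = -1 by rewrite /sgn white_top.
move: (rowsum _ _) => M1; move: (rowsum (fun=> _) _) => M0; move: (rowsum _ _) => F.
move: (size _) (size _) => a b; rewrite /low /top.
move: le_tm; clear => le_tm M1P M0P.
have {}M1P : 4 * M1 = - 4 * m%:Z by rewrite M1P; lia.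
have {}M0P : 4 * M0 = 4 * m%:Z - 4 * t%:Z by rewrite M0P; lia.
by lia.
Qed.

(** Let a and b be the two sizes and F the flux. If F <= 0 then a - b >= t, and if F >= 1 then a - b
    <= 2 - t; with a + b = 2m - t this gives a >= m or b >= m - 1. *)
Lemma many_tails : (m <= size (tails true))%N \/ (m <= (size (tails false)).+1)%N.
Proof.
have := tails_balance; have := size_tails.
move: (rowsum _ _) (size (tails true)) (size (tails false)) => F a b ab bal.
have [F0|F0] := leP F 0; [left|right].
  have : (t%:Z - 1) * F <= 0 by rewrite mulr_ge0_le0 //; move: t_gt0; clear; lia.
  by move: ab bal; rewrite -mulrA; move: (_ * F) => Z; clear; lia.
have : 0 <= (t%:Z - 1) * (F - 1) by rewrite mulr_ge0 //; move: t_gt0 F0; clear; lia.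
by move: ab bal; rewrite -mulrA mulrBr mulr1; move: (_ * F) => Z; clear; lia.
Qed.

(** A tail is never in the last column t + 2m of row [true], since its partner would leave the
    annulus. That column is traded for column t, which admits the corner [(true, t)]. *)
Definition near_annulus (x : tube) : bool :=
  if x.1 then t%:Z <= x.2 < t%:Z + m.*2%:Z else t.*2%:Z < x.2 <= m.*2%:Z.

Lemma tail_near c x : tail c x -> near_annulus x /\ white x = c.
Proof.
case: x => b z /and3P[Ax rux /eqP <-]; split=> //; have := annulus_mu Ax.
have [/eqP->|/eqP->] := orP rux; rewrite tubeD ?addbF ?addbT; move: Ax; rewrite /annulus /near_annulus /=;
  case: b {rux} => /=; move: t_gt0; clear; lia.
Qed.

Lemma near_good c L : uniq L -> (m <= size L)%N -> acyclic mu (tadj t) L ->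
  {in L, forall x, near_annulus x /\ white x = c} -> good t m mu L.
Proof.
move=> uL sL aL Lnear; split=> //.
- move=> [b z] k /Lnear[+ _]; rewrite turnE => + /Lnear[+ _]; rewrite /near_annulus /=.
  by have := turn_cases m k; move: (k * _) => kq; case: b; clear; lia.
- move=> [b z] [d w] k /Lnear[xn xw] /Lnear[yn yw]; rewrite turnE; apply/negP => /tadj_cases /=.
  have := turn_cases m k; move: (k * _) => kq k_cases a.
  have : white (b, z) = white (d, w) by rewrite xw yw.
  rewrite /white /=; move: xn yn; rewrite /near_annulus /= {xw yw}.
  case: a => -[-> a]; case: d => /=; rewrite ?mul0n ?mul1n ?addn0; move: a k_cases t_gt0 le_tm; clear => a k_cases t0 tm xn yn xyw; lia.
move=> x y k /Lnear[xn xw] /Lnear[yn yw] _; rewrite turnE.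
have : white x = white y by rewrite xw yw.
move: (adj_mu x) (turn_cases m k) xn yn {xw yw}; move: (k * _) => kq.
case: (mu x) => e u; case: x => b z; case: y => d w /tadj_cases /= a1 k_cases xn yn xyw /tadj_cases /= a2.
have D : (b = d /\ (w + kq - z = 0 \/ `|w + kq - z| = 2 \/ `|w + kq - z| = t.*2%:Z)) \/
    (b = ~~ d /\ (`|w + kq - z| = t%:Z + 1 \/ `|w + kq - z| = t%:Z - 1)).
  case: a1 => -[-> a1]; case: a2 => -[-> a2]; rewrite ?negbK; [left|right|right|left];
    by split=> //; clear -a1 a2 t_gt0; lia.
move: xn yn xyw D {a1 a2}; rewrite /near_annulus /white /= => xn yn xyw [] [eb D]; subst b;
  case: d xn yn xyw => /=; rewrite ?mul0n ?mul1n ?addn0 => xn yn xyw;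
  move: xn yn xyw k_cases D t_gt0 le_tm; clear => *; lia.
Qed.

(** If the tails of colour [false] are one short of m, the corner [(true, t)] of the deleted path,
    of the same colour, is added. No arc enters it: its only neighbour in the annulus is
    [(true, t + 1)], which is not the right or upper end of a matching edge of the annulus. *)
Lemma annulus_case : exists L, good t m mu L.
Proof.
have uT c : uniq (tails c) by rewrite filter_uniq ?annulus_uniq.
have tT c : {in tails c, forall x, tail c x} by move=> x; rewrite mem_filter => /andP[].
have nT c : {in tails c, forall x, near_annulus x /\ white x = c} by move=> x /tT/tail_near.
have [le_m|le_m] := many_tails.
  by exists (tails true); apply: near_good (uT _) le_m (tail_acyclic (tT _)) (nT _).
have ncorner : (true, t%:Z) \notin tails false.
  by apply/negP => /tT/and3P[+ _]; rewrite /annulus /=; clear; lia.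
exists ((true, t%:Z) :: tails false); apply: (@near_good false) => //.
- by rewrite /= ncorner uT.
- move=> C s uC sCL injs sP.
  have nC : (true, t%:Z) \notin C.
    apply/negP => cC; have [x xC sx] := in_map_perm uC injs (fun x xC => let: And3 a _ _ := sP x xC in a) cC.
    have [_ + ] := sP x xC; rewrite sx => nx.
    have := sCL x xC; rewrite inE eq_sym (negbTE nx) /= => /tT/and3P[Ax /orP rx _].
    move: (annulus_mu Ax) => Ay /tadj_cases ey.
    have emu : mu x = (true, t%:Z + 1).
      move: Ay ey; case: (mu x) => -[] z; rewrite /annulus /= => Az [] [] // _ ez;
        by congr (_, _); move: ez Az t_gt0; clear; lia.
    move: Ax; case: rx => /eqP ex.
      have -> : x = (true, t%:Z) by rewrite -[x](addrK hstep) -ex emu tubeD tubeN /= addrK.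
      by rewrite /annulus /=; clear; lia.
    have -> : x = (false, 1) by rewrite -[x](addrK (vstep t)) -ex emu tubeD tubeN /= addrAC subrr add0r.
    by rewrite /annulus /=; move: t_gt0; clear; lia.
  apply: (tail_acyclic (tT false) uC) injs sP => x xC.
  by have := sCL x xC; rewrite inE; case: eqP => // ex; rewrite -ex xC in nC.
move=> x; rewrite inE => /orP[/eqP->|/nT//]; split.
  by rewrite /near_annulus /=; move: t_gt0 le_tm; clear; lia.
by rewrite /white /=; clear; lia.
Qed.
End Annulus.

(** * Symmetries of the tube: moving the run to the origin *)

Section Transport.
Variables (m t : nat).
Hypotheses (t_gt0 : (0 < t)%N) (le_tm : (t <= m)%N).
Variable mu : tube -> tube.
Hypothesis muK : involutive mu.
Hypothesis adj_mu : forall x, tadj t x (mu x).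
Hypothesis mu_turn : forall x k, mu (x + turn m k) = mu x + turn m k.

Section Frame.
Variables (e : int) (x0 : tube).
Hypothesis e1 : e = 1 \/ e = -1.
Definition mirror (x : tube) : tube := (x.1, e * x.2).
Definition place x := x0 + mirror x.
Definition unplace x := mirror (x - x0).
Definition moved x := unplace (mu (place x)).

Lemma mirrorK : involutive mirror.
Proof. by case=> b z; rewrite /mirror /=; case: e1 => ->; congr (_, _); clear; lia. Qed.
Lemma mirrorD x y : mirror (x + y) = mirror x + mirror y.
Proof. by rewrite /mirror !tubeD mulrDr. Qed.
Lemma mirrorN x : mirror (- x) = - mirror x.
Proof. by rewrite /mirror !tubeN mulrN. Qed.
Lemma placeK : cancel place unplace.
Proof. by move=> x; rewrite /place /unplace addrC addKr mirrorK. Qed.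
Lemma unplaceK : cancel unplace place.
Proof. by move=> x; rewrite /place /unplace mirrorK addrC subrK. Qed.

Lemma mirror_steps d : (mirror d \in [:: hstep; - hstep; vstep t; - vstep t])
  = (d \in [:: hstep; - hstep; vstep t; - vstep t]).
Proof.
rewrite !inE !(can2_eq mirrorK mirrorK) !mirrorN.
by case: e1 => e2; rewrite /mirror e2 /= ?mul1r // !mulN1r !tubeN /= !opprK;
  case: (d == _); case: (d == _); case: (d == _); case: (d == _).
Qed.

Lemma tadj_place x y : tadj t (place x) (place y) = tadj t x y.
Proof.
rewrite /tadj (_ : place y - place x = mirror (y - x)) ?mirror_steps //.
by rewrite /place mirrorD mirrorN; ring.
Qed.

Lemma place_turn x k : place x + turn m k = place (x + turn m (e * k)).
Proof.
rewrite /place mirrorD -addrA; congr (_ + (_ + _)); rewrite /mirror /turn /=; congr (_, _).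
by case: e1 => ->; clear; lia.
Qed.

Lemma mu_place x : mu (place x) = place (moved x).
Proof. by rewrite /moved unplaceK. Qed.

Lemma e_inv k : e * k = 0 -> k = 0.
Proof. by case: e1 => ->; clear; lia. Qed.

Lemma good_moved L : good t m moved L -> good t m mu (map place L).
Proof.
have inj := can_inj placeK.
case=> sL uL tL iL aL cL; split.
- by rewrite size_map.
- by rewrite map_inj_uniq.
- by move=> _ k /mapP[x xL ->]; rewrite place_turn mem_map // => /(tL _ _ xL)/e_inv.
- by move=> _ _ k /mapP[x xL ->] /mapP[y yL ->]; rewrite place_turn tadj_place iL.
- move=> _ _ k /mapP[x xL ->] /mapP[y yL ->].
  by rewrite (inj_eq inj) place_turn mu_place tadj_place => yx /(aL _ _ _ xL yL yx)/e_inv.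
move=> C s uC sCL injs sP.
have CE x : (x \in map unplace C) = (place x \in C).
  by rewrite -(mem_map inj) -map_comp map_id_in // => z _; exact: unplaceK.
suff /(congr1 size) : map unplace C = [::] by rewrite size_map => /size0nil.
apply: (cL _ (unplace \o s \o place)).
- by rewrite map_inj_uniq //; apply: can_inj unplaceK.
- by move=> x; rewrite CE => /sCL; rewrite mem_map.
- by move=> x y; rewrite !CE => xC yC e2; apply/inj/injs => //; apply: (can_inj unplaceK) e2.
move=> x; rewrite !CE /= => /sP[sC sx a]; rewrite unplaceK; split=> //.
  by apply: contra sx => /eqP e2; rewrite -{2}e2 unplaceK.
by rewrite -tadj_place unplaceK -mu_place.
Qed.

Lemma movedK : involutive moved.
Proof. by move=> x; rewrite /moved unplaceK muK placeK. Qed.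

Lemma adj_moved x : tadj t x (moved x).
Proof. by rewrite -tadj_place -mu_place. Qed.

Lemma moved_turn x k : moved (x + turn m k) = moved x + turn m k.
Proof.
have ek : e * (e * k) = k by case: e1 => ->; clear; lia.
apply: (can_inj placeK); rewrite -mu_place -[k in LHS]ek -place_turn mu_turn mu_place.
by rewrite place_turn ek.
Qed.
End Frame.

Lemma good_exists : exists L, good t m mu L.
Proof.
have [/forallP all_opp|] := boolP [forall D, min_cycle mu (@row0 m) D ==> opposed t mu D].
  apply: window_case => // D mD; exact: (implyP (all_opp D)).
rewrite negb_forall => /existsP[D]; rewrite negb_imply => /andP[mD /negbTE nD].
have [|[e [x0 [e1 [run_h run_v]]]]] := opposed_or_run t_gt0 adj_mu mD.
  by rewrite nD.
have pl b z : place e x0 (b, z) = x0 + (b, e * z) by [].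
have run_h' (j : nat) : (j < t)%N -> moved e x0 (false, j.*2%:Z) = (false, j.*2.+1%:Z).
  by move=> ltj; apply: (can_inj (placeK x0 e1)); rewrite -(mu_place x0 e1) !pl run_h.
have run_v' : moved e x0 (false, t.*2%:Z) = (true, t%:Z).
  by apply: (can_inj (placeK x0 e1)); rewrite -(mu_place x0 e1) !pl run_v.
have [L gL] := annulus_case t_gt0 le_tm (movedK x0 e1) (adj_moved x0 e1) (moved_turn x0 e1) run_h' run_v'.
by exists (map (place e x0) L); apply: good_moved.
Qed.
End Transport.

(** * Two rows *)

Section Columns.
Variable m : nat.
Local Notation q := (2 * m + 1)%N.

Fact col_subproof (z : int) : (absz (z %% q%:Z)%Z < q)%N.
Proof.
have q_neq0 : q%:Z != 0 by rewrite addn1.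
have := modz_ge0 z q_neq0; have : (z %% q%:Z)%Z < q%:Z by rewrite ltz_pmod // addn1.
by move: (_ %% _)%Z => c; clear; lia.
Qed.
Definition col (z : int) : 'I_q := Ordinal (col_subproof z).

Lemma val_col z : (val (col z))%:Z = (z %% q%:Z)%Z.
Proof. by rewrite /= gez0_abs // modz_ge0 // addn1. Qed.

Lemma col_eqP z w : col z = col w -> exists k, z = w + k * q%:Z.
Proof.
move=> /(congr1 (fun i : 'I_q => (val i)%:Z)); rewrite !val_col => e.
exists ((z %/ q%:Z)%Z - (w %/ q%:Z)%Z).
rewrite {1}(divz_eq z q%:Z) {1}(divz_eq w q%:Z) e.
by move: (_ %% _)%Z (_ %/ _)%Z (_ %/ _)%Z => a b c; ring.
Qed.

Lemma colD z k : col (z + k * q%:Z) = col z.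
Proof. by apply: val_inj; rewrite /= addrC modzMDl. Qed.

Lemma col_val (j : 'I_q) : col (val j)%:Z = j.
Proof. by apply: val_inj; rewrite /= modz_nat modn_small // ltn_ord. Qed.

Lemma col_addl z w : col ((val (col z))%:Z + w) = col (z + w).
Proof.
rewrite val_col {2}(divz_eq z q%:Z) -(colD (_ + _) (z %/ q%:Z)%Z); congr col.
by move: (_ %% _)%Z (_ %/ _)%Z => a b; ring.
Qed.

Lemma eq_col (i j : 'I_q) (a : nat) : val i == (val j + a)%N %[mod q] -> i = col ((val j)%:Z + a%:Z).
Proof.
by move=> /eqP e; apply: val_inj; rewrite /= -PoszD modz_nat /= -e modn_small // ltn_ord.
Qed.

Variables (p r : nat).
Local Notation torus := (torus p q r).

Lemma torus_nbr (i : 'I_p) z v : torus (i, col z) v ->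
  (v = (i, col (z + 1)) \/ v = (i, col (z - 1))) \/
  ((val v.1 = (i + 1)%N /\ v.2 = col z) \/ (val i = (v.1 + 1)%N /\ v.2 = col z) \/
   (val i = 0%N /\ val v.1 = (p - 1)%N /\ v.2 = col (z - r%:Z)) \/
   (val i = (p - 1)%N /\ val v.1 = 0%N /\ v.2 = col (z + r%:Z))).
Proof.
have back (j k : 'I_q) (a : nat) : j = col ((val k)%:Z + a%:Z) -> k = col ((val j)%:Z - a%:Z).
  by move=> ->; rewrite col_addl addrK col_val.
case: v => k j; rewrite /Defs.torus /torus_arc /= => /orP[] /or3P[].
- move=> /andP[/eqP <- /(@eq_col j (col z))]; rewrite col_addl => ->; by left; left.
- by move=> /andP[/eqP e /eqP <-]; right; left.
- move=> /and3P[/eqP e1 /eqP e2 /(@eq_col (col z) j)/back]; rewrite col_addl => ->.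
  by right; right; right; left.
- move=> /andP[/eqP -> /(@eq_col (col z) j)/back]; rewrite col_addl => ->; by left; right.
- by move=> /andP[/eqP e /eqP ->]; right; right; left.
move=> /and3P[/eqP e1 /eqP e2 /(@eq_col j (col z))]; rewrite col_addl => ->.
by right; right; right; right.
Qed.
End Columns.

Section TwoRows.
Variables (m r : nat) (c : int).
Local Notation q := (2 * m + 1)%N.
Local Notation t := `|c|%N.
Hypothesis t_gt0 : (0 < t)%N.
Hypothesis le_tm : (t <= m)%N.
Hypothesis rc : exists k, r%:Z + 2 * c = k * q%:Z.
Notation V := ('I_(2 * 1) * 'I_q)%type.
Local Notation adj := (torus (2 * 1) q r).

Fact row_subproof (b : bool) : (b < 2 * 1)%N. Proof. by case: b. Qed.
Let row (b : bool) : 'I_(2 * 1) := Ordinal (row_subproof b).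
(** c is half of -r modulo q. Shifting the second row by c turns the two vertical neighbours of
    column z, which lie in columns z and z - r, into z - c and z + c. *)
Definition unroll (x : tube) : V := (row x.1, col m (x.2 + x.1%:Z * c)).

Lemma row_inj : injective row.
Proof.
by move=> [] [] // /(congr1 val).
Qed.

Lemma turnq k : turn m k = (false, k * q%:Z).
Proof. by rewrite /turn mul2n addn1. Qed.

Lemma unroll_turn x k : unroll (x + turn m k) = unroll x.
Proof.
rewrite turnq /unroll tubeD addbF /=; congr (_, _).
by rewrite addrAC colD.
Qed.

Lemma unroll_eq x y : unroll x = unroll y -> exists k, x = y + turn m k.
Proof.
case: x y => [b z] [d w] /eqP; rewrite xpair_eqE => /andP[/eqP/row_inj /= -> /eqP/col_eqP[k e]]; exists k.
rewrite turnq tubeD addbF; congr (_, _); move: e; rewrite /=; clear; lia.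
Qed.

Lemma unroll_nbr x v : adj (unroll x) v -> exists2 d, d \in [:: hstep; - hstep; vstep t; - vstep t] & unroll (x + d) = v.
Proof.
have [k kq] := rc.
have [tc tNc] : (c = t%:Z \/ c = - t%:Z) /\ (- c = t%:Z \/ - c = - t%:Z) by clear; lia.
case: x v => b z [i j] /torus_nbr /= [[]|].
- move=> [-> ->]; exists hstep; first by rewrite inE eqxx.
  by rewrite /unroll tubeD addbF /= addrAC.
- move=> [-> ->]; exists (- hstep); first by rewrite !inE eqxx orbT.
  by rewrite /unroll tubeD tubeN addbF /= addrAC.
move=> H; have ei : i = row (~~ b).
  apply: val_inj; rewrite /=.
  by have := ltn_ord i; move: H; case: (b) => /=; clear; lia.
have up (w : int) : w = t%:Z \/ w = - t%:Z -> j = col m (z + w + (~~ b)%:Z * c) ->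
   exists2 d, d \in [:: hstep; - hstep; vstep t; - vstep t] & unroll ((b, z) + d) = (i, j).
  case=> -> ->; [exists (vstep t) | exists (- vstep t)]; rewrite ?inE ?eqxx ?orbT //.
    by rewrite /unroll tubeD /= addbT ei.
  by rewrite /unroll tubeD tubeN /= addbT ei.
case: b H ei up => /= H ei up.
  have [e|e] : j = col m (z + c) \/ j = col m (z + c + r%:Z).
  - case: H => [[a1 a2]|[[a1 a2]|[[a1 [a2 a3]]|[a1 [a2 a3]]]]] //.
    + by have := ltn_ord i; rewrite a1.
    + by left; rewrite a2 mul1r.
    by right; rewrite a3 mul1r.
  - by apply: (up c) => //; rewrite e mul0r addr0.
  apply: (up (- c)); first exact: tNc.
  rewrite e mul0r addr0 -(colD _ (z - c) k) -kq; congr col; clear; lia.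
have [e|e] : j = col m z \/ j = col m (z - r%:Z).
- case: H => [[a1 a2]|[[a1 a2]|[[a1 [a2 a3]]|[a1 [a2 a3]]]]] //.
  + by left; rewrite a2 mul0r addr0.
  + by move: a1; rewrite addn1.
  by right; rewrite a3 mul0r addr0.
- apply: (up (- c)); first exact: tNc.
  by rewrite e mul1r subrK.
apply: (up c) => //; rewrite e mul1r -(colD _ (z - r%:Z) k) -kq; congr col; clear; lia.
Qed.

(** As 0 < t <= m, the four neighbours of a vertex remain distinct modulo turns; hence [mu] lifts to
    the tube in only one way. *)
Lemma step_unique x d d' : d \in [:: hstep; - hstep; vstep t; - vstep t] ->
  d' \in [:: hstep; - hstep; vstep t; - vstep t] -> unroll (x + d) = unroll (x + d') -> d = d'.
Proof.
move=> dI dI' /unroll_eq[k]; rewrite -addrA => /addrI e.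
have k0 : k * q%:Z = d.2 - d'.2 by rewrite e turnq /=; clear; lia.
have : k = 0.
  move: k0 (congr1 fst e) t_gt0 le_tm; move: dI dI'; rewrite !inE.
  by case/or4P => /eqP-> /or4P[] /eqP-> //=; clear; nia.
by move=> k00; rewrite e k00 turnq mul0r addr0.
Qed.

Variable mu : V -> V.
Hypothesis muK : involutive mu.
Hypothesis adj_mu : forall v, adj v (mu v).
Let dirs := [:: hstep; - hstep; vstep t; - vstep t].

Let step x := nth 0 dirs (find (fun d => unroll (x + d) == mu (unroll x)) dirs).

Let stepP x : step x \in dirs /\ unroll (x + step x) = mu (unroll x).
Proof.
have hs : has (fun d => unroll (x + d) == mu (unroll x)) dirs.
  have [d dI e] := unroll_nbr (adj_mu (unroll x)).
  by apply/hasP; exists d => //; apply/eqP.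
split; first by rewrite mem_nth // -has_find.
exact/eqP/(nth_find 0 hs).
Qed.

Definition lift x := x + step x.

Lemma unroll_lift x : unroll (lift x) = mu (unroll x).
Proof. by have [] := stepP x. Qed.

Lemma adj_lift x : tadj t x (lift x).
Proof. by rewrite /tadj /lift addrAC subrr add0r; have [] := stepP x. Qed.

Lemma lift_eq x d : d \in dirs -> unroll (x + d) = mu (unroll x) -> lift x = x + d.
Proof.
move=> dI e; have [sI es] := stepP x.
by rewrite /lift (step_unique sI dI (etrans es (esym e))).
Qed.

Lemma liftK : involutive lift.
Proof.
move=> x; have [sI es] := stepP x.
rewrite (@lift_eq _ (- step x)); first by rewrite /lift addrK.
  move: sI; rewrite /dirs !inE -!eqr_oppLR !opprK.
  by do 4![case: (_ == _)].
by rewrite unroll_lift muK /lift addrK.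
Qed.

Lemma lift_turn x k : lift (x + turn m k) = lift x + turn m k.
Proof.
have [sI es] := stepP x; have e : x + turn m k + step x = x + step x + turn m k by rewrite addrAC.
by rewrite (@lift_eq _ (step x)) // e ?unroll_turn.
Qed.

Lemma two_rows : exists2 X : {set V}, (m <= #|X|)%N & alternation_free adj mu X.
Proof.
have [L [sL uL tL iL aL cL]] := good_exists t_gt0 le_tm liftK adj_lift lift_turn.
have inj : {in L &, injective unroll}.
  move=> x y xL yL /unroll_eq[k e]; have k0 : k = 0 by apply: (tL y) => //; rewrite -e.
  by rewrite e k0 turnq mul0r addr0.
have adjP x y : adj (unroll x) (unroll y) -> exists k, tadj t x (y + turn m k).
  move=> /unroll_nbr[d dI /unroll_eq[k e]]; exists k.
  by rewrite -e /tadj addrAC subrr add0r.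
exists [set v in map unroll L].
  by rewrite cardsE (card_uniqP _) ?size_map // map_inj_in_uniq.
split=> [u v|C s /subsetP CX injs sP].
  rewrite !inE => /mapP[x xL ->] /mapP[y yL ->]; apply/negP => /adjP[k].
  exact/negP/iL.
pose back u := nth 0 L (index u (map unroll L)).
have backP u : u \in C -> back u \in L /\ unroll (back u) = u.
  move=> /CX; rewrite inE => uL'; have lt : (index u (map unroll L) < size L)%N.
    by rewrite -(size_map unroll) index_mem.
  by split; [exact: mem_nth | rewrite -(nth_map 0 (unroll 0)) // nth_index].
pose C' := [seq x <- L | unroll x \in C].
have C'0 : C' = [::].
  apply: (cL C' (fun x => back (s (unroll x)))).
  - by rewrite filter_uniq.
  - by move=> x; rewrite mem_filter => /andP[].
  - move=> x y; rewrite !mem_filter => /andP[xC xL] /andP[yC yL] e.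
    apply: inj => //; apply: injs => //.
    have [sxC _ _] := sP _ xC; have [syC _ _] := sP _ yC.
    by rewrite -(backP _ sxC).2 -(backP _ syC).2 e.
  move=> x; rewrite !mem_filter => /andP[xC xL]; have [sxC sxx a] := sP _ xC.
  have [bL ub] := backP _ sxC; have neq : back (s (unroll x)) != x.
    by apply: contra sxx => /eqP e; rewrite -{2}e ub.
  rewrite ub sxC bL; split=> //.
  move: a; rewrite -{1}ub -unroll_lift => /adjP[k a].
  by have := a; rewrite (aL _ _ _ xL bL neq a) turnq mul0r addr0.
apply/setP => u; rewrite inE; apply/negP => uC; have [bL ub] := backP u uC.
by have := in_nil (back u); rewrite -C'0 mem_filter ub uC bL.
Qed.
End TwoRows.

(** * More rows *)

Section Strip.
Variables (V : finType) (mu : V -> V) (row : bool -> int -> V) (mid : int -> V).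
Variables (occ : bool -> int -> bool) (N : nat).
Hypothesis muK : involutive mu.
Hypothesis occ_bound : forall b p, occ b p -> `|p| <= N%:Z.
Hypothesis row_neq : forall b z, row b z <> row b (z + 2).
Hypothesis out : forall b p, occ b p ->
  (occ b (p + 1) /\ mu (row b (2 * p)) = row b (2 * p + 1)) \/
  (occ b (p - 1) /\ mu (row b (2 * p)) = row b (2 * p - 1)) \/
  (occ (~~ b) p /\ mu (row b (2 * p)) = mid (2 * p)).
Hypothesis into : forall b p, occ b p ->
  (occ b (p - 1) /\ mu (row b (2 * (p - 1))) = row b (2 * (p - 1) + 1)) \/
  (occ b (p + 1) /\ mu (row b (2 * (p + 1))) = row b (2 * (p + 1) - 1)) \/
  (occ (~~ b) p /\ mu (row (~~ b) (2 * p)) = mid (2 * p)).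
(** Needed only if row [true] is occupied, so that a single row is covered by leaving row [true]
    empty. *)
Definition crossable := [/\ forall b z w, row b z <> mid w, forall z, mid z <> mid (z + 2),
  forall z, mu (mid z) = mid (z - 1) \/ mu (mid z) = mid (z + 1) \/ exists b, mu (mid z) = row b z
  & forall b z, row b z <> row (~~ b) z].
Hypothesis cross : forall p, occ true p -> crossable.

Let mu_inj : injective mu := can_inj muK.

(* A closed set on two rows has a leftmost crossing and a next one; the odd
   number of middle vertices strictly between them would be matched among
   themselves. *)
Lemma strip_empty b p : occ b p = false.
Proof.
apply/negP => occ_bp.
have exn : exists n : nat, occ true (n%:Z - N%:Z) || occ false (n%:Z - N%:Z).
  exists (absz (p + N%:Z)%R); have := occ_bound occ_bp => le_p.
  rewrite (_ : _ - _ = p); last by clear -le_p; lia.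
  by case: b occ_bp => ->; rewrite ?orbT.
have [n occ_n min_n] := ex_minnP exn.
have {min_n occ_n} [p0 [b0 occ0] min_p] : exists2 p0, exists b0, occ b0 p0 & forall b, ~ occ b (p0 - 1).
  exists (n%:Z - N%:Z); first by case/orP: occ_n; [exists true | exists false].
  move=> b' occ'; have le' := occ_bound occ'.
  have := min_n (absz (n%:Z - N%:Z - 1 + N%:Z)%R).
  rewrite (_ : (absz _)%:Z - _ = n%:Z - N%:Z - 1); last by clear -le'; lia.
  by case: b' occ' => ->; rewrite ?orbT => /(_ isT); clear -le'; lia.
clear b p occ_bp; have {b0 occ0} [b [occF muF occG muG]] : exists b, [/\ occ b p0,
    mu (row b (2 * p0)) = row b (2 * p0 + 1), occ (~~ b) p0 & mu (row (~~ b) (2 * p0)) = mid (2 * p0)].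
  have right c : occ c p0 -> mu (row c (2 * p0)) = row c (2 * p0 + 1) ->
      occ (~~ c) p0 /\ mu (row (~~ c) (2 * p0)) = mid (2 * p0).
    move=> o e; case: (into o) => [[/min_p//]|[[_ e']|//]].
    case: (@row_neq c (2 * p0)); apply: mu_inj; rewrite e.
    have -> : 2 * p0 + 2 = 2 * (p0 + 1) by clear; lia.
    by rewrite e'; congr (row c _); clear; lia.
  case: (out occ0) => [[_ e]|[[/min_p//]|[o e]]].
    by have [o' e'] := right _ occ0 e; exists b0.
  have cr : crossable by case: (b0) occ0 o => o1 o2; [apply: cross o1 | apply: cross o2].
  case: (out o) => [[_ e']|[[/min_p//]|[_ e']]].
    by exists (~~ b0); rewrite negbK.
  by case: cr => _ _ _ /(_ b0 (2 * p0)) []; apply: mu_inj; rewrite e e'.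
have [row_mid mid_neq mid_nb rowN] : crossable.
  by case: (b) occF occG => o1 o2; [apply: cross o1 | apply: cross o2].
pose F (j : nat) := row b (2 * (p0 + j%:Z)); pose G (j : nat) := row (~~ b) (2 * (p0 + j%:Z)).
have turnback j : occ b (p0 + j%:Z) -> mu (F j) = row b (2 * (p0 + j%:Z) + 1) -> occ b (p0 + j.+1%:Z).
  move=> o e; have ej : p0 + j.+1%:Z = p0 + j%:Z + 1 by clear; lia.
  case: (out o) => [[o' _]|[[_ e']|[_ e']]]; first by rewrite ej.
    case: (@row_neq b (2 * (p0 + j%:Z) - 1)); rewrite -e' -[mu _]/(mu (F j)) e; congr row; clear; lia.
  by case: (@row_mid b (2 * (p0 + j%:Z) + 1) (2 * (p0 + j%:Z))); rewrite -e -e'.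
(* k is where the path running right along row b leaves it; boundedness of [occ] forces it to do
   so. *)
have exk : exists k, mu (F k) != row b (2 * (p0 + k%:Z) + 1).
  have [/existsP[k ek]|/existsPn nk] :=
    boolP [exists k : 'I_(2 * N).+1, mu (F k) != row b (2 * (p0 + k%:Z) + 1)]; first by exists k.
  have occj j : (j <= (2 * N).+1)%N -> occ b (p0 + j%:Z).
    elim: j => [|j IH] lej; first by rewrite addr0.
    by apply: turnback; [apply: IH; apply: ltnW | have /negPn/eqP := nk (Ordinal lej)].
  by have := occ_bound (occj _ (leqnn _)); have := occ_bound occF; clear; lia.
have [k /eqP turn_k min_k] := ex_minnP exk.
have muFj j : (j < k)%N -> mu (F j) = row b (2 * (p0 + j%:Z) + 1).
  by move=> ltj; apply/eqP; apply: contraTT ltj => /min_k; rewrite -leqNgt.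
have occj j : (j <= k)%N -> occ b (p0 + j%:Z).
  elim: j => [|j IH] lej; first by rewrite addr0.
  by apply: turnback; [apply: IH; apply: ltnW | apply: muFj].
have k_gt0 : (0 < k)%N.
  by case: (k) turn_k => // []; rewrite /F addr0.
have turnF : mu (F k) = mid (2 * (p0 + k%:Z)).
  case: (out (occj _ (leqnn k))) => [[_ e]|[[_ e]|[_ e]]] //.
  have lt1 : (k.-1 < k)%N by rewrite prednK.
  case: (@row_neq b (2 * (p0 + k.-1%:Z))).
  rewrite -[LHS]/(F k.-1); apply: mu_inj; rewrite muFj // (_ : 2 * (p0 + k.-1%:Z) + 2 = 2 * (p0 + k%:Z)).
    by rewrite e; congr (row b _); clear -k_gt0; lia.
  by clear -k_gt0; lia.
(* For j < k the vertex [F j] is matched to the right, so position j of the other row is not entered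
   by crossing; since it is not entered from the left either, the arc comes from position j + 1. *)
have backG j : (0 < j <= k)%N -> occ (~~ b) (p0 + j%:Z) /\ mu (G j) = row (~~ b) (2 * (p0 + j%:Z) - 1).
  elim: j => // j IH /andP[_ ltjk].
  have ej : p0 + j.+1%:Z = p0 + j%:Z + 1 by clear; lia.
  have o : occ (~~ b) (p0 + j%:Z).
    by case: (j) IH ltjk => [|i] IH ltik; rewrite ?addr0 //; case: IH => //; rewrite (ltnW ltik).
  case: (into o) => [[o' e]|[[o' e]|[o' e]]].
  - case: (posnP j) => [j0|j_gt0]; first by move: o'; rewrite j0 addr0 => /min_p.
    have [|_ eG] := IH; first by rewrite j_gt0 ltnW.
    case: (@row_neq (~~ b) (2 * (p0 + j%:Z - 1))).
    apply: mu_inj; rewrite e (_ : 2 * (p0 + j%:Z - 1) + 2 = 2 * (p0 + j%:Z)); last by clear; lia.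
    by rewrite -[X in _ = mu X]/(G j) eG; congr (row _ _); clear; lia.
  - by rewrite /G ej; split=> //; rewrite e; congr (row _ _); clear; lia.
  case: (@row_mid b (2 * (p0 + j%:Z) + 1) (2 * (p0 + j%:Z))).
  by rewrite -e negbK -[RHS]/(mu (F j)) muFj.
(* Up to column 2(p0 + k) both rows are matched horizontally next to the middle vertices, which are
   thus forced into horizontal pairs from the left. The last pair would claim [mid (2 * (p0 + k))],
   already the partner of [F k]. *)
have pair j : (j < k)%N -> mu (mid (2 * (p0 + j%:Z) + 1)) = mid (2 * (p0 + j%:Z) + 2).
  elim: j => [|j IH] ltj.
    have G0 : mu (mid (2 * p0)) = row (~~ b) (2 * p0) by rewrite -muG muK.
    rewrite addr0; case: (mid_nb (2 * p0 + 1)) => [e|[e|[c e]]].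
    - case: (@row_mid (~~ b) (2 * p0) (2 * p0 + 1)); rewrite -G0; apply: mu_inj; rewrite muK e; congr mid; clear; lia.
    - by rewrite e; congr mid; clear; lia.
    have [ec|ec] : c = b \/ c = ~~ b by case: (c); case: (b); auto.
      case: (@row_mid b (2 * p0) (2 * p0 + 1)); apply: mu_inj.
      by rewrite muF e ec.
    have [|_ e1] := backG 1%N; first by rewrite k_gt0.
    case: (@row_mid (~~ b) (2 * (p0 + 1%:Z)) (2 * p0 + 1)); apply: mu_inj.
    by rewrite -[X in mu X = _]/(G 1%N) e1 e ec; congr (row _ _); clear; lia.
  have {}IH := IH (ltnW ltj).
  have ej : 2 * (p0 + j.+1%:Z) = 2 * (p0 + j%:Z) + 2 by clear; lia.
  case: (mid_nb (2 * (p0 + j.+1%:Z) + 1)) => [e|[e|[c e]]].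
  - case: (@mid_neq (2 * (p0 + j%:Z) + 1)); apply: mu_inj; rewrite IH.
    have -> : 2 * (p0 + j%:Z) + 1 + 2 = 2 * (p0 + j.+1%:Z) + 1 by clear; lia.
    by rewrite e; congr mid; clear; lia.
  - by rewrite e; congr mid; clear; lia.
  have [ec|ec] : c = b \/ c = ~~ b by case: (c); case: (b); auto.
    case: (@row_mid b (2 * (p0 + j.+1%:Z)) (2 * (p0 + j.+1%:Z) + 1)); apply: mu_inj.
    by rewrite -[X in mu X = _]/(F j.+1) muFj // e ec.
  have [|_ e1] := backG j.+2; first by rewrite ltj.
  case: (@row_mid (~~ b) (2 * (p0 + j.+2%:Z)) (2 * (p0 + j.+1%:Z) + 1)); apply: mu_inj.
  by rewrite -[X in mu X = _]/(G j.+2) e1 e ec; congr (row _ _); clear; lia.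
have lt1 : (k.-1 < k)%N by rewrite prednK.
case: (@row_mid b (2 * (p0 + k%:Z)) (2 * (p0 + k.-1%:Z) + 1)); apply: mu_inj.
rewrite (pair _ lt1) -[X in mu X = _]/(F k) turnF; congr mid; clear -k_gt0; lia.
Qed.
End Strip.

Lemma col_small m z w : col m z = col m w -> `|z - w| < (2 * m + 1)%N%:Z -> z = w.
Proof.
move=> /col_eqP[k ->]; rewrite (_ : w + _ - w = k * (2 * m + 1)%N%:Z); last by ring.
have := turn_cases m k; rewrite (_ : m.*2.+1 = 2 * m + 1)%N; last by clear; lia.
by move: (k * _) => kq; clear; lia.
Qed.

Lemma col_add m z w x : col m z = col m w -> col m (z + x) = col m (w + x).
Proof. by move=> /col_eqP[k ->]; rewrite addrAC colD. Qed.

(** * A fixed set in every other row, shifted by one column each time *)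

Section ManyRows.
Variables (n m r : nat) (kappa l : int).
Local Notation q := (2 * m + 1)%N.
Notation V := ('I_(2 * n) * 'I_q)%type.
Local Notation adj := (torus (2 * n) q r).
Hypotheses (n_gt0 : (0 < n)%N) (m_gt0 : (0 < m)%N).
Hypothesis prism : (n <= 1)%N -> r = q.
Hypothesis kappa_le : `|kappa| <= m%:Z.
Hypothesis kappaE : 2 * kappa = n.-1%:Z + r%:Z + l * q%:Z.

Fact even_row_subproof (a : 'I_n) : (2 * a < 2 * n)%N.
Proof. by rewrite ltn_pmul2l. Qed.
Definition even_row a : 'I_(2 * n) := Ordinal (even_row_subproof a).
Fact last_row_subproof : (2 * n - 1 < 2 * n)%N.
Proof. by move: n_gt0; clear; lia. Qed.
Definition last_row : 'I_(2 * n) := Ordinal last_row_subproof.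

Definition spot (a : 'I_n) (i : int) : V := (even_row a, col m (a%:Z + 2 * i)).

Lemma even_row_inj : injective even_row.
Proof. by move=> a b /(congr1 val) /= e; apply: val_inj; move: e; rewrite /=; clear; lia. Qed.

Lemma spot_inj a b i j : 0 <= i < m%:Z -> 0 <= j < m%:Z -> spot a i = spot b j -> a = b /\ i = j.
Proof.
move=> im jm /eqP; rewrite xpair_eqE => /andP[/eqP/even_row_inj <- /eqP/col_small e]; split=> //.
by have := e _; rewrite (_ : `|_| < _ = true) => [/(_ isT)|]; move: im jm; clear; lia.
Qed.

(* X takes the columns a, a+2, ..., a+2m-2 in row 2a. The shift by a makes
   vertical arcs possible only across the seam between rows 2n-1 and 0, where
   kappa is the offset between the half-columns of rows 0 and 2n-2. *)
Definition link (a b : 'I_n) (i j : int) (u : V) : Prop :=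
  (b = a /\ ((j = i + 1 /\ u = (even_row a, col m (a%:Z + (2 * i + 1)))) \/
             (j = i - 1 /\ u = (even_row a, col m (a%:Z + (2 * i - 1)))))) \/
  ((1 < n)%N /\ ((val a = n.-1 /\ val b = 0%N /\ j = i + kappa /\ u = (last_row, col m (n.-1%:Z + 2 * i))) \/
    (val a = 0%N /\ val b = n.-1 /\ i = j + kappa /\ u = (last_row, col m (n.-1%:Z + 2 * j))))).

Lemma linkP a b i j u : 0 <= i < m%:Z -> 0 <= j < m%:Z -> adj (spot a i) u -> adj u (spot b j) ->
  spot b j != spot a i -> link a b i j u.
Proof.
move=> im jm au ub neq.
have la := ltn_ord a; have lb := ltn_ord b.
move: au => /torus_nbr [|].
- move=> eu.
  have [w [ew lw]] : exists w, u = (even_row a, col m w) /\ (w = a%:Z + 2 * i + 1 \/ w = a%:Z + 2 * i - 1).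
    by case: eu => ->; eexists; split; auto.
  move: ub; rewrite ew => /torus_nbr [|] /=; last first.
    by case=> [[e _]|[[e _]|[[_ [e _]]|[e [_ _]]]]]; exfalso; move: e la lb n_gt0; clear; lia.
  rewrite /spot => eb.
  have [w' [/eqP ew' lw']] : exists w', (even_row b, col m (b%:Z + 2 * j)) == (even_row a, col m w') /\ (w' = w + 1 \/ w' = w - 1).
    by case: eb => ->; eexists; split; first [exact: eqxx | auto].
  move/eqP: ew'; rewrite xpair_eqE => /andP[/eqP/even_row_inj eba /eqP/esym/col_small e].
  left; split=> //; subst b; have {}e : w' = a%:Z + 2 * j.
    by apply: e; move: im jm lw lw'; clear; lia.
  have [ej|[ej|ej]] : (j = i \/ (j = i + 1 /\ w = a%:Z + (2 * i + 1)) \/ (j = i - 1 /\ w = a%:Z + (2 * i - 1))).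
  - by move: e lw lw'; clear; lia.
  - by case/eqP: neq; rewrite ej.
  - by left; case: ej => -> <-.
  by right; case: ej => -> <-.
(* Between consecutive even rows the columns differ by an odd number of absolute value less than q,
   hence never agree modulo q. *)
have far : col m (b%:Z + 2 * j) = col m (a%:Z + 2 * i) -> val b = (val a).+1 \/ val a = (val b).+1 -> False.
  move=> /col_small e lab; have := e _; move: im jm lab; clear; rewrite /=; lia.
have back : val b = val a -> col m (b%:Z + 2 * j) = col m (a%:Z + 2 * i) -> False.
  move=> e1 e2; case/eqP: neq; rewrite /spot e2; congr (_, _).
  by apply/val_inj; rewrite /= -[nat_of_ord b]/(val b) e1.
have flat x : (n <= 1)%N -> col m (x + r%:Z) = col m x.
  by move=> n1; rewrite prism // -[q%:Z]mul1r colD.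
(* The multiple of q in question is even and, since kappa is at most m in absolute value, smaller
   than 2q; as q is odd, it is 0. *)
have shift (A B i' j' : int) : A = n.-1%:Z -> B = 0 -> 0 <= i' < m%:Z -> 0 <= j' < m%:Z ->
    col m (B + 2 * j') = col m (A + 2 * i' + r%:Z) -> j' = i' + kappa.
  move=> -> -> im' jm' /col_eqP[k e]; have := turn_cases m (k - l).
  rewrite (_ : m.*2.+1 = 2 * m + 1)%N; last by clear; lia.
  have : (k - l) * q%:Z = 2 * (j' - i' - kappa).
    have -> : 2 * (j' - i' - kappa) = (0 + 2 * j') - 2 * i' - 2 * kappa by ring.
    by rewrite e kappaE; ring.
  by move: (_ * q%:Z) => kq; move: im' jm' kappa_le; clear; lia.
case: u ub => k c ub /= H.
case: H => [[h ec]|[[h ec]|[[h [h' ec]]|[h [h' ec]]]]]; last by exfalso; move: h n_gt0; clear; lia.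
- move: ub; rewrite ec => /torus_nbr [[] /(congr1 fst) /= e|/= [[g ed]|[[g ed]|[[g [g' ed]]|[g [g' ed]]]]]]; try (exfalso; move: h (congr1 (fun o : 'I__ => nat_of_ord o) e); clear; rewrite /=; lia).
  + by exfalso; apply: (far ed); left; move: h g; clear; rewrite /=; lia.
  + by exfalso; apply: (back _ ed); move: h g; clear; rewrite /=; lia.
  + by exfalso; move: h g; clear; lia.
  have [n1|n2] := leqP n 1.
    by exfalso; apply: back; [move: la lb n1; clear; rewrite /=; lia | rewrite ed flat].
  have ea : val a = n.-1 by move: h g n_gt0; clear; rewrite /=; lia.
  have eb : val b = 0%N by move: g'; clear; rewrite /=; lia.
  right; split=> //; left; split=> //; split=> //; split.
    by apply: (shift a%:Z b%:Z) => //; [rewrite -ea | rewrite -[nat_of_ord b]/(val b) eb].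
  rewrite -ea; congr (_, _); apply: val_inj; rewrite /=; exact: g.
- move: ub; rewrite ec => /torus_nbr [[] /(congr1 fst) /= e|/= [[g ed]|[[g ed]|[[g [g' ed]]|[g [g' ed]]]]]]; try (exfalso; move: h (congr1 (fun o : 'I__ => nat_of_ord o) e); clear; rewrite /=; lia).
  + by exfalso; apply: (back _ ed); move: h g; clear; rewrite /=; lia.
  + by exfalso; apply: (far ed); right; move: h g; clear; rewrite /=; lia.
  + by exfalso; move: h g; clear; lia.
  by exfalso; move: h g la; clear; lia.
move: ub; rewrite ec => /torus_nbr [[] /(congr1 fst) /= e|/= [[g ed]|[[g ed]|[[g [g' ed]]|[g [g' ed]]]]]]; try (exfalso; move: h' (congr1 (fun o : 'I__ => nat_of_ord o) e) n_gt0; clear; rewrite /=; lia).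
- by exfalso; move: h' g lb; clear; lia.
- have [n1|n2] := leqP n 1.
    exfalso; apply: back; first by move: la lb n1; clear; rewrite /=; lia.
    by rewrite ed -[LHS]flat // subrK.
  have ea : val a = 0%N by move: h; clear; rewrite /=; lia.
  have eb : val b = n.-1 by move: h' g; clear; rewrite /=; lia.
  right; split=> //; right; split=> //; split=> //; split.
    apply: (shift b%:Z a%:Z) => //; [by rewrite -eb | by rewrite -[nat_of_ord a]/(val a) ea |].
    by rewrite (col_add r%:Z ed) subrK.
  by rewrite -ed -eb; congr (_, _); apply: val_inj; rewrite /=; exact: h'.
- by exfalso; move: h' g n_gt0; clear; lia.
exfalso; apply: back; first by move: h g'; clear; rewrite /=; lia.
by rewrite ed subrK.
Qed.

Lemma col_step2 z : col m z <> col m (z + 2).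
Proof. by move=> /col_small e; have := e _; move: m_gt0; clear; lia. Qed.

Variable mu : V -> V.
Hypothesis muK : involutive mu.
Hypothesis adj_mu : forall v, adj v (mu v).

Section Closed.
Variables (C : {set V}) (s : V -> V).
Hypothesis CX : {in C, forall x, exists a (p : int), 0 <= p < m%:Z /\ x = spot a p}.
Hypothesis s_inj : {in C &, injective s}.
Hypothesis sP : {in C, forall x, [/\ s x \in C, s x != x & adj (mu x) (s x)]}.

Let occ a (p : int) := (0 <= p < m%:Z) && (spot a p \in C).

Let link_out a p : occ a p -> exists b j, occ b j /\ link a b p j (mu (spot a p)).
Proof.
case/andP=> pm xC; have [sC sx adj_s] := sP xC; have [b [j [jm es]]] := CX sC.
exists b, j; rewrite /occ jm -es sC; split=> //.
by apply: linkP; rewrite // -es.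
Qed.

Let link_into a p : occ a p -> exists b j, occ b j /\ link b a j p (mu (spot b j)).
Proof.
case/andP=> pm xC; have sC : s @: C = C.
  apply/eqP; rewrite eqEcard card_in_imset // leqnn andbT.
  by apply/subsetP => _ /imsetP[x /sP[sxC _ _] ->].
have /imsetP[y yC ey] : spot a p \in s @: C by rewrite sC.
have [b [j [jm eyj]]] := CX yC; have [_ sy adj_s] := sP yC.
exists b, j; rewrite /occ jm -eyj yC; split=> //.
by apply: linkP; rewrite // -?eyj // ey.
Qed.

(** Away from the seam arcs stay in their row, so this is [strip_empty] with the row [true] left
    empty. *)
Let occ_inner a p : ~ ((1 < n)%N /\ (val a = 0%N \/ val a = n.-1)) -> occ a p = false.
Proof.
move=> inner; apply: (@strip_empty _ mu (fun _ z => (even_row a, col m (a%:Z + z)))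
  (fun z => (even_row a, col m z)) (fun b p => ~~ b && occ a p) m muK _ _ _ _ _ false p).
- by move=> b j /andP[_ /andP[jm _]]; move: jm; clear; lia.
- by move=> b z /(congr1 snd) /=; rewrite addrA; apply: col_step2.
- move=> [] // j /= /link_out[b [i [oi [[eb [[ei eu]|[ei eu]]]|[n1 [[ea _]|[ea _]]]]]]].
  + by left; split; [rewrite -ei -eb | exact: eu].
  + by right; left; split; [rewrite -ei -eb | exact: eu].
  + by case: inner; split=> //; right.
  by case: inner; split=> //; left.
- move=> [] // j /= /link_into[b [i [oi [[eb [[ei eu]|[ei eu]]]|[n1 [[_ [ea _]]|[_ [ea _]]]]]]]].
  + have -> : j - 1 = i by rewrite ei addrK.
    by rewrite -eb in oi eu; left; split; [exact: oi | exact: eu].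
  + have -> : j + 1 = i by rewrite ei subrK.
    by rewrite -eb in oi eu; right; left; split; [exact: oi | exact: eu].
  + by case: inner; split=> //; left.
  by case: inner; split=> //; right.
by [].
Qed.

Fact pred_subproof : (n.-1 < n)%N. Proof. by rewrite ltn_predL. Qed.
Let last_a : 'I_n := Ordinal pred_subproof.
Let first_a : 'I_n := Ordinal n_gt0.

(** Columns are measured so that both rows meet the middle row 2n - 1 at equal z; for row 0 this
    costs the torsion r. *)
Definition seam_row (b : bool) (z : int) : V :=
  if b then (even_row first_a, col m (n.-1%:Z + z + r%:Z))
  else (even_row last_a, col m (n.-1%:Z + z)).
Arguments seam_row : simpl never.

(** Rows 2n - 2 and 0 form the strip around row 2n - 1. Positions in row 0 are shifted by kappa,
    whence the bound 2m on positions instead of m. *)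
Let occ_seam b p : (1 < n)%N -> (if b then occ first_a (p + kappa) else occ last_a p) = false.
Proof.
move=> n_gt1.
have firstE z : col m (n.-1%:Z + 2 * z + r%:Z) = col m (first_a%:Z + 2 * (z + kappa)).
  by rewrite -[RHS](colD _ _ (- l)) /=; congr col; rewrite mulrDr kappaE; ring.
have first_last a : val a = 0%N -> a = first_a by move=> e; apply: val_inj.
have is_last a : val a = n.-1 -> a = last_a by move=> e; apply: val_inj.
have fl : first_a <> last_a by move/(congr1 val) => /=; move: n_gt1; clear; lia.
pose mid z : V := (last_row, col m (n.-1%:Z + z)).
have rowT z : spot first_a (z + kappa) = seam_row true (2 * z).
  by rewrite /spot -firstE.
have rowS z e : (even_row first_a, col m (first_a%:Z + (2 * (z + kappa) + e))) = seam_row true (2 * z + e) :> V.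
  rewrite /seam_row addrA -(col_add e (firstE z)); congr (_, col m _); ring.
apply: (@strip_empty _ mu seam_row mid (fun b p => if b then occ first_a (p + kappa) else occ last_a p) (2 * m) muK).
- by move=> [] j /andP[jm _]; move: jm kappa_le; clear; lia.
- move=> [] z; rewrite /seam_row => /(congr1 snd) /=; rewrite addrA.
    by rewrite [_ + 2 + _]addrAC; apply: col_step2.
  exact: col_step2.
- move=> [] j /=.
    move=> /link_out[b' [i [oi [[eb [[ei eu]|[ei eu]]]|[_ [[ea _]|[_ [eb [ej eu]]]]]]]]].
    + by left; split; [rewrite addrAC -ei -eb | rewrite -rowT eu rowS].
    + by right; left; split; [rewrite addrAC -ei -eb | rewrite -rowT eu rowS].
    + by case: fl; rewrite -(is_last _ ea).
    have eji : j = i by apply: (addIr kappa).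
    by right; right; split; [rewrite eji -(is_last _ eb) | rewrite -rowT eu eji].
  move=> /link_out[b' [i [oi [[eb [[ei eu]|[ei eu]]]|[_ [[_ [eb [ei eu]]]|[ea _]]]]]]].
  + by left; split; [rewrite -ei -eb | exact: eu].
  + by right; left; split; [rewrite -ei -eb | exact: eu].
  + by right; right; split; [rewrite -ei -(first_last _ eb) | exact: eu].
  by case: fl; rewrite -(first_last _ ea).
- move=> [] j /=.
    move=> /link_into[b' [i [oi [[eb [[ei eu]|[ei eu]]]|[_ [[eb [_ [ej eu]]]|[_ [ea _]]]]]]]].
    + have ei' : i = j - 1 + kappa by rewrite addrAC ei addrK.
      by rewrite -eb in oi eu; left; split; [rewrite -ei' | rewrite -rowT -ei' eu ei' rowS].
    + have ei' : i = j + 1 + kappa by rewrite addrAC ei subrK.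
      by rewrite -eb in oi eu; right; left; split; [rewrite -ei' | rewrite -rowT -ei' eu ei' rowS].
    + have eij : i = j by apply: (addIr kappa).
      by rewrite (is_last _ eb) eij in oi eu; right; right; split; [exact: oi | exact: eu].
    by case: fl; rewrite -(is_last _ ea).
  move=> /link_into[b' [i [oi [[eb [[ei eu]|[ei eu]]]|[_ [[_ [ea _]]|[eb [_ [ei eu]]]]]]]]].
  + have -> : j - 1 = i by rewrite ei addrK.
    by rewrite -eb in oi eu; left; split; [exact: oi | exact: eu].
  + have -> : j + 1 = i by rewrite ei subrK.
    by rewrite -eb in oi eu; right; left; split; [exact: oi | exact: eu].
  + by case: fl; rewrite -(first_last _ ea).
  rewrite (first_last _ eb) ei in oi eu; right; right; split; [exact: oi | by rewrite -rowT].
move=> _ _; split.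
- by move=> [] z w /(congr1 fst)/(congr1 val) /=; move: n_gt0; clear; lia.
- by move=> z /(congr1 snd) /=; rewrite addrA; apply: col_step2.
- move=> z; have := adj_mu (mid z); rewrite {1}/mid => /torus_nbr [[e|e]|].
  + by right; left; rewrite e /mid addrA.
  + by left; rewrite e /mid addrA.
  case: (mu _) => k c /= [[e _]|[[e ->]|[[e _]|[e [e0 ->]]]]].
  + by exfalso; have := ltn_ord k; move: e; clear; lia.
  + right; right; exists false; congr (_, _); apply: val_inj; rewrite /=.
    by move: e n_gt0; clear; lia.
  + by exfalso; move: e n_gt0; clear; lia.
  right; right; exists true; congr (_, _); apply: val_inj; rewrite /=.
  by move: e0; clear; lia.
by move=> [] z /(congr1 fst)/(congr1 val) /=; move: n_gt1; clear; lia.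
Qed.

Lemma closed_empty : C = set0.
Proof.
apply/setP => x; rewrite inE; apply/negP => xC; have [a [p [pm ex]]] := CX xC.
have oa : occ a p by rewrite /occ pm -ex.
have [n1|n1] := leqP n 1.
  by suff : occ a p = false; [rewrite oa | apply: occ_inner => -[]; rewrite ltnNge n1].
have [a0|a0] := eqVneq (val a) 0%N.
  by have := @occ_seam true (p - kappa) n1; rewrite subrK (_ : first_a = a) ?oa //; apply: val_inj.
have [al|al] := eqVneq (val a) n.-1.
  by have := @occ_seam false p n1; rewrite (_ : last_a = a) ?oa //; apply: val_inj.
suff : occ a p = false by rewrite oa.
by apply: occ_inner => -[_ [] /eqP]; apply/negP.
Qed.
End Closed.

Lemma many_rows : exists2 X : {set V}, (n * m <= #|X|)%N & alternation_free adj mu X.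
Proof.
exists [set spot u.1 (val u.2)%:Z | u : 'I_n * 'I_m].
  rewrite card_imset ?card_prod ?card_ord // => -[a i] [b j] /= /spot_inj [||-> e] //.
  - exact: ltn_ord.
  - exact: ltn_ord.
  by congr (_, _); apply: val_inj; move: e => [].
split=> [_ _ /imsetP[[a i] _ ->] /imsetP[[b j] _ ->]|C s CX injs sP].
  apply/negP => /= /torus_nbr [e|/= H]; last first.
    by have := ltn_ord a; have := ltn_ord b; move: H n_gt0; clear; lia.
  have [w ew /col_small e2] : exists2 w, w = a%:Z + 2 * i%:Z + 1 \/ w = a%:Z + 2 * i%:Z - 1 & col m (a%:Z + 2 * j%:Z) = col m w.
    by case: e => /eqP; rewrite xpair_eqE => /andP[/eqP/even_row_inj <- /eqP ec];
      [exists (b%:Z + 2 * i%:Z + 1) | exists (b%:Z + 2 * i%:Z - 1)]; auto.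
  by have := e2 _; have := ltn_ord i; have := ltn_ord j; move: ew; clear; lia.
apply: closed_empty injs sP => x /(subsetP CX)/imsetP[[a i] _ ->].
by exists a, (val i)%:Z; split=> //; exact: ltn_ord.
Qed.
End ManyRows.

Close Scope ring_scope.

Lemma large_alternation_free (n m r : nat) (mu : 'I_(2 * n) * 'I_(2 * m + 1) -> 'I_(2 * n) * 'I_(2 * m + 1)) :
  0 < n -> 0 < m -> 0 < r <= 2 * m + 1 -> involutive mu ->
  (forall v, torus (2 * n) (2 * m + 1) r v (mu v)) ->
  exists2 X : {set 'I_(2 * n) * 'I_(2 * m + 1)}, n * m <= #|X| &
    alternation_free (torus (2 * n) (2 * m + 1) r) mu X.
Proof.
move=> n_gt0 m_gt0 /andP[r_gt0 r_le] muK adj_mu.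
have [rows|/negP rows] := boolP ((1 < n) || (r == 2 * m + 1)).
  have prism : n <= 1 -> r = 2 * m + 1 by move=> n1; apply/eqP; move: rows; rewrite ltnNge n1.
  pose c := (n.-1 + r) %% (2 * m + 1); pose d := ((n.-1 + r) %/ (2 * m + 1)).
  have ec : n.-1 + r = d * (2 * m + 1) + c := divn_eq _ _.
  have ltc : c < 2 * m + 1 by rewrite ltn_mod addn1.
  (* Half of n - 1 + r modulo the odd number q: an odd residue c is replaced by c - q before
     halving, which also keeps kappa between -m and m. *)
  pose kappa : int := if odd c then (c./2%:Z - m%:Z)%R else (c./2%:Z)%R.
  pose l : int := if odd c then (- d%:Z - 1)%R else (- d%:Z)%R.
  have kappa_le : (`|kappa| <= m%:Z)%R by rewrite /kappa; case: ifP; move: ltc; clear; lia.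
  have kappaE : (2 * kappa = n.-1%:Z + r%:Z + l * (2 * m + 1)%N%:Z)%R.
    rewrite -PoszD ec PoszD PoszM; have [Q eQ] : exists Q, Q = 2 * m + 1 by exists (2 * m + 1).
    rewrite -eQ.
    rewrite /kappa /l; have := odd_double_half c; case: ifP => oc; rewrite ?add1n ?add0n => e2.
      rewrite mulrBl mulNr mul1r; move: (d%:Z * Q%:Z)%R => dQ; move: e2 eQ; clear; lia.
    rewrite mulNr; move: (d%:Z * Q%:Z)%R => dQ; move: e2; clear; lia.
  exact: (many_rows n_gt0 m_gt0 prism kappa_le kappaE muK adj_mu).
have n1 : n = 1 by apply/eqP; rewrite eqn_leq n_gt0 andbT leqNgt; apply/negP => n1; apply: rows; rewrite n1.
have r_neq : r <> 2 * m + 1 by move=> e; apply: rows; rewrite e eqxx orbT.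
(* Half of q - r or of -r, whichever is even; r < q makes it nonzero. *)
subst n; pose c : int := if odd r then (((2 * m + 1 - r)./2)%N%:Z)%R else (- (r./2)%:Z)%R.
have t_gt0 : (0 < `|c|)%N by rewrite /c; case: ifP; move: r_gt0 r_le r_neq; clear; lia.
have le_tm : (`|c| <= m)%N by rewrite /c; case: ifP; move: r_gt0 r_le r_neq; clear; lia.
have rc : exists k, (r%:Z + 2 * c = k * (2 * m + 1)%N%:Z)%R.
  rewrite /c; case: ifP => odd_r; [exists 1%R; rewrite mul1r | exists 0%R; rewrite mul0r];
    by move: odd_r r_le; clear; lia.
by have := two_rows t_gt0 le_tm rc muK adj_mu; rewrite mul1n.
Qed.

Theorem theorem3p1 (n m r : nat) (n_ge1 : 1 <= n) (m_ge1 : 1 <= m)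
    (r_ge1 : 1 <= r) (r_le : r <= 2 * m + 1) :
  max_forcing_number (torus (2 * n) (2 * m + 1) r) = (m + 1) * n.
Proof.
have sym := @torus_sym (2 * n) (2 * m + 1) r.
have irr : irreflexive (torus (2 * n) (2 * m + 1) r) by apply: torus_irrefl; lia.
have r_range : 0 < r <= 2 * m + 1 by rewrite r_ge1.
apply/eqP; rewrite eqn_leq; apply/andP; split.
  apply/bigmax_leqP => M /(partner_exists sym irr)[mu [muK adj_mu ->]].
  have [X leX freeX] := large_alternation_free n_ge1 m_ge1 r_range muK adj_mu.
  have := forcing_number_acyclic sym irr muK adj_mu freeX.
  (* The matching has n(2m+1) edges, and n(2m+1) - nm = (m+1)n. *)
  have := card_matching irr muK adj_mu; rewrite card_prod !card_ord.
  by move: leX; move: #|X| #|_| (forcing_number _ _) => x M' f; clear; nia.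
have pM := matching_of_perfect (@rungK n m) (@adj_rung n m r).
have [S fS cS] := forcing_number_attained pM.
rewrite [(m + 1) * n]mulnC [m + 1]addn1; apply: leq_trans (leq_bigmax_cond _ pM).
by rewrite -cS; apply: forcing_rungs fS.
Qed.
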